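(* Let $f=(f_1,\dots,f_n)$ be an $n$-tuple of formal power series in the set $\mathcal M_{rad}^b$ or $\mathcal M_{rad}\cap\mathcal M^{||}$ and let $g=(g_1,\dots,g_n)$ be its inverse with respect to the composition. If $\mathcal H$ is a Hilbert space and $T=(T_1,\dots,T_n)$ is in the noncommutative domain $\mathbb B_f(\mathcal H)$, then $T$ has a minimal dilation, which is unique up to an isomorphism. Moreover, its minimal dilation coincides with $(g_1(W),\dots,g_n(W))$, where $W=(W_1,\dots,W_n)$ is the minimal isometric dilation of the row contraction $(f_1(T),\dots,f_n(T))$ on a Hilbert space $\mathcal K\supseteq\mathcal H$.
   Context: Words and series. $\mathbb F_n^+$ is the free semigroup of words in the letters $1,\dots,n$, with empty word $\varnothing$; $|\alpha|$ is the length of $\alpha$. For an $n$-tuple $Y=(Y_1,\dots,Y_n)$ of elements of a unital algebra, $Y_\alpha:=Y_{i_1}\cdots Y_{i_k}$ if $\alpha=i_1\cdots i_k$, and $Y_\varnothing:=1$. Power series are formal power series $\psi=\sum_\alpha a_\alpha Z_\alpha$ with complex coefficients in noncommuting indeterminates $Z_1,\dots,Z_n$. For $Y\in B(\mathcal H)^n$ put $\psi(Y):=\sum_{k\ge0}\sum_{|\alpha|=k}a_\alpha Y_\alpha$ (series over $k$); $\mathcal C_\psi(\mathcal H)$ (resp. $\mathcal C_\psi^{SOT}(\mathcal H)$) is the set of $Y$ for which this converges in norm (resp. in the strong operator topology, SOT). $\mathcal C_\psi^{rad}(\mathcal H)$ is the set of $Y$ for which there is $\delta\in(0,1)$ with $rY\in\mathcal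 C_\psi(\mathcal H)$ for $r\in(\delta,1)$ and $\text{SOT-}\lim_{r\to1}\psi(rY)$ exists; then $\psi(Y)$ denotes this limit. For an $n$-tuple $f=(f_1,\dots,f_n)$ of power series these conditions are required for every $f_i$; $f(Y)=(f_1(Y),\dots,f_n(Y))$ is also regarded as a row operator $\mathcal H^{(n)}\to\mathcal H$, where $\mathcal H^{(n)}$ is the direct sum of $n$ copies of $\mathcal H$. $[B(\mathcal H)^n]_r:=\{X\in B(\mathcal H)^n:\|\sum_iX_iX_i^*\|^{1/2}<r\}$. A free holomorphic function on $[B(\mathcal H)^n]_\gamma$ is (the evaluation map of) a power series with $\limsup_k(\sum_{|\alpha|=k}|a_\alpha|^2)^{1/2k}\le1/\gamma$. Model property. $\mathbb H^2(f)$ denotes the Hilbert space with orthonormal basis $\{f_\alpha\}_{\alpha\in\mathbb F_n^+}$ ($f_\varnothing=1$), whose elements are the series $\sum_\alpha c_\alpha f_\alpha$, $\sum|c_\alpha|^2<\infty$. $f$ has the model property ($f\in\mathcal M$) if one of the following holds. ($\mathcal A$) $f$ is an $n$-tuple of noncommutative polynomials and there is an $n$-tuple $q$ of polynomials with $f\circ q=q\circ f=\mathrm{id}$. ($\mathcal S$) $f(0)=0$, each $f_i$ has nonzero radius of convergence, the matrix of linear coefficients of $f$ is invertible ($\det J_f(0)\ne0$; then elements of $\mathbb H^2(f)$ are formal power series), $Z_1,\dots,Z_n\in\mathbb H^2(f)$, each $M_{Z_i}\psi:=Z_i\psi$ is a bounded operator on $\mathbb H^2(f)$, and $M_{f_j}=f_j(M_{Z_1},\dots,M_{Z_n})$,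 where $M_{f_j}\psi:=f_j\psi$ and $(M_{Z_1},\dots,M_{Z_n})$ is in $\mathcal C_f^{SOT}(\mathbb H^2(f))$ or $\mathcal C_f^{rad}(\mathbb H^2(f))$. ($\mathcal F$) for some $\gamma>0$, $f$ is an $n$-tuple of free holomorphic functions on $[B(\mathcal H)^n]_\gamma$ ($\mathcal H$ infinite dimensional) with range in $[B(\mathcal H)^n]_1$, there is no nonzero free holomorphic $G$ on $[B(\mathcal H)^n]_1$ with $G\circ f=0$ (then $\mathbb H^2(f)=\{G\circ f: G=\sum c_\alpha Z_\alpha,\ \sum|c_\alpha|^2<\infty\}$), the coordinate functions lie in $\mathbb H^2(f)$, and the boundedness of $M_{Z_i}$ and $M_{f_j}=f_j(M_{Z_1},\dots,M_{Z_n})$ hold as in ($\mathcal S$). The universal model of $\mathbb B_f$ is $M_Z=(M_{Z_1},\dots,M_{Z_n})$. Writing $Z_i=\sum_\alpha a_\alpha^{(i)}f_\alpha$ in $\mathbb H^2(f)$, the inverse of $f$ under composition is $g=(g_1,\dots,g_n)$, $g_i:=\sum_\alpha a^{(i)}_\alpha Z_\alpha$ (so $g\circ f=\mathrm{id}$). Domain. $\mathbb B_f(\mathcal H)$ is the set of $X\in B(\mathcal H)^n$ with $X\in\mathcal C_f^{SOT}(\mathcal H)$ or $X\in\mathcal C_f^{rad}(\mathcal H)$, $\|f(X)\|\le1$ and $g(f(X))=X$, meaning that either $X_i=\sum_k\sum_{|\alpha|=k}a_\alpha^{(i)}[f(X)]_\alpha$ (SOT convergence) for all $i$, or $X_i=\text{SOT-}\lim_{r\to1}\sum_k\sum_{|\alpha|=k}a_\alpha^{(i)}r^{|\alpha|}[f(X)]_\alpha$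 for all $i$. Classes. With $f_i=\sum_\alpha b_\alpha^{(i)}Z_\alpha$: $f\in\mathcal M^b$ means $f\in\mathcal M$ and either $M_Z\in\mathcal C_f^{SOT}(\mathbb H^2(f))$ and $\sup_m\|\sum_{|\alpha|\le m}b^{(i)}_\alpha(M_Z)_\alpha\|<\infty$ for all $i$, or $M_Z\in\mathcal C_f^{rad}(\mathbb H^2(f))$ and $\sup_{r\in[0,1)}\|\sum_k\sum_{|\alpha|=k}b^{(i)}_\alpha r^{|\alpha|}(M_Z)_\alpha\|<\infty$ for all $i$. $f\in\mathcal M^{||}$ means $f\in\mathcal M$ and either the series $f_i(M_Z)$ converge in norm, or $f_i(rM_Z)$ converges in norm for $r<1$ close to $1$ and $f_i(M_Z)=\lim_{r\to1}f_i(rM_Z)$ in norm. $f\in\mathcal M_{rad}$ (radial approximation property), resp. $f\in\mathcal M_{rad}^b$, means that there is $\delta\in(0,1)$ such that $rf=(rf_1,\dots,rf_n)\in\mathcal M$, resp. $rf\in\mathcal M^b$, for every $r\in(\delta,1]$. When $f\in\mathcal M_{rad}$ the $g_i$ are free holomorphic on $[B(\mathcal H)^n]_\gamma$ for some $\gamma>1$, so $g_i(W)$ is a norm-convergent series. Dilations. $C^*(M_{Z_1},\dots,M_{Z_n})$ is the $C^*$-algebra generated by $M_{Z_1},\dots,M_{Z_n}$ and the identity. A minimal dilation of $T\in\mathbb B_f(\mathcal H)$ is an $n$-tuple $V=(V_1,\dots,V_n)$ of operators on a Hilbert space $\mathcal K\supseteq\mathcal H$ such that: (i) $V\in\mathbb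 B_f(\mathcal K)$; (ii) there is a unital $*$-representation $\pi:C^*(M_{Z_1},\dots,M_{Z_n})\to B(\mathcal K)$ with $\pi(M_{Z_i})=V_i$ for all $i$; (iii) $V_i^*|_{\mathcal H}=T_i^*$ for all $i$; (iv) $\mathcal K=\bigvee_{\alpha\in\mathbb F_n^+}V_\alpha\mathcal H$ (closed linear span). Uniqueness up to isomorphism: for two minimal dilations $V$ on $\mathcal K$ and $V'$ on $\mathcal K'$ there is a unitary $U:\mathcal K\to\mathcal K'$ with $U|_{\mathcal H}=I_{\mathcal H}$ and $UV_i=V_i'U$ for all $i$. The minimal isometric dilation $W$ of the row contraction $f(T)$ is an $n$-tuple on $\mathcal K\supseteq\mathcal H$ with $W_i^*W_j=\delta_{ij}I_{\mathcal K}$, $W_i^*|_{\mathcal H}=f_i(T)^*$, and $\mathcal K=\bigvee_\alpha W_\alpha\mathcal H$ (it exists and is unique up to isomorphism). *)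

(* Defs.v *)
From HB Require Import structures.
From mathcomp Require Import all_boot all_order all_algebra.
From mathcomp Require Import sesquilinear complex.
From mathcomp Require Import all_classical all_reals all_analysis.

Set Implicit Arguments.
Unset Strict Implicit.
Unset Printing Implicit Defensive.

Import Order.TTheory GRing.Theory Num.Theory.
Import numFieldNormedType.Exports.

Local Open Scope classical_set_scope.
Local Open Scope complex_scope.
Local Open Scope ring_scope.

(* The inner product is linear in its first argument and conjugate-linear in
   its second one. *)
HB.mixin Record isHilbert (R : realType) H & CompleteNormedModule R[i] H := {
  hdot : {dot H for (@Num.conj R[i])} ;
  normr_hdot : forall x : H, `|x| ^+ 2 = hdot x x }.

#[short(type="hilbertType")]
HB.structure Definition Hilbert (R : realType) :=
  {H of CompleteNormedModule R[i] H & isHilbert R H}.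

Notation word n := (seq 'I_n).

Section Operators.
Context {R : realType}.
Implicit Types H K : hilbertType R.

Definition bounded_op H K (T : H -> K) : Prop :=
  linear T /\ exists M : R, forall x, `|T x| <= M%:C * `|x|.

Definition opnorm H K (T : H -> K) : R :=
  sup [set complex.Re `|T x| | x in [set x : H | `|x| <= 1]].

(* By Riesz representation, exactly one S qualifies when T is bounded. *)
Definition adj H (T : H -> H) : H -> H :=
  get [set S : H -> H | forall x y, hdot (T x) y = hdot x (S y)].

Definition norm_cvg H K (I : Type) (F : set_system I)
    (T : I -> H -> K) (A : H -> K) : Prop :=
  opnorm (T i - A) @[i --> F] --> (0 : R).

Definition sot_cvg H K (I : Type) (F : set_system I)
    (T : I -> H -> K) (A : H -> K) : Prop :=
  forall x, T i x @[i --> F] --> A x.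

Definition is_subspace H (S : set H) : Prop :=
  S 0 /\ forall (a : R[i]) x y, S x -> S y -> S (a *: x + y).

Definition closed_span H (A : set H) : set H :=
  \bigcap_(S in [set S | [/\ is_subspace S, closed S & A `<=` S]]) S.

Definition infinite_dim H : Prop :=
  forall (m : nat) (v : 'I_m -> H),
    exists x, forall c : 'I_m -> R[i], x <> \sum_i c i *: v i.

Definition orthonormal_basis (I : eqType) H (e : I -> H) : Prop :=
  (forall a b, hdot (e a) (e b) = (a == b)%:R) /\
  closed_span (range e) = setT.

Definition isometric H K (J : H -> K) : Prop :=
  linear J /\ forall x y, hdot (J x) (J y) = hdot x y.

Definition unitary H K (U : H -> K) : Prop :=
  isometric U /\ range U = setT.

Definition Cstar_subalgebra H (S : set (H -> H)) : Prop :=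
  [/\ S `<=` bounded_op (K:=H), S id,
      forall (a : R[i]) A B, S A -> S B -> S (a *: A + B),
      forall A B, S A -> S B -> S (A \o B) &
      (forall A, S A -> S (adj A)) /\
      (forall (A : nat -> H -> H) B, (forall m, S (A m)) -> bounded_op B ->
         norm_cvg \oo A B -> S B)].

Definition Cstar_generated (I : Type) H (M : I -> H -> H) : set (H -> H) :=
  \bigcap_(S in [set S | Cstar_subalgebra S /\ forall i, S (M i)]) S.

Definition unital_star_rep H K (A : set (H -> H))
    (pi : (H -> H) -> (K -> K)) : Prop :=
  [/\ forall a, A a -> bounded_op (pi a),
      pi id = id,
      forall (c : R[i]) a b, A a -> A b -> pi (c *: a + b) = c *: pi a + pi b,
      forall a b, A a -> A b -> pi (a \o b) = pi a \o pi b &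
      forall a, A a -> pi (adj a) = adj (pi a)].

End Operators.

(* Formal power series in n noncommuting indeterminates, as coefficient
   families. *)
Definition ncseries (R : realType) (n : nat) : Type := word n -> R[i].

Section FormalSeries.
Context {R : realType} {n : nat}.
Implicit Types (psi phi c : ncseries R n) (f q : 'I_n -> ncseries R n).

Definition pone : ncseries R n := fun a => (a == [::])%:R.
Definition pvar (i : 'I_n) : ncseries R n := fun a => (a == [:: i])%:R.
Definition pmul psi phi : ncseries R n := fun a =>
  \sum_(k < (size a).+1) psi (take k a) * phi (drop k a).
Definition pword f (a : word n) : ncseries R n :=
  foldr (fun i p => pmul (f i) p) pone a.
Definition pscale (r : R) f : 'I_n -> ncseries R n := fun i a => r%:C * f i a.

Definition pcomp_upto (m : nat) c f : ncseries R n := fun b =>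
  \sum_(k < m) \sum_(a : k.-tuple 'I_n) c a * pword f a b.

Definition deg_lt (N : nat) c : Prop := forall a, (N <= size a)%N -> c a = 0.
Definition is_poly c : Prop := exists N, deg_lt N c.

(* "c is a polynomial and its composition with f is s" *)
Definition poly_comp c f (s : ncseries R n) : Prop :=
  exists2 N, deg_lt N c & pcomp_upto N c f = s.

(* Composition of series when f has no constant terms: a word a contributes to
   the coefficient of b only if size a <= size b. *)
Definition series_comp c f : ncseries R n := fun b => pcomp_upto (size b).+1 c f b.

(* limsup_k (\sum_(|a| = k) |psi_a|^2)^(1/2k) <= 1/gamma *)
Definition free_holo (gamma : R) psi : Prop :=
  (limn_esup (fun k : nat =>
     ((\sum_(a : k.-tuple 'I_n) complex.Re `|psi a| ^+ 2)
        `^ ((2 * k)%:R^-1))%:E) <= (gamma^-1)%:E)%E.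

Definition linear_coefs f : 'M[R[i]]_n := \matrix_(i, j) f i [:: j].

End FormalSeries.

Section Evaluation.
Context {R : realType} {n : nat} {H : hilbertType R}.
Implicit Types (psi : ncseries R n) (f : 'I_n -> ncseries R n).
Implicit Types (Y X F : 'I_n -> H -> H) (A : H -> H).

Definition opword Y (a : word n) : H -> H :=
  foldr (fun i A => Y i \o A) id a.

Definition opscale (r : R) Y : 'I_n -> H -> H := fun i => r%:C *: Y i.

Definition psum psi Y (m : nat) : H -> H :=
  \sum_(k < m) \sum_(a : k.-tuple 'I_n) psi a *: opword Y a.

(* Y belongs to C_psi, C_psi^SOT or C_psi^rad respectively, and psi(Y) = A *)
Definition sum_norm psi Y A : Prop :=
  bounded_op A /\ norm_cvg \oo (psum psi Y) A.
Definition sum_sot psi Y A : Prop :=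
  bounded_op A /\ sot_cvg \oo (psum psi Y) A.
Definition sum_rad psi Y A : Prop :=
  bounded_op A /\
  exists delta : R, exists B : R -> H -> H,
    [/\ 0 < delta < 1,
        forall r, delta < r < 1 -> sum_norm psi (opscale r Y) (B r) &
        sot_cvg (1 : R)^'- B A].

(* Y belongs to C_f^SOT or C_f^rad, and f(Y) = F; the two values agree when
   both are defined, by Abel summation. *)
Definition evals f Y F : Prop :=
  (forall i, sum_sot (f i) Y (F i)) \/ (forall i, sum_rad (f i) Y (F i)).

Definition op_ball (r : R) : set ('I_n -> H -> H) :=
  [set X | (forall i, bounded_op (X i)) /\
           Num.sqrt (opnorm (\sum_i (X i \o adj (X i)))) < r].

(* The row operator (x_1, ..., x_n) |-> \sum_i F_i x_i on the direct sum of n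
   copies of H has norm at most 1. *)
Definition row_contraction F : Prop :=
  forall x : 'I_n -> H, `|\sum_i F i (x i)| ^+ 2 <= \sum_i `|x i| ^+ 2.

(* X is in B_f(H), where g is the inverse of f. *)
Definition in_domain f (g : 'I_n -> ncseries R n) X : Prop :=
  (forall i, bounded_op (X i)) /\
  exists F, [/\ evals f X F, row_contraction F & evals g F X].

End Evaluation.

(* H^2(f) is any Hilbert space E with an orthonormal basis e indexed by words,
   e a standing for f_a: a vector psi of E stands for the series
   \sum_a (coords e psi a) f_a.  Below, z i is the vector of E standing for
   the indeterminate Z_i, and MZ i is the operator M_{Z_i} on E. *)
Section Model.
Context {R : realType} {n : nat} {E : hilbertType R}.
Variables (f : 'I_n -> ncseries R n).
Variables (e : word n -> E) (z : 'I_n -> E) (MZ : 'I_n -> E -> E).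

Definition coords (psi : E) : ncseries R n := fun a => hdot psi (e a).

Definition inverse_series : 'I_n -> ncseries R n := fun i => coords (z i).

(* M_{Z_i} is determined by its values on the span of the f_a, which consists
   of polynomials. *)
Definition model_A : Prop :=
  [/\ forall i, is_poly (f i),
      exists q : 'I_n -> ncseries R n, forall i,
        poly_comp (f i) q (pvar i) /\ poly_comp (q i) f (pvar i),
      forall i, poly_comp (coords (z i)) f (pvar i),
      forall i, bounded_op (MZ i) &
      forall i psi s, poly_comp (coords psi) f s ->
        poly_comp (coords (MZ i psi)) f (pmul (pvar i) s)].

Definition model_S : Prop :=
  [/\ (forall i, f i [::] = 0) /\
      (forall i, exists2 gamma : R, 0 < gamma & free_holo gamma (f i)),
      \det (linear_coefs f) != 0,
      forall i, series_comp (coords (z i)) f = pvar i,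
      (forall i, bounded_op (MZ i)) /\
      (forall i psi, series_comp (coords (MZ i psi)) f =
                     pmul (pvar i) (series_comp (coords psi) f)) &
      exists2 Mf : 'I_n -> E -> E, evals f MZ Mf &
        forall j psi, series_comp (coords (Mf j psi)) f =
                      pmul (f j) (series_comp (coords psi) f)].

(* fX stands for f(X); elements of H^2(f) are functions of X in the ball of
   radius gamma of a fixed infinite dimensional Hilbert space, the element psi
   taking at X the value of its coordinate series at f(X). *)
Definition model_F : Prop :=
  exists (gamma : R) (H : hilbertType R),
  let f_at X (fX : 'I_n -> H -> H) :=
    op_ball gamma X /\ forall i, sum_norm (f i) X (fX i) in
  [/\ 0 < gamma /\ infinite_dim H,
      (forall i, free_holo gamma (f i)) /\
      (forall X : 'I_n -> H -> H, op_ball gamma X ->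
         exists2 fX, f_at X fX & op_ball 1 fX),
      forall G : ncseries R n, free_holo 1 G ->
        (forall X fX, f_at X fX -> sum_norm G fX 0) -> forall a, G a = 0,
      forall i X fX, f_at X fX -> sum_norm (coords (z i)) fX (X i) &
      [/\ forall i, bounded_op (MZ i),
          forall i psi X fX A, f_at X fX -> sum_norm (coords psi) fX A ->
            sum_norm (coords (MZ i psi)) fX (X i \o A) &
          exists2 Mf : 'I_n -> E -> E, evals f MZ Mf &
            forall j psi X fX A, f_at X fX -> sum_norm (coords psi) fX A ->
              sum_norm (coords (Mf j psi)) fX (fX j \o A)]].

Definition model : Prop :=
  orthonormal_basis e /\ [\/ model_A, model_S | model_F].

Definition bounded_model : Prop :=
  ((exists F, forall i, sum_sot (f i) MZ (F i)) /\
   forall i, exists C : R, forall m, opnorm (psum (f i) MZ m) <= C) \/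
  ((exists F, forall i, sum_rad (f i) MZ (F i)) /\
   forall i, exists C : R, forall r : R, 0 <= r < 1 ->
     exists2 A, sum_norm (f i) (opscale r MZ) A & opnorm A <= C).

Definition norm_model : Prop :=
  (exists F, forall i, sum_norm (f i) MZ (F i)) \/
  (exists F, evals f MZ F /\ forall i,
     exists delta : R, exists B : R -> E -> E,
       [/\ 0 < delta < 1,
           forall r, delta < r < 1 -> sum_norm (f i) (opscale r MZ) (B r) &
           norm_cvg (1 : R)^'- B (F i)]).

End Model.

Section Classes.
Context {R : realType} {n : nat}.
Implicit Types f : 'I_n -> ncseries R n.

Definition in_M f : Prop :=
  exists (E : hilbertType R) (e : word n -> E) z MZ, model f e z MZ.

Definition in_Mb f : Prop :=
  exists (E : hilbertType R) (e : word n -> E) z MZ,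
    model f e z MZ /\ bounded_model f MZ.

Definition in_Mnorm f : Prop :=
  exists (E : hilbertType R) (e : word n -> E) z MZ,
    model f e z MZ /\ norm_model f MZ.

Definition in_Mrad f : Prop :=
  exists2 delta : R, 0 < delta < 1 &
    forall r, delta < r <= 1 -> in_M (pscale r f).

Definition in_Mradb f : Prop :=
  exists2 delta : R, 0 < delta < 1 &
    forall r, delta < r <= 1 -> in_Mb (pscale r f).

End Classes.

(* The inclusion of H in K is an isometric linear map J. *)
Section Dilations.
Context {R : realType} {n : nat} {E H K : hilbertType R}.

Definition coextends (T : 'I_n -> H -> H) (J : H -> K) (V : 'I_n -> K -> K) :=
  forall i h, adj (V i) (J h) = J (adj (T i) h).

Definition cyclic_for (J : H -> K) (V : 'I_n -> K -> K) : Prop :=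
  closed_span (\bigcup_(a : word n) range (opword V a \o J)) = setT.

Definition minimal_dilation (f g : 'I_n -> ncseries R n) (MZ : 'I_n -> E -> E)
    (T : 'I_n -> H -> H) (J : H -> K) (V : 'I_n -> K -> K) : Prop :=
  [/\ isometric J,
      in_domain f g V,
      exists pi : (E -> E) -> (K -> K),
        unital_star_rep (Cstar_generated MZ) pi /\ forall i, pi (MZ i) = V i,
      coextends T J V &
      cyclic_for J V].

Definition minimal_isometric_dilation (F : 'I_n -> H -> H)
    (J : H -> K) (W : 'I_n -> K -> K) : Prop :=
  [/\ isometric J,
      forall i, bounded_op (W i),
      forall i j x, adj (W i) (W j x) = (i == j)%:R *: x,
      coextends F J W &
      cyclic_for J W].

End Dilations.

(* The unitary fixes H: it intertwines the two inclusions of H. *)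
Definition dilations_isomorphic (R : realType) (n : nat) (H K K' : hilbertType R)
    (J : H -> K) (V : 'I_n -> K -> K) (J' : H -> K') (V' : 'I_n -> K' -> K') :=
  exists U : K -> K', [/\ unitary U, forall h, U (J h) = J' h &
    forall i x, U (V i x) = V' i (U x)].

(* Main.v *)
Require Import Defs.
From HB Require Import structures.
From mathcomp Require Import all_boot all_order all_algebra.
From mathcomp Require Import sesquilinear complex.
From mathcomp Require Import all_classical all_reals all_analysis.
From mathcomp Require Import ring lra.

Set Implicit Arguments.
Unset Strict Implicit.
Unset Printing Implicit Defensive.

Import Order.TTheory GRing.Theory Num.Theory.
Import numFieldNormedType.Exports.

Local Open Scope classical_set_scope.
Local Open Scope complex_scope.
Local Open Scope ring_scope.

(** In every kind of model the space E is the full Fock space: f_j(M_Z) is the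
    creation operator L_j, which maps e_a to e_(ja), and M_(Z_i) is left
    multiplication by the coefficients of g_i ([model_fock]). The theorem says that
    W = f(V) and V = g(W) set up a correspondence between the dilations V of T and
    the isometric dilations W of F = f(T); the existence and the uniqueness of
    minimal isometric dilations ([isometric_dilation_ex],
    [isometric_dilation_unique]) then give those of V. The correspondence has to be
    compatible with representations, with compression to H, and with cyclicity.

    Representations. A representation of a C*-algebra is contractive
    ([rep_contract]), so it commutes with limits in norm, but in general not with
    strong limits. Two facts provide limits in norm. First, r f has a model for
    some r < 1. Its inverse series is the g of f with the degree-k coefficients
    divided by r^k, because f alone determines the inverse
    ([formal_inverse_unique]). As the coefficients of that series are square
    summable, those of g decay geometrically ([inverse_radius]), and g(W) converges
    in norm for every row contraction W ([series_row_contraction]). Second,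
    f(M_Z) = L with limits in norm. In the bounded class, the partial sums for r f
    are multipliers of bounded norm, and the passage to f multiplies their degree-k
    coefficients by r^k ([radial_gain], [bounded_class_norm]). In the norm class,
    the convergence is transported from one model of f to another along a unitary
    ([norm_class_norm]).

    From W to V. For a row isometry W the assignment of W to L extends to a
    representation of a C*-algebra that contains the L_i
    ([universal_representation]). This rests on the inequality |p(W)| <= |p(L)| for
    *-polynomials p ([star_ev_opb]), proved with the Poisson kernel of W. The
    representation sends M_(Z_i) to V_i = g_i(W), so f(V) = W ([rep_norm_evals]).

    From V to W. The representation that belongs to a minimal dilation V sends the
    L_j to a row isometry W = f(V), and g(W) = V.

    In both directions H is co-invariant, so compression to H commutes with
    evaluation ([compress_evals]), and F = f(T) and T = g(F) match. Finally V and W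
    have the same closed invariant subspaces, being limits of polynomials in each
    other, so that H generates K under one when it does under the other
    ([cyclic_evals]). *)

(** * Real-valued norms and limits *)

(** Real-valued, so that estimates take place in R: norms over R[i] have values in R[i]. *)
Definition nm (R : realType) (V : normedZmodType R[i]) (x : V) : R :=
  complex.Re `|x|.

Section RealNorm.
Context {R : realType} {V : normedZmodType R[i]}.
Implicit Types x y : V.

Lemma nmE x : `|x| = (nm x)%:C.
Proof. by rewrite /nm RRe_real // normr_real. Qed.

Lemma nm_ge0 x : 0 <= nm x.
Proof. by rewrite -lecR -nmE normr_ge0. Qed.

Lemma nm0 : nm (0 : V) = 0.
Proof. by apply: complexI; rewrite -nmE normr0. Qed.

Lemma nm_eq0 x : nm x = 0 -> x = 0.
Proof. by move=> x0; apply/eqP; rewrite -normr_eq0 nmE x0. Qed.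

Lemma nm_triangle x y : nm (x + y) <= nm x + nm y.
Proof. by rewrite -lecR rmorphD /= -!nmE ler_normD. Qed.

Lemma nmN x : nm (- x) = nm x.
Proof. by rewrite /nm normrN. Qed.

Lemma nmBC x y : nm (x - y) = nm (y - x).
Proof. by rewrite -nmN opprB. Qed.

Lemma nm_dist_triangle x y z : nm (x - z) <= nm (x - y) + nm (y - z).
Proof. by rewrite -[x - z](subrK (y - z)) addrC; apply: le_trans (nm_triangle _ _) _;
  rewrite addrC opprB addrA subrK lexx. Qed.

Lemma nm_sum (I : Type) (r : seq I) (P : pred I) (F : I -> V) :
  nm (\sum_(i <- r | P i) F i) <= \sum_(i <- r | P i) nm (F i).
Proof.
elim/big_ind2: _ => [|x a y b xa yb|//]; first by rewrite nm0.
exact: le_trans (nm_triangle _ _) (lerD xa yb).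
Qed.

End RealNorm.

Section ScalarNorm.
Context {R : realType}.
Implicit Types z w : R[i].

Lemma nmM z w : nm (z * w) = nm z * nm w.
Proof. by apply: complexI; rewrite rmorphM /= -!nmE normrM. Qed.

Lemma nm_real (r : R) : nm (r%:C : R[i]) = `|r|.
Proof. by apply: complexI; rewrite -nmE normc_def /= expr0n addr0 sqrtr_sqr. Qed.

Lemma nm1 : nm (1 : R[i]) = 1.
Proof. by rewrite -[1]/(1%:C) nm_real normr1. Qed.

Lemma conjE z : Num.conj z = conjc z.
Proof. by []. Qed.

Lemma nm_conj z : nm (Num.conj z) = nm z.
Proof. by rewrite /nm norm_conjC. Qed.

Lemma Re_le_nm z : complex.Re z <= nm z.
Proof.
by apply: le_trans (ler_norm _) _; rewrite -lecR -nmE normc_ge_Re.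
Qed.

Lemma sqr_nm z : (nm z ^+ 2)%:C = z * Num.conj z.
Proof. by rewrite rmorphXn /= -nmE normCK. Qed.

Lemma cReD z w : complex.Re (z + w) = complex.Re z + complex.Re w.
Proof. by case: z w => [a b] [c d]. Qed.

Lemma cReN z : complex.Re (- z) = - complex.Re z.
Proof. by case: z. Qed.

Lemma cReM (r : R) z : complex.Re (r%:C * z) = r * complex.Re z.
Proof. by case: z => a b /=; rewrite mul0r subr0. Qed.

Lemma cRe_conj z : complex.Re (Num.conj z) = complex.Re z.
Proof. by case: z. Qed.

Lemma conj_real (r : R) : Num.conj (r%:C : R[i]) = r%:C.
Proof. by rewrite conjE conjc_real. Qed.

Lemma cRe_sum (I : Type) (r : seq I) (P : pred I) (F : I -> R[i]) :
  complex.Re (\sum_(i <- r | P i) F i) = \sum_(i <- r | P i) complex.Re (F i).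
Proof. by elim/big_ind2: _ => [//|x a y b <- <-|//]; rewrite cReD. Qed.

End ScalarNorm.

Section Limits.
Context {R : realType} {V : normedZmodType R[i]}.

(** Real error bounds, and only a norm on the values: it serves vectors and complex
    scalars alike. *)
Definition tends (I : Type) (F : set_system I) (u : I -> V) (l : V) :=
  forall e : R, 0 < e -> \forall t \near F, nm (u t - l) < e.

Context {I : Type} (F : set_system I) {FF : Filter F}.
Implicit Types (u v : I -> V) (l k : V).

Lemma tends_eq u v l : (forall t, u t = v t) -> tends F u l -> tends F v l.
Proof. by move=> uv; have -> : v = u by apply/funext => t; rewrite uv. Qed.

Lemma tends_near u v l : (\forall t \near F, u t = v t) ->
  tends F u l -> tends F v l.
Proof. by move=> uv ul e e0; apply: filterS2 uv (ul _ e0) => t ->. Qed.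

Lemma tends_cst l : tends F (fun=> l) l.
Proof. by move=> e e0; apply: nearW => t; rewrite subrr nm0. Qed.

Lemma tendsD u v l k : tends F u l -> tends F v k ->
  tends F (fun t => u t + v t) (l + k).
Proof.
move=> ul vk e e0; have e20 : 0 < e / 2 by rewrite divr_gt0.
apply: filterS2 (ul _ e20) (vk _ e20) => t ut vt.
rewrite opprD addrACA [e in _ < e]splitr.
by apply: le_lt_trans (nm_triangle _ _) (ltrD ut vt).
Qed.

Lemma tendsN u l : tends F u l -> tends F (fun t => - u t) (- l).
Proof. by move=> ul e /ul; apply: filterS => t; rewrite -opprD nmN. Qed.

Lemma tendsB u v l k : tends F u l -> tends F v k ->
  tends F (fun t => u t - v t) (l - k).
Proof. by move=> ul vk; exact: tendsD ul (tendsN vk). Qed.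

Lemma tends_sum (J : Type) (r : seq J) (P : pred J) (u : J -> I -> V) (l : J -> V) :
  (forall j, P j -> tends F (u j) (l j)) ->
  tends F (fun t => \sum_(j <- r | P j) u j t) (\sum_(j <- r | P j) l j).
Proof.
move=> ul; elim: r => [|j r IHr].
  by rewrite big_nil; apply: tends_eq (tends_cst 0) => t; rewrite big_nil.
rewrite big_cons; case: ifP => Pj.
  by apply: tends_eq (tendsD (ul j Pj) IHr) => t; rewrite big_cons Pj.
by apply: tends_eq IHr => t; rewrite big_cons Pj.
Qed.

Lemma tends_squeeze u l (b : I -> R) :
  (\forall t \near F, nm (u t - l) <= b t) ->
  (forall e, 0 < e -> \forall t \near F, b t < e) -> tends F u l.
Proof.
by move=> ub b0 e /b0; apply: filterS2 ub => t; exact: le_lt_trans. Qed.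

End Limits.

Lemma near_ex2 (I : Type) (F : set_system I) {FF : ProperFilter F} (P Q : set I) :
  F P -> F Q -> exists t, P t /\ Q t.
Proof.
move=> FP FQ; have FPQ : F (P `&` Q) by exact: filterI.
by have [t []] := filter_ex FPQ; exists t.
Qed.

Section LimitUnique.
Context {R : realType} {V : normedZmodType R[i]}.
Context {I : Type} (F : set_system I) {FF : ProperFilter F}.

Lemma tends_unique (u : I -> V) l k : tends F u l -> tends F u k -> l = k.
Proof.
move=> ul uk; apply/eqP; rewrite -subr_eq0; apply/eqP/nm_eq0/eqP.
rewrite eq_le nm_ge0 andbT leNgt; apply/negP => d0.
have e0 : 0 < nm (l - k) / 2 by rewrite divr_gt0.
have [t [ut vt]] : exists t, nm (u t - l) < nm (l - k) / 2 /\
    nm (u t - k) < nm (l - k) / 2.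
  exact: near_ex2 (ul _ e0) (uk _ e0).
have := nm_dist_triangle l (u t) k; rewrite [nm (l - u t)]nmBC leNgt.
by rewrite [X in _ < X]splitr ltrD.
Qed.

Lemma nm_tends_le (u : I -> V) l (M : R) :
  tends F u l -> (\forall t \near F, nm (u t) <= M) -> nm l <= M.
Proof.
move=> ul uM; apply/ler_addgt0Pr => e e0.
have [t [ut vt]] := near_ex2 (ul _ e0) uM.
rewrite -[l](subrK (u t)); apply: le_trans (nm_triangle _ _) _.
by rewrite addrC lerD // nmBC ltW.
Qed.
End LimitUnique.

Section LimitScale.
Context {R : realType} {H : normedModType R[i]}.
Context {I : Type} (F : set_system I) {FF : Filter F}.

Lemma nmZ (a : R[i]) (x : H) : nm (a *: x) = nm a * nm x.
Proof. by apply: complexI; rewrite rmorphM /= -!nmE normrZ. Qed.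

Lemma tendsZ (a : R[i]) (u : I -> H) l :
  tends F u l -> tends F (fun t => a *: u t) (a *: l).
Proof.
move=> ul e e0; have a0 : 0 < nm a + 1 by rewrite ltr_wpDl ?nm_ge0.
apply: filterS (ul _ (divr_gt0 e0 a0)) => t; rewrite ltr_pdivlMr // -scalerBr nmZ => ute.
by apply: le_lt_trans ute; rewrite mulrC ler_wpM2l ?nm_ge0 // lerDl.
Qed.

Lemma tendsM (a : R[i]) (u : I -> R[i]) l :
  tends F u l -> tends F (fun t => a * u t) (a * l).
Proof.
move=> ul e e0; have a0 : 0 < nm a + 1 by rewrite ltr_wpDl ?nm_ge0.
apply: filterS (ul _ (divr_gt0 e0 a0)) => t; rewrite ltr_pdivlMr // -mulrBr nmM => ute.
by apply: le_lt_trans ute; rewrite mulrC ler_wpM2l ?nm_ge0 // lerDl.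
Qed.

Lemma cvg_tends (u : I -> H) l : u t @[t --> F] --> l <-> tends F u l.
Proof.
split=> ul.
  move=> e e0; have /cvgrPdistC_lt/(_ e%:C) := ul; rewrite ltcR => /(_ e0).
  by apply: filterS => t; rewrite nmE ltcR.
apply/cvgrPdistC_lt => -[e e'] /=; rewrite ltcE /= => /andP[/eqP -> e0].
by apply: filterS (ul _ e0) => t; rewrite nmE ltcR.
Qed.

Lemma closed_approx (S : set H) (x : H) : closed S ->
  (forall e : R, 0 < e -> exists2 y, S y & nm (x - y) < e) -> S x.
Proof.
move=> Scl xS; apply: Scl => B /nbhs_ballP[[e e'] /=].
rewrite ltcE /= => /andP[/eqP -> e0] eB.
have [y Sy xy] := xS _ e0; exists y; split=> //; apply: eB.
by rewrite -ball_normE /ball_ /= nmE ltcR.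
Qed.

Lemma approx_closed (S : set H) :
  (forall x, (forall e : R, 0 < e -> exists2 y, S y & nm (x - y) < e) -> S x) ->
  closed S.
Proof.
move=> Sapp x xS; apply: Sapp => e e0.
have /xS[y [Sy]] : nbhs x (ball x (e%:C)) by apply: nbhsx_ballx; rewrite ltcR.
by rewrite -ball_normE /ball_ /= nmE ltcR => xy; exists y.
Qed.

End LimitScale.

Section CompleteLimit.
Context {R : realType} {H : completeNormedModType R[i]}.

Lemma cauchy_seq (u : nat -> H) :
  (forall e : R, 0 < e -> exists N, forall i j, (N <= i)%N -> (N <= j)%N ->
      nm (u i - u j) < e) ->
  exists l, tends \oo u l.
Proof.
move=> uC; have /cvg_ex[l ul] : cvg (u @ \oo).
  apply: cauchy_cvg; apply/cauchyP => -[e e'] /=.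
  rewrite ltcE /= => /andP[/eqP -> e0]; have [N uN] := uC _ e0.
  exists (u N); exists N => // i /= Ni; rewrite -ball_normE /ball_ /= nmE ltcR.
  exact: uN.
by exists l; apply/cvg_tends.
Qed.

End CompleteLimit.

Lemma invrn_lt_exists (R : realType) (e : R) : 0 < e ->
  exists N : nat, N.+1%:R^-1 < e.
Proof. by move=> /ltr_add_invr[k]; rewrite add0r; exists k. Qed.

(** * Inner products *)

Section InnerProduct.
Context {R : realType} {H : hilbertType R}.
Implicit Types x y z : H.

Lemma dotDl x y z : hdot (x + y) z = hdot x z + hdot y z.
Proof. exact: linearDl. Qed.
Lemma dotDr x y z : hdot x (y + z) = hdot x y + hdot x z.
Proof. exact: linearDr. Qed.
Lemma dotNl x y : hdot (- x) y = - hdot x y. Proof. exact: linearNl. Qed.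
Lemma dotNr x y : hdot x (- y) = - hdot x y. Proof. exact: linearNr. Qed.
Lemma dotBl x y z : hdot (x - y) z = hdot x z - hdot y z.
Proof. by rewrite dotDl dotNl. Qed.
Lemma dotBr x y z : hdot x (y - z) = hdot x y - hdot x z.
Proof. by rewrite dotDr dotNr. Qed.
Lemma dot0l x : hdot 0 x = 0. Proof. exact: linear0l. Qed.
Lemma dot0r x : hdot x 0 = 0. Proof. exact: linear0r. Qed.
Lemma dotZl (a : R[i]) x y : hdot (a *: x) y = a * hdot x y.
Proof. exact: linearZl_LR. Qed.
Lemma dotZr (a : R[i]) x y : hdot x (a *: y) = Num.conj a * hdot x y.
Proof. exact: linearZr_LR. Qed.
Lemma dot_suml (I : Type) (r : seq I) (P : pred I) (F : I -> H) x :
  hdot (\sum_(i <- r | P i) F i) x = \sum_(i <- r | P i) hdot (F i) x.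
Proof. by elim/big_ind2: _ => [|u a v b <- <-|//]; rewrite ?dot0l ?dotDl. Qed.
Lemma dot_sumr (I : Type) (r : seq I) (P : pred I) (F : I -> H) x :
  hdot x (\sum_(i <- r | P i) F i) = \sum_(i <- r | P i) hdot x (F i).
Proof. by elim/big_ind2: _ => [|u a v b <- <-|//]; rewrite ?dot0r ?dotDr. Qed.

Lemma dotC x y : hdot x y = Num.conj (hdot y x).
Proof. by rewrite [LHS]hermC expr0 mul1r. Qed.

Lemma dotxx x : hdot x x = (nm x ^+ 2)%:C.
Proof. by rewrite -normr_hdot nmE rmorphXn. Qed.

Lemma nm_sqr_Re x : nm x ^+ 2 = complex.Re (hdot x x).
Proof. by rewrite dotxx. Qed.

Lemma nm_sqrD x y :
  nm (x + y) ^+ 2 = nm x ^+ 2 + nm y ^+ 2 + 2 * complex.Re (hdot x y).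
Proof.
rewrite !nm_sqr_Re dotDl !dotDr !cReD [hdot y x]dotC cRe_conj; ring.
Qed.

Lemma nm_sqrB x y :
  nm (x - y) ^+ 2 = nm x ^+ 2 + nm y ^+ 2 - 2 * complex.Re (hdot x y).
Proof. by rewrite nm_sqrD nmN dotNr cReN mulrN. Qed.

Lemma le_of_sqr (a b : R) : 0 <= b -> a ^+ 2 <= b ^+ 2 -> a <= b.
Proof.
move=> b0 ab; have [a0|a0] := ltP a 0; first exact: le_trans (ltW a0) b0.
by rewrite -(@ler_pXn2r _ 2).
Qed.

Lemma real_cauchy_schwarz x y : complex.Re (hdot x y) <= nm x * nm y.
Proof.
have [y0|y0] := eqVneq (nm y) 0.
  by rewrite (nm_eq0 y0) dot0r nm0 mulr0 /=.
have [x0|x0] := eqVneq (nm x) 0.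
  by rewrite (nm_eq0 x0) dot0l nm0 mul0r /=.
have xp : 0 < nm x by rewrite lt_neqAle eq_sym x0 nm_ge0.
have yp : 0 < nm y by rewrite lt_neqAle eq_sym y0 nm_ge0.
have : 0 <= nm (((nm y)%:C *: x) - ((nm x)%:C *: y)) ^+ 2 by rewrite sqr_ge0.
rewrite nm_sqrB !nmZ !nm_real !ger0_norm ?nm_ge0 // dotZl dotZr conj_real !cReM.
have xy0 : 0 < nm x * nm y by rewrite mulr_gt0.
move=> h; rewrite -(ler_pM2l xy0); nra.
Qed.

Lemma cauchy_schwarz x y : nm (hdot x y) <= nm x * nm y.
Proof.
have [d0|d0] := eqVneq (hdot x y) 0.
  by rewrite d0 nm0 mulr_ge0 ?nm_ge0.
set a := Num.conj (hdot x y).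
have h := real_cauchy_schwarz (a *: x) y.
have dp : 0 < nm (hdot x y).
  rewrite lt_neqAle nm_ge0 andbT eq_sym; apply: contra_neq d0; exact: nm_eq0.
rewrite -(ler_pM2l dp); apply: le_trans (_ : complex.Re (hdot (a *: x) y) <= _).
  by rewrite dotZl /a [X in complex.Re X]mulrC -sqr_nm expr2.
by apply: le_trans h _; rewrite nmZ nm_conj mulrA.
Qed.

Lemma dot_ext x y : (forall z, hdot x z = hdot y z) -> x = y.
Proof.
move=> xy; apply/eqP; rewrite -subr_eq0; apply/eqP/nm_eq0/eqP.
by rewrite -sqrf_eq0 nm_sqr_Re {1}dotBl xy subrr.
Qed.

Lemma dot_extr x y : (forall z, hdot z x = hdot z y) -> x = y.
Proof. by move=> xy; apply: dot_ext => z; rewrite dotC xy -dotC. Qed.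

Lemma parallelogram x y :
  nm (x + y) ^+ 2 + nm (x - y) ^+ 2 = 2 * nm x ^+ 2 + 2 * nm y ^+ 2.
Proof. rewrite nm_sqrD nm_sqrB; ring. Qed.

Context {I : Type} (F : set_system I) {FF : Filter F}.

Lemma tends_dotl (u : I -> H) l x :
  tends F u l -> tends F (fun t => hdot (u t) x) (hdot l x).
Proof.
move=> ul e e0; have x0 : 0 < nm x + 1 by rewrite ltr_wpDl ?nm_ge0.
apply: filterS (ul _ (divr_gt0 e0 x0)) => t; rewrite ltr_pdivlMr // => ute.
rewrite -dotBl; apply: le_lt_trans (cauchy_schwarz _ _) (le_lt_trans _ ute).
by rewrite ler_wpM2l ?nm_ge0 // lerDl.
Qed.

Lemma tends_conj (u : I -> R[i]) l :
  tends F u l -> tends F (fun t => Num.conj (u t)) (Num.conj l).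
Proof. by move=> ul e /ul; apply: filterS => t; rewrite -rmorphB nm_conj. Qed.

Lemma tends_dotr (u : I -> H) l x :
  tends F u l -> tends F (fun t => hdot x (u t)) (hdot x l).
Proof.
move=> ul; rewrite [hdot x l]dotC; apply: tends_eq (tends_conj (tends_dotl x ul)).
by move=> t; rewrite -dotC.
Qed.

End InnerProduct.

(** * Bounded operators *)

Section Bounds.
Context {R : realType} {H K L : hilbertType R}.

(** A bound by a constant, in place of the supremum [opnorm], which says nothing
    about unbounded maps. *)
Definition opb (M : R) (T : H -> K) := forall x, nm (T x) <= M * nm x.

Lemma bounded_opP (T : H -> K) :
  bounded_op T <-> linear T /\ exists2 M, 0 <= M & opb M T.
Proof.
split=> [[Tl [M TM]]|[Tl [M M0 TM]]]; split=> //.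
  exists `|M|; first exact: normr_ge0.
  move=> x; have := TM x; rewrite !nmE -rmorphM lecR => /le_trans; apply.
  by rewrite ler_wpM2r ?nm_ge0 ?ler_norm.
by exists M => x; rewrite !nmE -rmorphM lecR.
Qed.

Lemma bounded_linear (T : H -> K) : bounded_op T -> linear T.
Proof. by case. Qed.

Section Linear.
Variables (T : H -> K) (Tl : linear T).
Lemma lin0 : T 0 = 0.
Proof. by have := Tl 1 0 0; rewrite !scale1r !addr0 => /esym/eqP; rewrite -subr_eq0 addrK => /eqP. Qed.
Lemma linD x y : T (x + y) = T x + T y.
Proof. by rewrite -{1}[x]scale1r Tl scale1r. Qed.
Lemma linZ a x : T (a *: x) = a *: T x.
Proof. by rewrite -[a *: x]addr0 Tl lin0 addr0. Qed.
Lemma linN x : T (- x) = - T x.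
Proof. by rewrite -scaleN1r linZ scaleN1r. Qed.
Lemma linB x y : T (x - y) = T x - T y.
Proof. by rewrite linD linN. Qed.
Lemma lin_sum (I : Type) (r : seq I) (P : pred I) (F : I -> H) :
  T (\sum_(i <- r | P i) F i) = \sum_(i <- r | P i) T (F i).
Proof. by elim/big_ind2: _ => [|x a y b <- <-|//]; rewrite ?lin0 ?linD. Qed.
End Linear.

Lemma opb_le M N (T : H -> K) : M <= N -> opb M T -> opb N T.
Proof. by move=> MN TM x; apply: le_trans (TM x) _; rewrite ler_wpM2r ?nm_ge0. Qed.

Lemma opbD M N (S T : H -> K) : opb M S -> opb N T -> opb (M + N) (S + T).
Proof. by move=> SM TN x; rewrite mulrDl; apply: le_trans (nm_triangle _ _) (lerD _ _). Qed.

Lemma opbN M (T : H -> K) : opb M T -> opb M (- T).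
Proof. by move=> TM x; rewrite [(- T) x]/(- T x) nmN. Qed.

Lemma opbZ M (a : R[i]) (T : H -> K) : opb M T -> opb (nm a * M) (a *: T).
Proof. by move=> TM x; rewrite [(a *: T) x]/(a *: T x) nmZ -mulrA ler_wpM2l ?nm_ge0. Qed.

Lemma opb_comp M N (S : K -> L) (T : H -> K) :
  0 <= M -> (forall x, nm (S x) <= M * nm x) -> opb N T ->
  forall x, nm ((S \o T) x) <= M * N * nm x.
Proof.
by move=> M0 SM TN x; apply: le_trans (SM _) _; rewrite -mulrA ler_wpM2l.
Qed.

Lemma opnorm_le (T : H -> K) (M : R) : 0 <= M -> opb M T -> opnorm T <= M.
Proof.
move=> M0 TM; apply: ge_sup.
  by exists (nm (T 0)); exists 0; rewrite //= normr0 ler01.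
move=> _ [x /= x1 <-]; apply: le_trans (TM x) _; rewrite ler_piMr //.
by rewrite -lecR -nmE.
Qed.

Lemma opb_opnorm (T : H -> K) : bounded_op T -> opb (opnorm T) T.
Proof.
move=> /bounded_opP[Tl [M M0 TM]] x.
have [x0|x0] := eqVneq (nm x) 0; first by rewrite (nm_eq0 x0) lin0 // !nm0 mulr0.
have xp : 0 < nm x by rewrite lt_neqAle eq_sym x0 nm_ge0.
rewrite -ler_pdivrMr //.
have -> : nm (T x) / nm x = complex.Re `|T ((nm x)^-1%:C *: x)|.
  by rewrite linZ // -/(nm _) nmZ nm_real ger0_norm ?invr_ge0 ?nm_ge0 // mulrC.
apply: sup_upper_bound.
  split; first by exists (nm (T 0)); exists 0; rewrite //= normr0 ler01.
  exists M => _ [y /= y1 <-]; apply: le_trans (TM y) _; rewrite ler_piMr //.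
  by rewrite -lecR -nmE.
exists ((nm x)^-1%:C *: x) => //=; rewrite nmE lecR nmZ nm_real.
by rewrite ger0_norm ?invr_ge0 ?nm_ge0 // mulVf.
Qed.

Lemma opnorm_ge0 (T : H -> K) : bounded_op T -> 0 <= opnorm T.
Proof.
move=> /bounded_opP[Tl [M M0 TM]]; apply: le_trans (nm_ge0 (T 0)) _.
apply: sup_upper_bound; last by exists 0; rewrite //= normr0 ler01.
split; first by exists (nm (T 0)); exists 0; rewrite //= normr0 ler01.
exists M => _ [y /= y1 <-]; apply: le_trans (TM y) _; rewrite ler_piMr //.
by rewrite -lecR -nmE.
Qed.

Lemma bounded0 : bounded_op (0 : H -> K).
Proof.
apply/bounded_opP; split=> [a x y|]; first by rewrite scaler0 addr0.
by exists 0 => // x; rewrite nm0 mul0r.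
Qed.

Lemma boundedP_lin (a : R[i]) (S T : H -> K) :
  bounded_op S -> bounded_op T -> bounded_op (a *: S + T).
Proof.
move=> /bounded_opP[Sl [M M0 SM]] /bounded_opP[Tl [N N0 TN]].
apply/bounded_opP; split.
  move=> b x y; rewrite [LHS]/(a *: S _ + T _) Sl Tl !fctE.
  by rewrite !scalerDr !scalerA mulrC addrACA.
exists (nm a * M + N); first by rewrite addr_ge0 ?mulr_ge0 ?nm_ge0.
exact: opbD (opbZ a SM) TN.
Qed.

Lemma boundedD (S T : H -> K) : bounded_op S -> bounded_op T -> bounded_op (S + T).
Proof. by move=> Sb Tb; rewrite -[S]scale1r; exact: boundedP_lin. Qed.

Lemma boundedZ (a : R[i]) (T : H -> K) : bounded_op T -> bounded_op (a *: T).
Proof. by move=> Tb; rewrite -[_ *: _]addr0; apply: boundedP_lin => //; exact: bounded0. Qed.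

Lemma boundedB (S T : H -> K) : bounded_op S -> bounded_op T -> bounded_op (S - T).
Proof. by move=> Sb Tb; rewrite addrC -scaleN1r; exact: boundedP_lin. Qed.

Lemma bounded_sum (I : Type) (r : seq I) (P : pred I) (F : I -> H -> K) :
  (forall i, P i -> bounded_op (F i)) -> bounded_op (\sum_(i <- r | P i) F i).
Proof. by move=> Fb; elim/big_ind: _ => //; [exact: bounded0 | exact: boundedD]. Qed.

Lemma bounded_comp (S : K -> L) (T : H -> K) :
  bounded_op S -> bounded_op T -> bounded_op (S \o T).
Proof.
move=> [Sl [M SM]] [Tl [N TN]]; split=> [a x y|]; first by rewrite /= Tl Sl.
exists (`|M| * N) => x; rewrite /= rmorphM -mulrA.
apply: le_trans (SM _) _; apply: le_trans (ler_wpM2l _ (TN x)) => //.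
  by rewrite ler_wpM2r // lecR ler_norm.
by rewrite lecR.
Qed.

Lemma bounded_isometric (J : H -> K) : isometric J -> bounded_op J.
Proof.
move=> [Jl JJ]; apply/bounded_opP; split=> //; exists 1 => // x; rewrite mul1r.
by apply: le_of_sqr; rewrite ?nm_ge0 // !nm_sqr_Re JJ.
Qed.

Lemma tends_op (I : Type) (F : set_system I) {FF : Filter F} (T : H -> K)
    (u : I -> H) l : bounded_op T -> tends F u l ->
  tends F (fun t => T (u t)) (T l).
Proof.
move=> /bounded_opP[Tl [M M0 TM]] ul e e0.
have Mp : 0 < M + 1 by rewrite ltr_wpDl.
apply: filterS (ul _ (divr_gt0 e0 Mp)) => t; rewrite ltr_pdivlMr // -linB // => ute.
apply: le_lt_trans (TM _) (le_lt_trans _ ute).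
by rewrite mulrC ler_wpM2l ?nm_ge0 // lerDl.
Qed.

(** [norm_cvg] without the supremum; the two agree on bounded operators. *)
Definition ncvg (I : Type) (F : set_system I) (T : I -> H -> K) (A : H -> K) :=
  forall e : R, 0 < e -> \forall t \near F, opb e (T t - A).

Lemma norm_cvgP (I : Type) (F : set_system I) {FF : Filter F} T A :
  (\forall t \near F, bounded_op (T t)) -> bounded_op A ->
  norm_cvg F T A <-> ncvg F T A.
Proof.
move=> Tb Ab; split=> TA.
  move=> e e0; have /cvgrPdistC_lt/(_ e e0) := TA.
  apply: filterS2 Tb => t Tt; rewrite subr0 => le.
  have D := boundedB Tt Ab; apply: opb_le (opb_opnorm D).
  exact: le_trans (ler_norm _) (ltW le).
apply/cvgrPdistC_le => e e0; apply: filterS2 Tb (TA _ e0) => t Tt te.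
rewrite subr0 ger0_norm; first exact: opnorm_le (ltW e0) te.
by apply/opnorm_ge0/boundedB.
Qed.

Lemma ncvg_tends (I : Type) (F : set_system I) {FF : Filter F} T A x :
  ncvg F T A -> tends F (fun t => T t x) (A x).
Proof.
move=> TA e e0; have xp : 0 < nm x + 1 by rewrite ltr_wpDl ?nm_ge0.
apply: filterS (TA _ (divr_gt0 e0 xp)) => t /(_ x) h; apply: le_lt_trans h _.
by rewrite mulrAC ltr_pdivrMr // ltr_pM2l // ltrDl.
Qed.

Lemma sot_cvgP (I : Type) (F : set_system I) {FF : Filter F}
    (T : I -> H -> K) A :
  sot_cvg F T A <-> forall x, tends F (fun t => T t x) (A x).
Proof. by split=> TA x; apply/cvg_tends/TA. Qed.

End Bounds.

Lemma bounded_id (R : realType) (H : hilbertType R) : bounded_op (id : H -> H).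
Proof. by apply/bounded_opP; split=> //; exists 1 => // x; rewrite mul1r. Qed.

(** Minimising |x|^2 - 2 Re (phi x) produces the representing vector: a
    minimising sequence is Cauchy by the parallelogram law, and the limit is
    stationary. *)
Lemma riesz (R : realType) (H : hilbertType R) (phi : H -> R[i]) (M : R) :
  (forall a x y, phi (a *: x + y) = a * phi x + phi y) -> 0 <= M ->
  (forall x, nm (phi x) <= M * nm x) -> exists y, forall x, phi x = hdot x y.
Proof.
move=> phil M0 phiM.
have phi0 : phi 0 = 0.
  by have := phil 1 0 0; rewrite scale1r mul1r !addr0 => /esym/eqP;
     rewrite -subr_eq0 addrK => /eqP.
have phiZ a x : phi (a *: x) = a * phi x by rewrite -[_ *: _]addr0 phil phi0 addr0.
have phiD x y : phi (x + y) = phi x + phi y by rewrite -[x in LHS]scale1r phil mul1r.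
pose Q x := nm x ^+ 2 - 2 * complex.Re (phi x).
have Qge x : - M ^+ 2 <= Q x.
  have h : complex.Re (phi x) <= M * nm x := le_trans (Re_le_nm _) (phiM x).
  have := sqr_ge0 (nm x - M); rewrite /Q; nra.
pose m := inf (range Q).
have Qinf : has_inf (range Q).
  by split; [exists (Q 0); exists 0 | exists (- M ^+ 2) => _ [x _ <-]].
have mQ x : m <= Q x by apply: (ge_inf Qinf.2); exists x.
have mid x y : nm (x - y) ^+ 2 <= 2 * (Q x - m) + 2 * (Q y - m).
  have hm := mQ ((2^-1)%:C *: (x + y)).
  have pl := parallelogram x y; move: hm.
  rewrite /Q nmZ phiZ phiD cReM cReD nm_real ger0_norm ?invr_ge0 //.
  rewrite exprMn exprVn -natrX => hm; lra.
have ex k : exists x, Q x < m + k.+1%:R^-1.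
  have k0 : (0 : R) < k.+1%:R^-1 by rewrite invr_gt0.
  by have [_ [x _ <-] xm] := inf_adherent k0 Qinf; exists x.
have [u uQ] := choice ex.
have [|y uy] := @cauchy_seq R H u.
  move=> e e0; have e2 : 0 < e ^+ 2 / 4 by rewrite divr_gt0 ?exprn_gt0.
  have [N Ne] : exists N : nat, N.+1%:R^-1 < e ^+ 2 / 4.
    exact: invrn_lt_exists. 
  exists N => i j Ni Nj.
  have small k : (N <= k)%N -> Q (u k) - m < e ^+ 2 / 4.
    move=> Nk; rewrite ltrBlDl; apply: lt_le_trans (uQ k) _; rewrite lerD2l.
    by apply: le_trans (ltW Ne); rewrite lef_pV2 ?posrE // ler_nat ltnS.
  rewrite -(@ltr_pXn2r _ 2) ?nnegrE ?nm_ge0 ?ltW //.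
  have si := small _ Ni; have sj := small _ Nj; have md := mid (u i) (u j).
  by lra.
have Qy : Q y <= m.
  apply/ler_addgt0Pr => e e0.
  pose C := 3 + 2 * nm y + 2 * M.
  have Cp : 0 < C by rewrite /C; have := nm_ge0 y; lra.
  have eC : 0 < Num.min 1 (e / 2 / C) by rewrite lt_min ltr01 !divr_gt0.
  have e2 : 0 < e / 2 by rewrite divr_gt0.
  have [N Ne] : exists N : nat, N.+1%:R^-1 < e / 2 by exact: invrn_lt_exists.
  have [k [uk Nk]] : exists k, nm (u k - y) < Num.min 1 (e / 2 / C) /\ (N <= k)%N.
    by apply: (near_ex2 (F := \oo)); [exact: uy | exists N].
  move: uk; rewrite lt_min nmBC => /andP[d1]; rewrite ltr_pdivlMr // => dC.
  have uQk : Q (u k) <= m + e / 2.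
    apply: le_trans (ltW (uQ k)) _; rewrite lerD2l.
    by apply: le_trans (ltW Ne); rewrite lef_pV2 ?posrE // ler_nat ltnS.
  have := nm_sqrD (y - u k) (u k); rewrite subrK => Ey.
  have Ephi : phi y = phi (y - u k) + phi (u k) by rewrite -phiD subrK.
  have h1 := real_cauchy_schwarz (y - u k) (u k).
  have h2 : nm (u k) <= nm y + nm (y - u k).
    by rewrite -{1}[u k](subKr y); apply: le_trans (nm_triangle _ _) _; rewrite nmN.
  have h3 : - complex.Re (phi (y - u k)) <= M * nm (y - u k).
    by rewrite -cReN; apply: le_trans (Re_le_nm _) _; rewrite nmN.
  move: uQk; rewrite /Q Ey Ephi cReD.
  have d0 := nm_ge0 (y - u k); move: dC; rewrite /C; move: h1 h2 h3 d0 d1.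
  set d := nm (y - u k); set w := nm (u k); set ny := nm y => h1 h2 h3 d0 d1 dC uQk.
  have h4 : d * w <= d * (ny + d) by rewrite ler_wpM2l.
  have h5 : d ^+ 2 <= d by rewrite expr2 ler_piMl // ltW.
  by nra.
exists y => x.
(* Q is stationary at y in the direction v: the step s, proportional to the
   derivative d, would otherwise decrease Q. *)
have re v : complex.Re (phi v) = complex.Re (hdot v y).
  set d := complex.Re (hdot v y) - complex.Re (phi v).
  pose s := - d / (nm v ^+ 2 + 1).
  have h : Q y <= Q (s%:C *: v + y) := le_trans Qy (mQ _).
  have vp : 0 < nm v ^+ 2 + 1 by rewrite ltr_wpDl ?sqr_ge0.
  have sE : s * (nm v ^+ 2 + 1) = - d by rewrite /s divfK // gt_eqF.
  move: h; rewrite /Q nm_sqrD nmZ nm_real exprMn (real_normK (num_real s)) phil dotZl cReD !cReM.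
  move=> h; have {h} : 0 <= s ^+ 2 * nm v ^+ 2 + 2 * s * d by rewrite /d; lra.
  have -> : d = - (s * (nm v ^+ 2 + 1)) by rewrite sE opprK.
  move=> h; have s2 : s ^+ 2 * (nm v ^+ 2 + 2) <= 0 by lra.
  have s0 : s = 0.
    apply/eqP; rewrite -sqrf_eq0 eq_le sqr_ge0 andbT leNgt; apply/negP => s2p.
    by move: s2; rewrite leNgt mulr_gt0 // ltr_wpDl ?sqr_ge0.
  move: sE; rewrite s0 mul0r => /esym/eqP; rewrite oppr_eq0 subr_eq0 => /eqP.
  by [].
have im (c : R[i]) : complex.Re (-'i%C * c) = complex.Im c.
  by case: c => a b /=; rewrite oppr0 mul0r sub0r mulNr mul1r opprK.
apply/eqP; rewrite eq_complex re eqxx /=.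
by rewrite -!im -phiZ re dotZl.
Qed.

Section Adjoint.
Context {R : realType} {H K : hilbertType R}.

Lemma ex_adjoint (T : H -> K) : bounded_op T ->
  exists2 S : K -> H, bounded_op S & forall x y, hdot (T x) y = hdot x (S y).
Proof.
move=> /bounded_opP[Tl [M M0 TM]].
have ex y : exists z, forall x, hdot (T x) y = hdot x z.
  apply: (@riesz R H (fun x => hdot (T x) y) (M * nm y)).
  - by move=> a x x'; rewrite Tl dotDl dotZl.
  - by rewrite mulr_ge0 ?nm_ge0.
  move=> x; apply: le_trans (cauchy_schwarz _ _) _.
  by rewrite mulrAC ler_wpM2r ?nm_ge0.
have [S TS] := choice ex; exists S => //.
apply/bounded_opP; split=> [a y z|].
  by apply: dot_extr => x; rewrite -TS dotDr dotZr dotDr dotZr !TS.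
exists M => // y; have [S0|S0] := eqVneq (nm (S y)) 0.
  by rewrite S0 mulr_ge0 ?nm_ge0.
have Sp : 0 < nm (S y) by rewrite lt_neqAle eq_sym S0 nm_ge0.
rewrite -(ler_pM2l Sp) -expr2 nm_sqr_Re -TS.
apply: le_trans (real_cauchy_schwarz _ _) _.
by rewrite mulrCA mulrA ler_wpM2r ?nm_ge0.
Qed.

Lemma opb_adjoint (T : H -> K) (S : K -> H) M : 0 <= M -> opb M T ->
  (forall x y, hdot (T x) y = hdot x (S y)) -> opb M S.
Proof.
move=> M0 TM TS y; have [S0|S0] := eqVneq (nm (S y)) 0.
  by rewrite S0 mulr_ge0 ?nm_ge0.
have Sp : 0 < nm (S y) by rewrite lt_neqAle eq_sym S0 nm_ge0.
rewrite -(ler_pM2l Sp) -expr2 nm_sqr_Re -TS.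
apply: le_trans (real_cauchy_schwarz _ _) _.
by rewrite mulrCA mulrA ler_wpM2r ?nm_ge0.
Qed.

End Adjoint.

Section SelfAdjoint.
Context {R : realType} {H : hilbertType R}.
Implicit Types S T : H -> H.

Lemma adjP T : bounded_op T -> forall x y, hdot (T x) y = hdot x (adj T y).
Proof.
move=> Tb; rewrite /adj; case: xgetP => [S -> //|no].
by have [S _ TS] := ex_adjoint Tb; have := no S TS.
Qed.

Lemma adj_eq T S : (forall x y, hdot (T x) y = hdot x (S y)) -> adj T = S.
Proof.
move=> TS; rewrite /adj; case: xgetP => [S' -> TS'|no]; last by case: (no S TS).
by apply/funext => y; apply: dot_extr => x; rewrite -TS -TS'.
Qed.

Lemma adjPl T : bounded_op T -> forall x y, hdot (adj T x) y = hdot x (T y).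
Proof. by move=> Tb x y; rewrite dotC -adjP // -dotC. Qed.

Lemma bounded_adj T : bounded_op T -> bounded_op (adj T).
Proof. by move=> Tb; have [S Sb TS] := ex_adjoint Tb; rewrite (adj_eq TS). Qed.

Lemma adj_comp S T : bounded_op S -> bounded_op T ->
  adj (S \o T) = adj T \o adj S.
Proof. by move=> Sb Tb; apply: adj_eq => x y; rewrite /= !adjP. Qed.

Lemma adjZD (a : R[i]) S T : bounded_op S -> bounded_op T ->
  adj (a *: S + T) = Num.conj a *: adj S + adj T.
Proof.
move=> Sb Tb; apply: adj_eq => x y.
by rewrite !fctE dotDl dotZl dotDr dotZr conjCK !adjP.
Qed.

Lemma adj_id : adj (id : H -> H) = id.
Proof. exact: adj_eq. Qed.

Lemma opb_adj T M : bounded_op T -> 0 <= M -> opb M T -> opb M (adj T).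
Proof. by move=> Tb M0 TM; apply: (opb_adjoint M0 TM); exact: adjP. Qed.

End SelfAdjoint.

(** * Constructing Hilbert spaces *)

(** A complete inner product on a mere module determines the norm and the topology.
    Completeness is asked of sequences, as the verifications produce it; a Cauchy
    filter has a sequence of points in its balls of radius 1/(k+1). *)
HB.factory Record Lmodule_isHilbert (R : realType) H & GRing.Lmodule R[i] H := {
  ip : H -> H -> R[i];
  ip_linearl : forall a x y z, ip (a *: x + y) z = a * ip x z + ip y z;
  ipC : forall x y, ip x y = Num.conj (ip y x);
  ip_ge0 : forall x, 0 <= complex.Re (ip x x);
  ip_eq0 : forall x, complex.Re (ip x x) = 0 -> x = 0;
  ip_complete : forall u : nat -> H,
    (forall e : R, 0 < e -> exists N, forall i j, (N <= i)%N -> (N <= j)%N ->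
       complex.Re (ip (u i - u j) (u i - u j)) < e) ->
    exists l, forall e : R, 0 < e -> exists N, forall i, (N <= i)%N ->
       complex.Re (ip (u i - l) (u i - l)) < e }.

HB.builders Context R H & Lmodule_isHilbert R H.

Lemma ip_lin0 z : ip 0 z = 0.
Proof.
by have := ip_linearl 1 0 0 z; rewrite scale1r mul1r !addr0 => /esym/eqP;
   rewrite -subr_eq0 addrK => /eqP.
Qed.

Lemma ipDl x y z : ip (x + y) z = ip x z + ip y z.
Proof. by rewrite -{1}[x]scale1r ip_linearl mul1r. Qed.

Lemma ipZl a x z : ip (a *: x) z = a * ip x z.
Proof. by rewrite -[_ *: _]addr0 ip_linearl ip_lin0 addr0. Qed.

Lemma ipDr x y z : ip z (x + y) = ip z x + ip z y.
Proof. by rewrite ipC ipDl rmorphD /= -!ipC. Qed.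

Lemma ipZr a x z : ip z (a *: x) = Num.conj a * ip z x.
Proof. by rewrite ipC ipZl rmorphM /= -!ipC. Qed.

Let zmodl u' : zmod_morphism (ip ^~ u').
Proof.
by move=> x y; rewrite /= -scaleN1r ipDl ipZl mulN1r.
Qed.

Let zmodr u : zmod_morphism (ip u).
Proof. by move=> x y; rewrite -scaleN1r ipDr ipZr rmorphN rmorph1 mulN1r. Qed.

Let scall u' : scalable_for *%R (ip ^~ u').
Proof. by move=> a x; exact: ipZl. Qed.

Let scalr u : scalable_for (Num.conj \; *%R) (ip u).
Proof. by move=> a x; exact: ipZr. Qed.

HB.instance Definition _ := isBilinear.Build R[i] H H R[i] *%R
  (Num.conj \; *%R) ip zmodl zmodr scall scalr.

Let herm x y : ip x y = (-1) ^+ false * Num.conj (ip y x).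
Proof. by rewrite expr0 mul1r ipC. Qed.

HB.instance Definition _ := isHermitianSesquilinear.Build R[i] H false Num.conj
  ip herm.

Lemma ipxx x : ip x x = (complex.Re (ip x x))%:C.
Proof.
have := ipC x x; case: (ip x x) => a b /eqP; rewrite eq_complex /= => /andP[_].
by rewrite -subr_eq0 opprK -mulr2n mulrn_eq0 /= => /eqP ->.
Qed.

Let pos x : x != 0 -> 0 < ip x x.
Proof.
move=> x0; rewrite ipxx ltcR lt_neqAle ip_ge0 andbT eq_sym.
by apply: contra_neq x0; exact: ip_eq0.
Qed.

HB.instance Definition _ := isDotProduct.Build R[i] H ip pos.

Definition inorm x : R[i] := (Num.sqrt (complex.Re (ip x x)))%:C.

Let q x := complex.Re (ip x x).
Let sq x : Num.sqrt (q x) ^+ 2 = q x.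
Proof. by rewrite sqr_sqrtr // ip_ge0. Qed.

Lemma q_sqrD x y : q (x + y) = q x + q y + 2 * complex.Re (ip x y).
Proof. by rewrite /q ipDl !ipDr !cReD [ip y x]ipC cRe_conj; ring. Qed.

Lemma q_realZ (r : R) x : q (r%:C *: x) = r ^+ 2 * q x.
Proof. by rewrite /q ipZl ipZr conj_real !cReM expr2 mulrA. Qed.

Lemma ip_cauchy_schwarz x y :
  complex.Re (ip x y) <= Num.sqrt (q x) * Num.sqrt (q y).
Proof.
have x0 := sqrtr_ge0 (q x); have y0 := sqrtr_ge0 (q y).
have h t : 0 <= q x + t ^+ 2 * q y + 2 * t * complex.Re (ip x y).
  have : 0 <= q (x + t%:C *: y) by exact: ip_ge0.
  by rewrite q_sqrD q_realZ ipZr conj_real cReM mulrA.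
have [yz|yz] := eqVneq (q y) 0.
  by rewrite (ip_eq0 yz) ipC ip_lin0 rmorph0 /= mulr_ge0 ?sqrtr_ge0.
have [xz|xz] := eqVneq (q x) 0.
  by rewrite (ip_eq0 xz) ip_lin0 /= mulr_ge0 ?sqrtr_ge0.
have xp : 0 < Num.sqrt (q x) by rewrite sqrtr_gt0 lt_neqAle eq_sym xz ip_ge0.
have yp : 0 < Num.sqrt (q y) by rewrite sqrtr_gt0 lt_neqAle eq_sym yz ip_ge0.
have := h (- (Num.sqrt (q x) / Num.sqrt (q y))).
rewrite -{1}[q x]sq -{2}[q y]sq.
have tp : 0 < Num.sqrt (q x) / Num.sqrt (q y) by rewrite divr_gt0.
have : Num.sqrt (q x) = Num.sqrt (q x) / Num.sqrt (q y) * Num.sqrt (q y).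
  by rewrite divfK // gt_eqF.
move: tp; set t := _ / _ => tp -> ht.
by rewrite -(ler_pM2l tp); lra.
Qed.

Lemma inormD x y : inorm (x + y) <= inorm x + inorm y.
Proof.
rewrite /inorm -rmorphD lecR; apply: le_of_sqr; first by rewrite addr_ge0 ?sqrtr_ge0.
rewrite sq q_sqrD sqrrD !sq -[_ *+ 2]mulr_natl; have := ip_cauchy_schwarz x y.
by rewrite /q; lra.
Qed.

Lemma inormZ (l : R[i]) x : inorm (l *: x) = `|l| * inorm x.
Proof.
rewrite /inorm nmE -rmorphM; congr _%:C; rewrite ipZl ipZr mulrA -sqr_nm cReM.
by rewrite sqrtrM ?sqr_ge0 // sqrtr_sqr ger0_norm ?nm_ge0.
Qed.

Lemma inorm_eq0 x : inorm x = 0 -> x = 0.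
Proof.
move=> /complexI/eqP; rewrite sqrtr_eq0 => h.
by apply: ip_eq0; apply/eqP; rewrite eq_le h ip_ge0.
Qed.

HB.instance Definition _ := Lmodule_isNormed.Build R[i] H inormD inormZ inorm_eq0.

Let nm_sqr x : nm (x : H) ^+ 2 = q x.
Proof. exact: sq. Qed.

Let complete (F : set_system H) : ProperFilter F -> cauchy F -> cvg F.
Proof.
move=> FF /cauchyP Fc.
have ex k : exists x, F (ball (x : H) ((k.+1%:R^-1)%:C : R[i])).
  by apply: Fc; rewrite ltcR invr_gt0.
have [u uF] := choice ex.
have near k j : nm (u k - u j) < k.+1%:R^-1 + j.+1%:R^-1.
  have [t []] := near_ex2 (uF k) (uF j).
  rewrite -!ball_normE /ball_ /= !nmE !ltcR => uk uj.
  apply: le_lt_trans (nm_dist_triangle _ t _) (ltrD uk _); by rewrite nmBC.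
have inv_le i j : (i <= j)%N -> (j.+1%:R^-1 : R) <= i.+1%:R^-1.
  by move=> ij; rewrite lef_pV2 ?posrE // ler_nat ltnS.
have [|l ul] := ip_complete (u := u).
  move=> e e0; have e1 : 0 < Num.min 1 (e / 4) by rewrite lt_min ltr01 divr_gt0.
  have [N] := invrn_lt_exists e1; rewrite lt_min => /andP[N1 Ne].
  exists N => i j Ni Nj; rewrite -/(q _) -nm_sqr.
  have h := near i j; have hi := inv_le _ _ Ni; have hj := inv_le _ _ Nj.
  have d0 := nm_ge0 (u i - u j); move: h hi hj N1 Ne d0.
  set d := nm _; set r := N.+1%:R^-1 => h hi hj N1 Ne d0.
  have r0 : 0 <= r by rewrite invr_ge0.
  move: r d (i.+1%:R^-1) (j.+1%:R^-1) h hi hj N1 Ne d0 r0.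
  move=> r d a b h hi hj N1 Ne d0 r0.
  have h1 : d * d <= 2 * r * (2 * r) by apply: ler_pM => //; lra.
  have h2 : r * r <= r by rewrite ler_piMl // ltW.
  rewrite expr2; lra.
apply/cvg_ex; exists l; apply/cvgrPdistC_lt => -[e e'] /=.
rewrite ltcE /= => /andP[/eqP -> e0].
have e2 : 0 < e / 2 by rewrite divr_gt0.
have [N1 uN1] := ul _ (exprn_gt0 2 e2).
have [N2 N2e] := invrn_lt_exists e2.
apply: filterS (uF (maxn N1 N2)) => t.
rewrite -ball_normE /ball_ /= !nmE !ltcR => ut.
apply: le_lt_trans (nm_dist_triangle _ (u (maxn N1 N2)) _) _.
rewrite [e]splitr; apply: ltrD; last first.
  have := uN1 _ (leq_maxl N1 N2); rewrite -/(q _) -nm_sqr.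
  by rewrite ltr_pXn2r // ?nnegrE ?nm_ge0 // ltW.
rewrite nmBC; apply: lt_trans ut (le_lt_trans _ N2e).
exact/inv_le/leq_maxr.
Qed.

HB.instance Definition _ := Uniform_isComplete.Build H complete.

Let normr_ip (x : H) : `|x| ^+ 2 = ip x x.
Proof. by rewrite nmE -rmorphXn /= nm_sqr [RHS]ipxx. Qed.

HB.instance Definition _ := isHilbert.Build R H normr_ip.

HB.end.

Section Series.
Context {R : realType}.

Lemma monotone_bounded_tends (a : nat -> R) (M : R) :
  (forall k, a k <= a k.+1) -> (forall k, a k <= M) ->
  exists2 l, forall k, a k <= l &
    forall e, 0 < e -> exists N, forall k, (N <= k)%N -> l - e < a k.
Proof.
move=> a_incr aM; have hs : has_sup (range a).
  by split; [exists (a 0%N); exists 0%N | exists M => _ [k _ <-]].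
exists (sup (range a)) => [k|e e0]; first by apply: sup_upper_bound => //; exists k.
have [_ [N _ <-] aN] := sup_adherent e0 hs; exists N => k Nk.
apply: lt_le_trans aN _; elim: k Nk => [|k IHk]; first by rewrite leqn0 => /eqP ->.
by rewrite leq_eqVlt => /predU1P[-> //|/IHk /le_trans]; apply.
Qed.

Lemma abs_series_tends (c : nat -> R[i]) (M : R) :
  (forall N, \sum_(k < N) nm (c k) <= M) ->
  exists l, tends \oo (fun N => \sum_(k < N) c k) l.
Proof.
move=> cM.
have real (b : nat -> R) : (forall k, `|b k| <= nm (c k)) ->
    exists l, forall e, 0 < e -> exists N, forall k, (N <= k)%N ->
      `|\sum_(j < k) b j - l| < e.
  move=> bc.
  have [|//|l1 l1P l1e] := @monotone_bounded_tends (fun N => \sum_(k < N) nm (c k)) M.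
    by move=> k; rewrite big_ord_recr lerDl nm_ge0.
  have [||l2 l2P l2e] := @monotone_bounded_tends
      (fun N => \sum_(k < N) (nm (c k) - b k)) (M + M).
  - move=> k; rewrite big_ord_recr lerDl subr_ge0.
    exact: le_trans (ler_norm _) (bc k).
  - move=> k; rewrite big_split /= lerD // (le_trans _ (cM k)) // ler_sum // => i _.
    by rewrite (le_trans (ler_norm _)) // normrN.
  exists (l1 - l2) => e e0.
  have [N1 h1] := l1e _ e0; have [N2 h2] := l2e _ e0.
  exists (maxn N1 N2) => k; rewrite geq_max => /andP[/h1 k1 /h2 k2].
  have := l1P k; have := l2P k; move: k1 k2; rewrite sumrB ltr_norml.
  by move=> *; apply/andP; split; lra.
have nmi : nm ('i%C : R[i]) = 1.
  by rewrite /nm normc_def /= expr0n expr1n add0r sqrtr1.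
have [|x xP] := real (fun k => complex.Re (c k)).
  by move=> k; have := normc_ge_Re (c k); rewrite nmE lecR.
have [|y yP] := real (fun k => complex.Im (c k)).
  move=> k; have := normc_ge_Re ((- 'i%C) * c k); rewrite nmE lecR nmM nmN nmi mul1r.
  by case: (c k) => a b /=; rewrite oppr0 mul0r sub0r mulNr mul1r opprK.
exists (x +i* y) => e e0; have e2 : 0 < e / 2 by rewrite divr_gt0.
have [N1 h1] := xP _ e2; have [N2 h2] := yP _ e2.
exists (maxn N1 N2) => // k /=; rewrite geq_max => /andP[/h1 k1 /h2 k2].
have Im_sum : complex.Im (\sum_(i < k) c i) = \sum_(i < k) complex.Im (c i).
  have ImD (v w : R[i]) : complex.Im (v + w) = complex.Im v + complex.Im w.
    by case: v w => [? ?] [? ?].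
  by elim/big_ind2: _ => [//|v a w b <- <-|//]; rewrite ImD.
set s := \sum_(i < k) c i - _.
have -> : s = (complex.Re s)%:C + 'i%C * (complex.Im s)%:C by exact: complexE.
apply: le_lt_trans (nm_triangle _ _) _; rewrite nmM !nm_real.
rewrite nmi mul1r [e]splitr ltrD //.
  by rewrite /s cReD cReN cRe_sum /=.
have -> : complex.Im s = \sum_(i < k) complex.Im (c i) - y.
  by rewrite -Im_sum /s; case: (\sum_(i < k) c i).
by [].
Qed.

End Series.

Lemma nm_sqr_dist (R : realType) (V : normedZmodType R[i]) (a b : V) :
  `|nm a ^+ 2 - nm b ^+ 2| <= nm (a - b) * (nm (a - b) + 2 * nm b).
Proof.
have := nm_triangle (a - b) b; have := nm_triangle (b - a) a; rewrite !subrK.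
have := nm_ge0 a; have := nm_ge0 b; have := nm_ge0 (a - b); rewrite [nm (b - a)]nmBC.
move=> h0 h1 h2 h3 h4; rewrite subr_sqr normrM; apply: ler_pM => //.
  by rewrite ler_norml; apply/andP; split; lra.
by rewrite ger0_norm; lra.
Qed.

Section SquareSummable.
Context {R : realType} {H : hilbertType R}.
Implicit Types x y : nat -> H.

Definition sqsum x (N : nat) : R := \sum_(k < N) nm (x k) ^+ 2.

Definition square_summable : {pred nat -> H} :=
  fun x => `[< exists M : R, forall N, sqsum x N <= M >].

Lemma square_summableP x :
  reflect (exists M : R, forall N, sqsum x N <= M) (x \in square_summable).
Proof. exact: asboolP. Qed.

Lemma sqsumD x y N : sqsum (x + y) N <= 2 * sqsum x N + 2 * sqsum y N.
Proof.
rewrite !mulr_sumr -big_split /= ler_sum // => k _.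
by have := parallelogram (x k) (y k); have := sqr_ge0 (nm (x k - y k));
   rewrite [(x + y) k]/(x k + y k); lra.
Qed.

Lemma sqsumZ (a : R[i]) x N : sqsum (a *: x) N = nm a ^+ 2 * sqsum x N.
Proof. by rewrite mulr_sumr; apply: eq_bigr => k _; rewrite nmZ exprMn. Qed.

Lemma square_summable_submod : submod_closed square_summable.
Proof.
split.
  apply/square_summableP; exists 0 => N; rewrite /sqsum big1 // => k _.
  by rewrite nm0 expr0n.
move=> a x y /square_summableP[M xM] /square_summableP[M' yM].
apply/square_summableP; exists (2 * (nm a ^+ 2 * M) + 2 * M') => N.
apply: le_trans (sqsumD _ _ _) _; rewrite sqsumZ.
by rewrite lerD // ler_pM2l // ler_wpM2l // exprn_ge0 // nm_ge0.
Qed.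

HB.instance Definition _ := GRing.isSubmodClosed.Build R[i] (nat -> H)
  square_summable square_summable_submod.

End SquareSummable.

Definition ell2 (R : realType) (H : hilbertType R) :=
  {x : nat -> H | x \in square_summable}.

Section Ell2.
Context {R : realType} {H : hilbertType R}.

HB.instance Definition _ := SubType.on (ell2 H).
HB.instance Definition _ := [Choice of ell2 H by <:].
HB.instance Definition _ := [SubChoice_isSubLmodule of ell2 H by <:].

Implicit Types x y z : ell2 H.

Definition dotsum x y (N : nat) : R[i] := \sum_(k < N) hdot (val x k) (val y k).

Lemma ell2_bound x : exists M : R, forall N, sqsum (val x) N <= M.
Proof. exact/square_summableP/(valP x). Qed.

Lemma dotsum_ex x y : exists l, tends \oo (dotsum x y) l.
Proof.
have [M xM] := ell2_bound x; have [M' yM] := ell2_bound y.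
apply: (@abs_series_tends R (fun k => hdot (val x k) (val y k)) (M + M')) => N.
apply: le_trans (lerD (xM N) (yM N)); rewrite -big_split /= ler_sum // => k _.
apply: le_trans (cauchy_schwarz _ _) _.
have := sqr_ge0 (nm (val x k) - nm (val y k)).
have := sqr_ge0 (nm (val x k)); have := sqr_ge0 (nm (val y k)); nra.
Qed.

Definition ell2_dot x y : R[i] := xget 0 [set l | tends \oo (dotsum x y) l].

Lemma ell2_dotP x y : tends \oo (dotsum x y) (ell2_dot x y).
Proof.
rewrite /ell2_dot; case: xgetP => [l -> //|no].
by have [l xyl] := dotsum_ex x y; case: (no l xyl).
Qed.

Lemma ell2_dotE x y l : tends \oo (dotsum x y) l -> ell2_dot x y = l.
Proof. by move=> xyl; exact: tends_unique (ell2_dotP x y) xyl. Qed.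

Lemma ell2_dot_linear (a : R[i]) x y z :
  ell2_dot (a *: x + y) z = a * ell2_dot x z + ell2_dot y z.
Proof.
apply/ell2_dotE.
apply: tends_eq (tendsD (tendsM a (ell2_dotP x z)) (ell2_dotP y z)) => N.
rewrite mulr_sumr -big_split; apply: eq_bigr => k _ /=.
by rewrite dotDl dotZl.
Qed.

Lemma ell2_dotC x y : ell2_dot x y = Num.conj (ell2_dot y x).
Proof.
apply/ell2_dotE; apply: tends_eq (tends_conj (ell2_dotP y x)) => N.
by rewrite /= rmorph_sum; apply: eq_bigr => k _; rewrite [RHS]dotC.
Qed.

Lemma dotsumxx x N : dotsum x x N = (sqsum (val x) N)%:C.
Proof. by rewrite rmorph_sum; apply: eq_bigr => k _; rewrite dotxx. Qed.

Lemma sqsum_mono (u : nat -> H) N N' : (N <= N')%N -> sqsum u N <= sqsum u N'.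
Proof.
move=> NN; rewrite -(subnKC NN) /sqsum big_split_ord /= lerDl sumr_ge0 // => k _.
exact: sqr_ge0.
Qed.

Lemma Re_tends_le (u : nat -> R[i]) l (M : R) N0 : tends \oo u l ->
  (forall N, (N0 <= N)%N -> complex.Re (u N) <= M) -> complex.Re l <= M.
Proof.
move=> ul uM; apply/ler_addgt0Pr => e e0.
have [N [uN N0N]] : exists N, nm (u N - l) < e /\ (N0 <= N)%N.
  by apply: (near_ex2 (F := \oo)); [exact: ul | exists N0].
have := uM _ N0N; have := Re_le_nm (l - u N); rewrite nmBC cReD cReN; lra.
Qed.

Lemma Re_tends_ge (u : nat -> R[i]) l (M : R) N0 : tends \oo u l ->
  (forall N, (N0 <= N)%N -> M <= complex.Re (u N)) -> M <= complex.Re l.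
Proof.
move=> ul uM; rewrite -lerN2 -cReN; apply: (Re_tends_le (N0 := N0) (tendsN ul)) => N Nk.
by rewrite cReN lerN2; exact: uM Nk.
Qed.

Lemma sqsum_le x N : sqsum (val x) N <= complex.Re (ell2_dot x x).
Proof.
apply: (Re_tends_ge (N0 := N) (ell2_dotP x x)) => k Nk.
by rewrite dotsumxx /= sqsum_mono.
Qed.

Lemma ell2_dot_le x M : (forall N, sqsum (val x) N <= M) ->
  complex.Re (ell2_dot x x) <= M.
Proof.
move=> xM; apply: (Re_tends_le (N0 := 0) (ell2_dotP x x)) => k _.
by rewrite dotsumxx /=.
Qed.

Lemma ell2_dot_ge0 x : 0 <= complex.Re (ell2_dot x x).
Proof. by apply: le_trans (sqsum_le x 0); rewrite /sqsum big_ord0. Qed.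

Lemma coord_le x k : nm (val x k) ^+ 2 <= complex.Re (ell2_dot x x).
Proof.
apply: le_trans (sqsum_le x k.+1); rewrite /sqsum big_ord_recr /= lerDr.
by rewrite sumr_ge0 // => i _; exact: sqr_ge0.
Qed.

Lemma ell2_dot_eq0 x : complex.Re (ell2_dot x x) = 0 -> x = 0.
Proof.
move=> x0; apply: val_inj; apply/funext => k; apply/nm_eq0/eqP.
by rewrite -sqrf_eq0 eq_le sqr_ge0 andbT -x0 coord_le.
Qed.

(** The limit exists entry by entry, and the Cauchy bounds on finite sections pass to
    it. *)
Lemma ell2_complete (u : nat -> ell2 H) :
  (forall e : R, 0 < e -> exists N, forall i j, (N <= i)%N -> (N <= j)%N ->
     complex.Re (ell2_dot (u i - u j) (u i - u j)) < e) ->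
  exists l, forall e : R, 0 < e -> exists N, forall i, (N <= i)%N ->
     complex.Re (ell2_dot (u i - l) (u i - l)) < e.
Proof.
move=> uC.
have ex k : exists l, tends \oo (fun i => val (u i) k) l.
  apply: cauchy_seq => e e0; have [N uN] := uC _ (exprn_gt0 2 e0).
  exists N => i j Ni Nj; rewrite -(@ltr_pXn2r _ 2) ?nnegrE ?nm_ge0 ?ltW //.
  exact: le_lt_trans (coord_le (u i - u j) k) (uN _ _ Ni Nj).
have [l ul] := choice ex.
have key (e : R) : 0 < e -> exists N, forall i, (N <= i)%N ->
    forall M, sqsum (val (u i) - l) M <= e.
  move=> e0; have [N uN] := uC _ e0; exists N => i Ni M.
  have : tends \oo (fun j => \sum_(k < M) hdot (val (u i) k - val (u j) k) 
      (val (u i) k - val (u j) k)) (\sum_(k < M) ((nm (val (u i) k - l k)) ^+ 2)%:C).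
    apply: tends_sum => k _; rewrite -dotxx => d d0.
    have c : tends \oo (fun j => val (u i) k - val (u j) k) (val (u i) k - l k).
      by apply: tendsB; [exact: tends_cst | exact: ul].
    pose B := nm (val (u i) k - l k).
    have B0 : 0 <= B by exact: nm_ge0.
    have Bp : 0 < 2 * B + 1 by lra.
    have dp : 0 < Num.min 1 (d / (2 * B + 1)) by rewrite lt_min ltr01 divr_gt0.
    apply: filterS (c _ dp) => j; rewrite lt_min => /andP[c1].
    rewrite ltr_pdivlMr //.
    rewrite !dotxx -rmorphB nm_real => c2.
    apply: le_lt_trans (nm_sqr_dist _ (val (u i) k - l k)) _.
    apply: le_lt_trans c2; rewrite ler_wpM2l ?nm_ge0 // -/B; lra.
  move=> /(Re_tends_le (N0 := N)) h; have : complex.Re 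
    (\sum_(k < M) ((nm (val (u i) k - l k)) ^+ 2)%:C) <= e.
    apply: h => j Nj; apply: le_trans (ltW (uN _ _ Ni Nj)).
    apply: le_trans _ (sqsum_le (u i - u j) M).
    by rewrite cRe_sum ler_sum // => k _; rewrite dotxx.
  by rewrite cRe_sum.
have lP : l \in square_summable.
  have [N h] := key 1 ltr01; have [M' uM] := ell2_bound (u N).
  apply/square_summableP; exists (2 * M' + 2 * 1) => M.
  have -> : l = val (u N) + - (val (u N) - l) by rewrite opprB addrC subrK.
  apply: le_trans (sqsumD _ _ _) _; rewrite lerD // ler_pM2l //.
  apply: le_trans (h _ (leqnn N) M); rewrite ler_sum // => k _.
  by rewrite [X in nm X]/(- _) nmN.
exists (Sub l lP : ell2 H) => e e0.
have [N h] := key _ (divr_gt0 e0 (ltr0n _ 2)); exists N => i Ni.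
apply: le_lt_trans (_ : _ <= e / 2) _; last by lra.
by apply: ell2_dot_le => M; exact: h.
Qed.

HB.instance Definition _ := Lmodule_isHilbert.Build R (ell2 H)
  ell2_dot_linear ell2_dotC ell2_dot_ge0 ell2_dot_eq0 ell2_complete.

Lemma slot_proof (m : nat) (h : H) :
  (fun k => if k == m then h else 0) \in @square_summable R H.
Proof.
apply/square_summableP; exists (nm h ^+ 2) => N; rewrite /sqsum.
have [mN|Nm] := ltnP m N.
  rewrite (bigD1 (Ordinal mN)) //= eqxx big1 ?addr0 // => k kn.
  by rewrite (_ : (k == m :> nat) = false) ?nm0 ?expr0n //; apply/negbTE.
rewrite big1 ?sqr_ge0 // => k _; rewrite (_ : (k == m :> nat) = false) ?nm0 ?expr0n //.
by apply/negbTE; rewrite neq_ltn (leq_trans (ltn_ord k) Nm).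
Qed.

Definition slot (m : nat) (h : H) : ell2 H :=
  exist (fun x : nat -> H => x \in square_summable) _ (slot_proof m h).

Lemma dot_slotl m (h : H) (x : ell2 H) : hdot (slot m h) x = hdot h (val x m).
Proof.
apply: ell2_dotE => e e0; exists m.+1 => // N /= mN.
rewrite /dotsum /= (bigD1 (Ordinal mN)) //= eqxx big1 ?addr0 ?subrr ?nm0 // => j jm.
rewrite (_ : (j == m :> nat) = false) ?dot0l //; exact/negbTE.
Qed.

Lemma dot_slot m k (h h' : H) : hdot (slot m h) (slot k h') = (m == k)%:R * hdot h h'.
Proof.
by rewrite dot_slotl /=; case: eqP => _; rewrite ?mul1r ?mul0r ?dot0r.
Qed.

End Ell2.

(** * Closed subspaces as Hilbert spaces *)

Record closed_subspace (R : realType) (H : hilbertType R) := ClosedSubspace {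
  cset : set H;
  cset_sub : is_subspace cset;
  cset_closed : closed cset }.

Section ClosedSubspace.
Context {R : realType} {H : hilbertType R} (S : closed_subspace H).

Definition cpred : {pred H} := fun x => `[< cset S x >].

Lemma cpredP x : reflect (cset S x) (x \in cpred).
Proof. exact: asboolP. Qed.

Lemma cpred_submod : submod_closed cpred.
Proof.
have [S0 SD] := cset_sub S.
split; first exact/cpredP.
by move=> a x y /cpredP Sx /cpredP Sy; apply/cpredP/SD.
Qed.

HB.instance Definition _ := GRing.isSubmodClosed.Build R[i] H cpred cpred_submod.

Definition subspace_type := {x : H | x \in cpred}.

HB.instance Definition _ := SubType.on subspace_type.
HB.instance Definition _ := [Choice of subspace_type by <:].
HB.instance Definition _ := [SubChoice_isSubLmodule of subspace_type by <:].

Implicit Types x y z : subspace_type.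

Definition sub_dot x y := hdot (val x) (val y).

Lemma sub_dot_linear (a : R[i]) x y z :
  sub_dot (a *: x + y) z = a * sub_dot x z + sub_dot y z.
Proof. by rewrite /sub_dot -dotZl -dotDl. Qed.

Lemma sub_dotC x y : sub_dot x y = Num.conj (sub_dot y x).
Proof. exact: dotC. Qed.

Lemma sub_dot_ge0 x : 0 <= complex.Re (sub_dot x x).
Proof. by rewrite /sub_dot -nm_sqr_Re sqr_ge0. Qed.

Lemma sub_dot_eq0 x : complex.Re (sub_dot x x) = 0 -> x = 0.
Proof.
rewrite /sub_dot -nm_sqr_Re => /eqP; rewrite sqrf_eq0 => /eqP/nm_eq0 x0.
exact: val_inj.
Qed.

Lemma sub_complete (u : nat -> subspace_type) :
  (forall e : R, 0 < e -> exists N, forall i j, (N <= i)%N -> (N <= j)%N ->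
     complex.Re (sub_dot (u i - u j) (u i - u j)) < e) ->
  exists l, forall e : R, 0 < e -> exists N, forall i, (N <= i)%N ->
     complex.Re (sub_dot (u i - l) (u i - l)) < e.
Proof.
move=> uC; have [|l ul] := @cauchy_seq R H (fun k => val (u k)).
  move=> e e0; have [N uN] := uC _ (exprn_gt0 2 e0); exists N => i j Ni Nj.
  rewrite -(@ltr_pXn2r _ 2) ?nnegrE ?nm_ge0 ?ltW //.
  by rewrite nm_sqr_Re; exact: uN.
have Sl : l \in cpred.
  apply/cpredP/(closed_approx (@cset_closed _ _ S)) => e e0.
  have [N _ uN] := ul _ e0; exists (val (u N)); first exact/cpredP/(valP (u N)).
  by rewrite nmBC; exact: uN (leqnn N).
exists (Sub l Sl : subspace_type) => e e0.
have [N _ uN] := ul (Num.sqrt e) ltac:(by rewrite sqrtr_gt0); exists N => i Ni.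
rewrite /sub_dot -nm_sqr_Re -[e in _ < e]sqr_sqrtr ?ltW //.
rewrite ltr_pXn2r ?nnegrE ?nm_ge0 ?sqrtr_ge0 //; exact: uN Ni.
Qed.

HB.instance Definition _ := Lmodule_isHilbert.Build R subspace_type
  sub_dot_linear sub_dotC sub_dot_ge0 sub_dot_eq0 sub_complete.

Lemma sub_nmE x : nm x = nm (val x).
Proof. by apply/eqP; rewrite -(@eqrXn2 _ 2) ?nm_ge0 // !nm_sqr_Re. Qed.

End ClosedSubspace.

(** * Limits of operators, spans, and unitaries from Gram matrices *)

Section MoreLimits.
Context {R : realType} {H K : hilbertType R}.

Lemma tends_dot2 (I : Type) (F : set_system I) {FF : Filter F} (u v : I -> H) l k :
  tends F u l -> tends F v k -> tends F (fun t => hdot (u t) (v t)) (hdot l k).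
Proof.
move=> ul vk e e0.
pose C := nm k + nm l + 1.
have C0 : 0 < C by rewrite /C; have := nm_ge0 k; have := nm_ge0 l; lra.
have e1 : 0 < Num.min 1 (e / C) by rewrite lt_min ltr01 divr_gt0.
apply: filterS2 (ul _ e1) (vk _ e1) => t; rewrite !lt_min.
rewrite !ltr_pdivlMr // => /andP[_ ut] /andP[v1 vt].
have -> : hdot (u t) (v t) - hdot l k = hdot (u t - l) (v t) + hdot l (v t - k).
  by rewrite dotBl dotBr addrA subrK.
apply: le_lt_trans (nm_triangle _ _) _.
apply: le_lt_trans (lerD (cauchy_schwarz _ _) (cauchy_schwarz _ _)) _.
have h : nm (v t) <= nm (v t - k) + nm k.
  by have := nm_triangle (v t - k) k; rewrite subrK.
move: ut vt v1 h; rewrite /C.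
have := nm_ge0 (u t - l); have := nm_ge0 (v t - k); have := nm_ge0 l.
have := nm_ge0 k; have := nm_ge0 (v t).
set a := nm (u t - l); set b := nm (v t - k); set x := nm l; set y := nm k.
set w := nm (v t) => w0 y0 x0 b0 a0 ut vt b1 h.
have : a * w <= a * (b + y) by rewrite ler_wpM2l.
have [ab|ba] := leP a b; nra.
Qed.

Lemma op_complete (T : nat -> H -> K) : (forall k, bounded_op (T k)) ->
  (forall e : R, 0 < e -> exists N, forall i j, (N <= i)%N -> (N <= j)%N ->
     opb e (T i - T j)) ->
  exists2 A, bounded_op A & ncvg \oo T A.
Proof.
move=> Tb TC.
have ex x : exists l, tends \oo (fun k => T k x) l.
  apply: cauchy_seq => e e0; have xp : 0 < nm x + 1 by rewrite ltr_wpDl ?nm_ge0.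
  have [N TN] := TC _ (divr_gt0 e0 xp); exists N => i j Ni Nj.
  apply: le_lt_trans (TN _ _ Ni Nj x) _.
  by rewrite mulrAC ltr_pdivrMr // ltr_pM2l // ltrDl.
have [A TA] := choice ex.
have Al : linear A.
  move=> a x y; apply: (tends_unique (TA _)).
  apply: tends_eq (tendsD (tendsZ a (TA x)) (TA y)) => k.
  by rewrite (bounded_linear (Tb k)).
have bnd e : 0 < e -> exists N, forall i, (N <= i)%N -> opb e (T i - A).
  move=> e0; have [N TN] := TC _ e0; exists N => i Ni x.
  have h : tends \oo (fun j => T i x - T j x) (T i x - A x).
    by apply: tendsB; [exact: tends_cst | exact: TA].
  apply: (nm_tends_le h); exists N => // j /= Nj; exact: TN.
exists A; last by move=> e /bnd[N TN]; exists N.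
have [N TN] := bnd 1 ltr01.
have /bounded_opP[_ [M M0 TM]] := Tb N.
apply/bounded_opP; split=> //; exists (1 + M); first by rewrite addr_ge0.
move=> x; have -> : A x = (- ((T N - A) + - T N)) x.
  have -> : (- ((T N - A) + - T N)) x = - ((T N x - A x) - T N x) by [].
  by rewrite addrAC subrr sub0r opprK.
by apply: opbN; apply: (opbD (TN _ (leqnn N)) (opbN TM)).
Qed.

Lemma ncvg_opb (I : Type) (F : set_system I) {FF : ProperFilter F}
    (T : I -> H -> K) A (M : R) :
  ncvg F T A -> (\forall t \near F, opb M (T t)) -> opb M A.
Proof.
move=> TA TM x; apply: (nm_tends_le (ncvg_tends x TA)).
by apply: filterS TM => t; exact.
Qed.

Lemma ncvg_unique (I : Type) (F : set_system I) {FF : ProperFilter F}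
    (T : I -> H -> K) A B : ncvg F T A -> ncvg F T B -> A = B.
Proof.
move=> TA TB; apply/funext => x.
exact: tends_unique (ncvg_tends x TA) (ncvg_tends x TB).
Qed.

Lemma ncvgD (I : Type) (F : set_system I) {FF : Filter F}
    (S T : I -> H -> K) A B : ncvg F S A -> ncvg F T B ->
  ncvg F (fun t => S t + T t) (A + B).
Proof.
move=> SA TB e e0; have e2 : 0 < e / 2 by rewrite divr_gt0.
apply: filterS2 (SA _ e2) (TB _ e2) => t Se Te.
by rewrite [e]splitr opprD addrACA; exact: opbD.
Qed.

Lemma ncvgZ (I : Type) (F : set_system I) {FF : Filter F}
    (a : R[i]) (T : I -> H -> K) A : ncvg F T A ->
  ncvg F (fun t => a *: T t) (a *: A).
Proof.
move=> TA e e0; have ap : 0 < nm a + 1 by rewrite ltr_wpDl ?nm_ge0.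
apply: filterS (TA _ (divr_gt0 e0 ap)) => t Te.
rewrite -scalerBr; apply: opb_le (opbZ a Te).
rewrite mulrCA; apply: ler_piMr; first exact: ltW.
by rewrite ler_pdivrMr // mul1r lerDl.
Qed.

Lemma opb_ge0 (M : R) (T : H -> K) (x : H) : opb M T -> nm x != 0 -> 0 <= M.
Proof.
move=> TM x0; have xp : 0 < nm x by rewrite lt_neqAle eq_sym x0 nm_ge0.
by rewrite -(pmulr_lge0 _ xp); exact: le_trans (nm_ge0 _) (TM x).
Qed.

Lemma ncvg_bound (I : Type) (F : set_system I) {FF : Filter F} (T : I -> H -> K) A :
  bounded_op A -> ncvg F T A ->
  exists2 M, 0 <= M & \forall t \near F, opb M (T t).
Proof.
move=> /bounded_opP[_ [M M0 AM]] TA; exists (1 + M); first by rewrite addr_ge0.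
apply: filterS (TA _ ltr01) => t T1.
have -> : T t = (T t - A) + A by rewrite subrK.
exact: opbD.
Qed.

End MoreLimits.

Lemma ncvg_comp (R : realType) (H K L : hilbertType R) (I : Type)
    (F : set_system I) {FF : Filter F}
    (S : I -> K -> L) (T : I -> H -> K) A B :
  (\forall t \near F, linear (S t)) -> bounded_op A -> bounded_op B ->
  ncvg F S A -> ncvg F T B -> ncvg F (fun t => S t \o T t) (A \o B).
Proof.
move=> Sl Ab Bb SA TB; have [M M0 SM] := ncvg_bound Ab SA.
have /bounded_opP[_ [N N0 BN]] := Bb.
move=> e e0; have c0 : 0 < M + N + 1 by lra.
have SlM : \forall t \near F, linear (S t) /\ opb M (S t).
  by apply: filterS2 Sl SM => t.
apply: filterS3 SlM (SA _ (divr_gt0 e0 c0)) (TB _ (divr_gt0 e0 c0)).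
move=> t [{}Sl {}SM] Se Te x.
have -> : ((S t \o T t) - (A \o B)) x = S t (T t x) - A (B x) by [].
have -> : S t (T t x) - A (B x) = S t (T t x - B x) + (S t (B x) - A (B x)).
  by rewrite (linB Sl) addrA subrK.
apply: le_trans (nm_triangle _ _) _.
apply: le_trans (lerD (SM _) (Se _)) _.
apply: (@le_trans _ _ (M * (e / (M + N + 1) * nm x) + e / (M + N + 1) * (N * nm x))).
  apply: lerD; first by rewrite ler_wpM2l //; exact: Te.
  by apply: ler_wpM2l; [rewrite ltW // divr_gt0 | exact: BN].
have -> : M * (e / (M + N + 1) * nm x) + e / (M + N + 1) * (N * nm x) =
  (M + N) / (M + N + 1) * (e * nm x) by field; rewrite gt_eqF.
apply: ler_piMl; first by rewrite mulr_ge0 ?nm_ge0 // ltW.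
by rewrite ler_pdivrMr // mul1r; lra.
Qed.

Section Spans.
Context {R : realType} {H : hilbertType R}.

Definition lincomb (I : Type) (v : I -> H) (s : seq (R[i] * I)) : H :=
  \sum_(p <- s) p.1 *: v p.2.

Lemma lincomb_cat (I : Type) (v : I -> H) s t :
  lincomb v (s ++ t) = lincomb v s + lincomb v t.
Proof. by rewrite /lincomb big_cat. Qed.

Definition sscale (I : Type) (a : R[i]) (s : seq (R[i] * I)) :=
  [seq (a * p.1, p.2) | p <- s].

Lemma lincomb_scale (I : Type) (v : I -> H) a s :
  lincomb v (sscale a s) = a *: lincomb v s.
Proof.
rewrite /lincomb big_map scaler_sumr; apply: eq_bigr => p _.
by rewrite scalerA.
Qed.

Lemma closed_span_sub (A : set H) (S : set H) :
  is_subspace S -> closed S -> A `<=` S -> closed_span A `<=` S.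
Proof. by move=> Ss Sc AS x; apply; split. Qed.

Lemma closed_span_is (A : set H) : is_subspace (closed_span A).
Proof.
split; first by move=> S [[S0 _] _ _].
move=> a x y xS yS S SP; have [[_ SD] _ _] := SP.
by apply: SD; [exact: xS | exact: yS].
Qed.

Lemma closed_span_closed (A : set H) : closed (closed_span A).
Proof.
apply: approx_closed => x xA S SP; have [_ Sc _] := SP.
apply: (closed_approx Sc) => e /xA[y yA xy]; exists y => //; exact: yA.
Qed.

Lemma closed_span_gen (A : set H) : A `<=` closed_span A.
Proof. by move=> x Ax S [_ _]; exact. Qed.

Lemma closed_span_approx (I : Type) (v : I -> H) x : closed_span (range v) x ->
  forall e : R, 0 < e -> exists s, nm (x - lincomb v s) < e.
Proof.
pose S := [set x | forall e : R, 0 < e -> exists s, nm (x - lincomb v s) < e].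
move=> xv; apply: (closed_span_sub (S := S)) xv.
- split; first by move=> e e0; exists [::]; rewrite /lincomb big_nil subr0 nm0.
  move=> a y z yS zS e e0; have ap : 0 < nm a + 1 by rewrite ltr_wpDl ?nm_ge0.
  have [s ys] := yS (e / 2 / (nm a + 1)) ltac:(by rewrite !divr_gt0).
  have [t zt] := zS (e / 2) ltac:(by rewrite divr_gt0).
  exists (sscale a s ++ t); rewrite lincomb_cat lincomb_scale opprD addrACA -scalerBr.
  rewrite [e]splitr; apply: le_lt_trans (nm_triangle _ _) _.
  apply: ler_ltD => //; rewrite nmZ; move: ys; rewrite ltr_pdivlMr // => /ltW.
  by apply: le_trans; rewrite mulrC ler_wpM2l ?nm_ge0 // lerDl.
- apply: approx_closed => y yS e e0; have e2 : 0 < e / 2 by rewrite divr_gt0.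
  have [z zS yz] := yS _ e2; have [s zs] := zS _ e2; exists s.
  rewrite [e]splitr; exact: le_lt_trans (nm_dist_triangle _ z _) (ltrD yz zs).
move=> _ [i _ <-] e e0; exists [:: (1, i)].
by rewrite /lincomb big_seq1 scale1r subrr nm0.
Qed.

Lemma dot_eq_span (I : Type) (v : I -> H) x y : closed_span (range v) = setT ->
  (forall i, hdot x (v i) = hdot y (v i)) -> x = y.
Proof.
move=> vT xy; apply/eqP; rewrite -subr_eq0; apply/eqP/nm_eq0/eqP.
rewrite eq_le nm_ge0 andbT leNgt; apply/negP => z0.
have : closed_span (range v) (x - y) by rewrite vT.
move=> /closed_span_approx/(_ _ z0)[s]; apply/negP; rewrite -leNgt.
rewrite -(ler_pM2l z0) -expr2 nm_sqr_Re.
have -> : hdot (x - y) (x - y) = hdot (x - y) (x - y - lincomb v s).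
  rewrite [RHS]dotBr [hdot _ (lincomb v s)]dot_sumr big1 ?subr0 // => p _.
  by rewrite dotZr dotBl xy subrr mulr0.
exact: real_cauchy_schwarz.
Qed.

Lemma bounded_eq_span (K : hilbertType R) (I : Type) (v : I -> H) (S T : H -> K) :
  bounded_op S -> bounded_op T -> closed_span (range v) = setT ->
  (forall i, S (v i) = T (v i)) -> S = T.
Proof.
move=> Sb Tb vT ST; have D := boundedB Sb Tb; apply/funext => x.
have Sl := bounded_linear Sb; have Tl := bounded_linear Tb.
apply/eqP; rewrite -subr_eq0; apply/eqP/nm_eq0/eqP; rewrite eq_le nm_ge0 andbT.
apply/ler_addgt0Pr => e e0; rewrite add0r.
have /bounded_opP[Dl [M M0 DM]] := D; have Mp : 0 < M + 1 by rewrite ltr_wpDl.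
have : closed_span (range v) x by rewrite vT.
move=> /closed_span_approx/(_ _ (divr_gt0 e0 Mp))[s].
rewrite ltr_pdivlMr // => xs.
have -> : S x - T x = (S - T) (x - lincomb v s).
  rewrite (linB Dl); have -> : (S - T) (lincomb v s) = 0; last by rewrite subr0.
  rewrite (lin_sum Dl) big1 // => p _; rewrite (linZ Dl).
  by rewrite (_ : (S - T) _ = S (v p.2) - T (v p.2)) // ST subrr scaler0.
apply: le_trans (DM _) _; apply: le_trans (ltW xs).
by rewrite mulrC ler_wpM2l ?nm_ge0 // lerDl.
Qed.

End Spans.

Section Gram.
Context {R : realType} {H K : hilbertType R} {I : Type}.
Variables (v : I -> H) (w : I -> K).
Hypothesis gram : forall a b, hdot (v a) (v b) = hdot (w a) (w b).

Lemma gram_lincomb s t :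
  hdot (lincomb v s) (lincomb v t) = hdot (lincomb w s) (lincomb w t).
Proof.
rewrite /lincomb !dot_suml; apply: eq_bigr => p _; rewrite !dot_sumr.
by apply: eq_bigr => q _; rewrite !dotZl !dotZr gram.
Qed.

Lemma gram_dist s t :
  nm (lincomb v s - lincomb v t) = nm (lincomb w s - lincomb w t).
Proof.
have E (L : hilbertType R) (u : I -> L) : lincomb u s - lincomb u t =
    lincomb u (s ++ sscale (-1) t).
  by rewrite lincomb_cat lincomb_scale scaleN1r.
by apply/eqP; rewrite -(@eqrXn2 _ 2) ?nm_ge0 // !nm_sqr_Re !E gram_lincomb.
Qed.

(** The closure of the correspondence between equal linear combinations of v and
    of w. *)
Definition gram_rel (x : H) (y : K) := exists s : nat -> seq (R[i] * I),
  tends \oo (fun k => lincomb v (s k)) x /\ tends \oo (fun k => lincomb w (s k)) y.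

Lemma gram_rel_dot x y x' y' : gram_rel x y -> gram_rel x' y' ->
  hdot x x' = hdot y y'.
Proof.
move=> [s [sx sy]] [t [tx ty]].
apply: (tends_unique (tends_dot2 sx tx)).
by apply: tends_eq (tends_dot2 sy ty) => k; rewrite gram_lincomb.
Qed.

Lemma gram_rel_uniq x y y' : gram_rel x y -> gram_rel x y' -> y = y'.
Proof.
move=> xy xy'; apply/eqP; rewrite -subr_eq0; apply/eqP/nm_eq0/eqP.
rewrite -sqrf_eq0 nm_sqr_Re dotBl !dotBr.
rewrite -(gram_rel_dot xy xy) -(gram_rel_dot xy xy') -(gram_rel_dot xy' xy).
by rewrite -(gram_rel_dot xy' xy') !subrr.
Qed.

Lemma seq_approx (L : hilbertType R) (u : I -> L) x : closed_span (range u) x ->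
  exists s : nat -> seq (R[i] * I), tends \oo (fun k => lincomb u (s k)) x.
Proof.
move=> /closed_span_approx xu.
have [s sx] := choice (fun k => xu (k.+1%:R^-1) ltac:(by rewrite invr_gt0)).
exists s => e /invrn_lt_exists[N Ne]; exists N => // k /= Nk.
rewrite nmBC; apply: lt_trans (sx k) (le_lt_trans _ Ne).
by rewrite lef_pV2 ?posrE // ler_nat ltnS.
Qed.

Lemma tends_cauchy (L : hilbertType R) (u : nat -> L) l : tends \oo u l ->
  forall e : R, 0 < e -> exists N, forall i j, (N <= i)%N -> (N <= j)%N ->
      nm (u i - u j) < e.
Proof.
move=> ul e e0; have [N _ uN] := ul _ (divr_gt0 e0 (ltr0n _ 2)).
exists N => i j Ni Nj; apply: le_lt_trans (nm_dist_triangle _ l _) _.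
by rewrite [e]splitr ltrD //; [exact: uN Ni | rewrite nmBC; exact: uN Nj].
Qed.

Lemma gram_rel_total x : closed_span (range v) x -> exists y, gram_rel x y.
Proof.
move=> /seq_approx[s sx]; have [|y sy] := @cauchy_seq _ K (fun k => lincomb w (s k)).
  move=> e /(tends_cauchy sx)[N sN]; exists N => i j Ni Nj.
  by rewrite -gram_dist sN.
by exists y, s.
Qed.

(** Equal Gram matrices give equal distances between corresponding linear
    combinations, so convergent sequences of combinations correspond. *)
Lemma gram_isometry : closed_span (range v) = setT ->
  exists2 U : H -> K, isometric U & forall a, U (v a) = w a.
Proof.
move=> vT; have ex x : exists y, gram_rel x y by apply: gram_rel_total; rewrite vT.
have [U UP] := choice ex.
have Ud x y : hdot (U x) (U y) = hdot x y by rewrite (gram_rel_dot (UP x) (UP y)).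
exists U; first split=> //.
  move=> a x y; apply/eqP; rewrite -subr_eq0; apply/eqP/nm_eq0/eqP.
  rewrite -sqrf_eq0 nm_sqr_Re !(dotBl, dotBr, dotDl, dotDr, dotZl, dotZr, Ud).
  set e := (X in complex.Re X); rewrite (_ : e = 0) // /e; ring.
move=> a; apply: gram_rel_uniq (UP _) _.
exists (fun=> [:: (1, a)]); split; apply: tends_eq (tends_cst _) => k;
  by rewrite /lincomb big_seq1 scale1r.
Qed.

Lemma gram_unitary : closed_span (range v) = setT -> closed_span (range w) = setT ->
  exists2 U : H -> K, unitary U & forall a, U (v a) = w a.
Proof.
move=> vT wT; have [U Ui Uv] := gram_isometry vT; exists U => //; split=> //.
rewrite -subTset => y _; have : closed_span (range w) y by rewrite wT.
move=> /seq_approx[s sy]; have [|x sx] := @cauchy_seq _ H (fun k => lincomb v (s k)).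
  move=> e /(tends_cauchy sy)[N sN]; exists N => i j Ni Nj.
  by rewrite gram_dist sN.
exists x => //; apply: (tends_unique (tends_op (bounded_isometric Ui) sx)).
apply: tends_eq sy => k; rewrite /lincomb lin_sum; last exact: Ui.1.
by apply: eq_bigr => p _; rewrite linZ ?Uv //; exact: Ui.1.
Qed.

End Gram.

(** * Square roots in C*-algebras and contractivity of representations *)

Section CstarBasics.
Context {R : realType} {H : hilbertType R}.
Variables (S : set (H -> H)) (SC : Cstar_subalgebra S).

Lemma Cstar_bounded A : S A -> bounded_op A.
Proof. by case: SC => + _ _ _ _ => /(_ A). Qed.
Lemma Cstar_id : S id. Proof. by case: SC. Qed.
Lemma Cstar_lin (a : R[i]) A B : S A -> S B -> S (a *: A + B).
Proof. by case: SC => _ _ + _ _; exact. Qed.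
Lemma Cstar_comp A B : S A -> S B -> S (A \o B).
Proof. by case: SC => _ _ _ + _; exact. Qed.
Lemma Cstar_adj A : S A -> S (adj A).
Proof. by case: SC => _ _ _ _ [+ _]; exact. Qed.
Lemma Cstar_lim (T : nat -> H -> H) B : (forall m, S (T m)) -> bounded_op B ->
  ncvg \oo T B -> S B.
Proof.
case: SC => _ _ _ _ [_ Slim] ST Bb TB; apply: (Slim T) => //.
by apply/norm_cvgP => //; apply: nearW => m; exact: Cstar_bounded.
Qed.
Lemma Cstar0 : S 0.
Proof. by have := Cstar_lin (-1) Cstar_id Cstar_id; rewrite scaleN1r addNr. Qed.
Lemma CstarZ a A : S A -> S (a *: A).
Proof. by move=> SA; rewrite -[_ *: _]addr0; apply: Cstar_lin => //; exact: Cstar0. Qed.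
Lemma CstarD A B : S A -> S B -> S (A + B).
Proof. by move=> SA SB; rewrite -[A]scale1r; exact: Cstar_lin. Qed.
Lemma CstarB A B : S A -> S B -> S (A - B).
Proof. by move=> SA SB; rewrite addrC -scaleN1r; exact: Cstar_lin. Qed.
Lemma Cstar_sum (I : Type) (r : seq I) (P : pred I) (F : I -> H -> H) :
  (forall i, P i -> S (F i)) -> S (\sum_(i <- r | P i) F i).
Proof. by move=> SF; elim/big_ind: _ => //; [exact: Cstar0 | exact: CstarD]. Qed.
Lemma Cstar_opword (n : nat) (Y : 'I_n -> H -> H) a : (forall i, S (Y i)) -> S (opword Y a).
Proof.
by move=> SY; elim: a => [|i a IHa]; [exact: Cstar_id | exact: Cstar_comp].
Qed.
Lemma Cstar_psum (n : nat) (Y : 'I_n -> H -> H) (psi : ncseries R n) m :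
  (forall i, S (Y i)) -> S (psum psi Y m).
Proof.
move=> SY; apply: Cstar_sum => k _; apply: Cstar_sum => a _.
exact/CstarZ/Cstar_opword.
Qed.

End CstarBasics.

Lemma Cstar_all (R : realType) (H : hilbertType R) :
  Cstar_subalgebra [set A : H -> H | bounded_op A].
Proof.
split=> //; first exact: bounded_id.
- by move=> a A B; exact: boundedP_lin.
- by move=> A B; exact: bounded_comp.
- by split=> [A|]; [exact: bounded_adj | ].
Qed.

Lemma Cstar_generated_subalgebra (R : realType) (H : hilbertType R) (I : Type)
    (M : I -> H -> H) : (forall i, bounded_op (M i)) ->
  Cstar_subalgebra (Cstar_generated M).
Proof.
move=> Mb; split.
- by move=> A; apply; split; [exact: Cstar_all | exact: Mb].
- by move=> S [SC _]; exact: Cstar_id.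
- by move=> a A B SA SB S SP; apply: (Cstar_lin SP.1); [exact: SA | exact: SB].
- by move=> A B SA SB S SP; apply: (Cstar_comp SP.1); [exact: SA | exact: SB].
split=> [A SA S SP|T B ST Bb TB S SP]; first by apply: (Cstar_adj SP.1); exact: SA.
apply: (Cstar_lim SP.1 (T := T)) => //; first by move=> m; exact: ST.
apply/norm_cvgP => //; apply: nearW => m; apply: (ST m); split; last exact: Mb.
exact: Cstar_all.
Qed.

Section SquareRoot.
Context {R : realType} {H : hilbertType R}.
Variables (S : set (H -> H)) (SC : Cstar_subalgebra S) (A : H -> H).
Hypotheses (SA : S A) (A_sym : forall x y, hdot (A x) y = hdot x (A y)).
Hypothesis A1 : opb 1 A.

Fixpoint root_iter k : H -> H :=
  if k is j.+1 then (2^-1)%:C *: (A + (root_iter j \o root_iter j)) else 0.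

Fixpoint root_bound k : R := if k is j.+1 then (1 + root_bound j ^+ 2) / 2 else 0.

Lemma root_bound_itv k : 0 <= root_bound k <= 1.
Proof.
elim: k => [|k /andP[y0 y1]] /=; first by rewrite lexx ler01.
by rewrite expr2; apply/andP; split; nra.
Qed.

Lemma root_iter_in k : S (root_iter k).
Proof.
elim: k => [|k IHk] /=; first exact: (Cstar0 SC).
by apply/(CstarZ SC)/(CstarD SC) => //; exact: (Cstar_comp SC).
Qed.

Lemma root_iter_bounded k : bounded_op (root_iter k).
Proof. exact: (Cstar_bounded SC (root_iter_in k)). Qed.

Lemma root_iter_opb k : opb (root_bound k) (root_iter k).
Proof.
elim: k => [|k IHk] /=; first by move=> x; rewrite nm0 mul0r.
have /andP[y0 y1] := root_bound_itv k.
have h2 : opb (root_bound k * root_bound k) (root_iter k \o root_iter k).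
  exact: (opb_comp y0 IHk IHk).
have h := opbZ (2^-1)%:C (opbD A1 h2); apply: (opb_le _ h).
by rewrite nm_real ger0_norm ?invr_ge0 // -expr2 mulrC.
Qed.

Lemma root_iter_sym k x y : hdot (root_iter k x) y = hdot x (root_iter k y).
Proof.
elim: k x y => [|k IHk] x y /=; first by rewrite dot0l dot0r.
by rewrite !fctE dotZl dotZr conj_real dotDl dotDr A_sym /= !IHk.
Qed.

Lemma root_iter_step k :
  opb (root_bound k.+1 - root_bound k) (root_iter k.+1 - root_iter k).
Proof.
elim: k => [|k IHk].
  move=> x; have -> : (root_iter 1 - root_iter 0) x = (2^-1)%:C *: (A x + 0) - 0 by [].
  rewrite /= addr0 !subr0 expr0n addr0 nmZ nm_real ger0_norm ?invr_ge0 // mul1r.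
  by rewrite ler_wpM2l ?invr_ge0 // -[nm x]mul1r.
have /andP[y0 y1] := root_bound_itv k; have /andP[z0 z1] := root_bound_itv k.+1.
set Y := root_iter k; set Z := root_iter k.+1 in IHk *.
set y := root_bound k in IHk y0 y1 *; set z := root_bound k.+1 in IHk z0 z1 *.
have Zl : linear Z := bounded_linear (root_iter_bounded k.+1).
have E x : (root_iter k.+2 - root_iter k.+1) x =
    (2^-1)%:C *: (Z ((Z - Y) x) + (Z - Y) (Y x)).
  have -> : (root_iter k.+2 - root_iter k.+1) x =
      (2^-1)%:C *: (A x + Z (Z x)) - (2^-1)%:C *: (A x + Y (Y x)) by [].
  rewrite -scalerBr; congr (_ *: _).
  have -> : Z ((Z - Y) x) = Z (Z x) - Z (Y x) by rewrite -(linB Zl).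
  have -> : (Z - Y) (Y x) = Z (Y x) - Y (Y x) by [].
  by rewrite opprD addrACA subrr add0r addrA subrK.
move=> x; rewrite E nmZ nm_real ger0_norm ?invr_ge0 //.
have -> : root_bound k.+2 - root_bound k.+1 = 2^-1 * ((z + y) * (z - y)).
  have -> : root_bound k.+2 = (1 + z ^+ 2) / 2 by [].
  have -> : root_bound k.+1 = (1 + y ^+ 2) / 2 by [].
  by move: z y {z0 z1 y0 y1 IHk} => z y; field.
rewrite -mulrA ler_wpM2l ?invr_ge0 //; apply: le_trans (nm_triangle _ _) _.
have zy : 0 <= z - y.
  have [x0|x0] := eqVneq (nm x) 0; last first.
    exact: opb_ge0 IHk x0.
  rewrite /z /=  -/y; have := sqr_ge0 (1 - y); lra.
rewrite mulrDl mulrDl; apply: lerD.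
  apply: le_trans (root_iter_opb k.+1 _) _; rewrite -mulrA ler_wpM2l //; exact: IHk.
apply: le_trans (IHk _) _; rewrite [y * _]mulrC -mulrA ler_wpM2l //.
exact: root_iter_opb.
Qed.

(** The iteration Y' = (A + Y^2) / 2 is dominated by its scalar instance
    y' = (1 + y^2) / 2, which is increasing and bounded by 1; hence it converges in
    norm, and the limit satisfies (1 - Y)^2 = 1 - A. *)
Lemma sqrt_defect : exists D : H -> H,
  [/\ S D, forall x y, hdot (D x) y = hdot x (D y) & forall x, D (D x) = x - A x].
Proof.
have incr k : root_bound k <= root_bound k.+1.
  by rewrite /=; have := sqr_ge0 (1 - root_bound k); lra.
have [k|l bl lim] := monotone_bounded_tends incr (M := 1).
  by have /andP[] := root_bound_itv k.
have step i d : opb (root_bound (i + d) - root_bound i)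
    (root_iter (i + d) - root_iter i).
  elim: d => [|d IHd]; first by rewrite addn0 !subrr => x; rewrite nm0 mul0r.
  have := opbD (root_iter_step (i + d)) IHd.
  by rewrite addrA subrK addrA subrK addnS.
have [|Y Yb YY] := @op_complete _ _ _ root_iter root_iter_bounded.
  move=> e e0; have [N Ne] := lim _ e0; exists N.
  have le i j : (N <= i)%N -> (i <= j)%N -> opb e (root_iter j - root_iter i).
    move=> Ni ij; have := step i (j - i)%N; rewrite subnKC //; apply: opb_le.
    by have := Ne _ Ni; have := bl j; lra.
  move=> i j Ni Nj; have [ij|/ltnW ji] := leqP i j; last exact: le.
  by rewrite -opprB; apply: opbN; exact: le.
have Ysym x y : hdot (Y x) y = hdot x (Y y).
  apply: (tends_unique (tends_dotl y (ncvg_tends x YY))).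
  by apply: tends_eq (tends_dotr x (ncvg_tends y YY)) => k; rewrite root_iter_sym.
have SY : S Y := Cstar_lim SC root_iter_in Yb YY.
have fix_eq x : Y x = (2^-1)%:C *: (A x + Y (Y x)).
  have h1 : tends \oo (fun k => root_iter k.+1 x) (Y x).
    move=> e /(ncvg_tends x YY)[N _ h]; exists N => // k /= Nk.
    exact: (h k.+1 (leqW Nk)).
  apply: (tends_unique h1); apply: tendsZ; apply: tendsD; first exact: tends_cst.
  have hc : ncvg \oo (fun k => root_iter k \o root_iter k) (Y \o Y).
    apply: ncvg_comp => //.
    by apply: nearW => k; exact: bounded_linear (root_iter_bounded k).
  exact: (ncvg_tends x hc).
exists (id - Y); split; first by apply: (CstarB SC) => //; exact: (Cstar_id SC).
  by move=> x y; rewrite !fctE dotBl dotBr Ysym.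
move=> x; have Yl := bounded_linear Yb.
have -> : (id - Y) ((id - Y) x) = (x - Y x) - Y (x - Y x) by [].
rewrite (linB Yl).
have -> : A x = 2%:C *: Y x - Y (Y x).
  rewrite {1}fix_eq scalerA -rmorphM /= divff ?scale1r ?addrK //.
have -> : (2%:C : R[i]) = 1 + 1.
  by apply/eqP; rewrite eq_complex /= addr0 !eqxx.
rewrite scalerDl scale1r !opprB -addrA; congr (_ + _).
by rewrite addrCA opprD.
Qed.

End SquareRoot.

Section StarRep.
Context {R : realType} {H K : hilbertType R}.
Variables (S : set (H -> H)) (SC : Cstar_subalgebra S).
Variables (pi : (H -> H) -> (K -> K)) (pi_rep : unital_star_rep S pi).

Lemma rep_bounded A : S A -> bounded_op (pi A).
Proof. by case: pi_rep => + _ _ _ _; exact. Qed.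
Lemma rep_id : pi id = id. Proof. by case: pi_rep. Qed.
Lemma rep_lin (c : R[i]) A B : S A -> S B -> pi (c *: A + B) = c *: pi A + pi B.
Proof. by case: pi_rep => _ _ + _ _; exact. Qed.
Lemma rep_comp A B : S A -> S B -> pi (A \o B) = pi A \o pi B.
Proof. by case: pi_rep => _ _ _ + _; exact. Qed.
Lemma rep_adj A : S A -> pi (adj A) = adj (pi A).
Proof. by case: pi_rep => _ _ _ _; exact. Qed.

Lemma rep0 : pi 0 = 0.
Proof.
have := rep_lin (-1) (Cstar_id SC) (Cstar_id SC).
by rewrite !scaleN1r !addNr.
Qed.
Lemma repZ (c : R[i]) A : S A -> pi (c *: A) = c *: pi A.
Proof.
move=> SA; have := rep_lin c SA (Cstar0 SC); by rewrite rep0 !addr0.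
Qed.
Lemma repD A B : S A -> S B -> pi (A + B) = pi A + pi B.
Proof. by move=> SA SB; have := rep_lin 1 SA SB; rewrite !scale1r. Qed.
Lemma repB A B : S A -> S B -> pi (A - B) = pi A - pi B.
Proof.
by move=> SA SB; rewrite addrC -scaleN1r rep_lin // scaleN1r addrC.
Qed.
Lemma rep_sum (I : Type) (r : seq I) (P : pred I) (F : I -> H -> H) :
  (forall i, P i -> S (F i)) ->
  pi (\sum_(i <- r | P i) F i) = \sum_(i <- r | P i) pi (F i).
Proof.
move=> SF; elim: r => [|i r IHr]; first by rewrite !big_nil rep0.
rewrite !big_cons; case: ifP => // Pi.
by rewrite repD ?IHr //; [exact: SF | exact: (Cstar_sum SC)].
Qed.

Lemma rep_opword (n : nat) (Y : 'I_n -> H -> H) a : (forall i, S (Y i)) ->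
  pi (opword Y a) = opword (fun i => pi (Y i)) a.
Proof.
move=> SY; elim: a => [|i a IHa] /=; first exact: rep_id.
by rewrite rep_comp ?IHa //; exact: (Cstar_opword SC).
Qed.

Lemma rep_psum (n : nat) (Y : 'I_n -> H -> H) (psi : ncseries R n) m :
  (forall i, S (Y i)) -> pi (psum psi Y m) = psum psi (fun i => pi (Y i)) m.
Proof.
move=> SY; have Sa c a : S (c *: opword Y a) by apply: (CstarZ SC); exact: (Cstar_opword SC).
rewrite /psum rep_sum => [|k _]; last by apply: (Cstar_sum SC).
apply: eq_bigr => k _; rewrite rep_sum => [|a _]; last exact: Sa.
by apply: eq_bigr => a _; rewrite repZ ?rep_opword //; exact: Cstar_opword.
Qed.

(** If |B| <= 1 then 1 - B^* B = D^2 with D in the algebra, so that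
    |k|^2 - |pi(B) k|^2 = |pi(D) k|^2. *)
Lemma rep_contract1 B : S B -> opb 1 B -> opb 1 (pi B).
Proof.
move=> SB B1; have Bb := Cstar_bounded SC SB.
have SBB : S (adj B \o B) by apply: (Cstar_comp SC) => //; exact: (Cstar_adj SC).
have [||D [SD Dsym DD]] := @sqrt_defect R H S SC (adj B \o B) SBB.
- by move=> x y; rewrite /= adjPl // adjP.
- have := opb_comp ler01 (opb_adj Bb ler01 B1) B1; by rewrite mulr1.
have Db := Cstar_bounded SC SD.
have piD : pi D \o pi D = id - (adj (pi B) \o pi B).
  rewrite -rep_comp // (_ : D \o D = id - (adj B \o B)); last first.
    by apply/funext => x; exact: DD.
  rewrite repB ?rep_id //; last exact: (Cstar_id SC).
  by rewrite rep_comp ?rep_adj //; exact: (Cstar_adj SC).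
have piDs x y : hdot (pi D x) y = hdot x (pi D y).
  by rewrite (adjP (rep_bounded SD)) -(rep_adj SD) (adj_eq Dsym).
move=> k; rewrite mul1r; apply: le_of_sqr; rewrite ?nm_ge0 // -subr_ge0.
have -> : nm k ^+ 2 - nm (pi B k) ^+ 2 = nm (pi D k) ^+ 2; last exact: sqr_ge0.
have e : pi D (pi D k) = k - adj (pi B) (pi B k).
  by rewrite -[LHS]/((pi D \o pi D) k) piD.
rewrite [RHS]nm_sqr_Re piDs e dotBr cReD cReN -!nm_sqr_Re.
by rewrite -(adjP (rep_bounded SB)) -nm_sqr_Re.
Qed.

Lemma rep_contract B M : S B -> 0 <= M -> opb M B -> opb M (pi B).
Proof.
move=> SB M0 BM x; apply/ler_addgt0Pr => e e0.
have xp : 0 < nm x + 1 by rewrite ltr_wpDl ?nm_ge0.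
pose m := M + e / (nm x + 1); have mp : 0 < m by rewrite ltr_wpDl ?divr_gt0.
have : opb 1 (pi (m^-1%:C *: B)).
  apply: rep_contract1; first exact: (CstarZ SC).
  apply: opb_le (opbZ _ (opb_le (_ : M <= m) BM)).
    by rewrite nm_real ger0_norm ?invr_ge0 ?mulVf ?gt_eqF // ltW.
  by rewrite lerDl ltW // divr_gt0.
move=> /(_ x); rewrite repZ // mul1r.
rewrite (_ : (m^-1%:C *: pi B) x = m^-1%:C *: pi B x) // nmZ nm_real ger0_norm ?invr_ge0 ?(ltW mp) //.
rewrite ler_pdivrMl // => /le_trans; apply; rewrite /m mulrDl lerD2l.
by rewrite mulrAC ler_pdivrMr // ler_wpM2l ?lerDl // ltW.
Qed.

Lemma rep_ncvg (I : Type) (F : set_system I) {FF : Filter F} (T : I -> H -> H) A :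
  (\forall t \near F, S (T t)) -> S A -> ncvg F T A ->
  ncvg F (fun t => pi (T t)) (pi A).
Proof.
move=> ST SA TA e e0; apply: filterS2 ST (TA _ e0) => t St te.
by rewrite -repB //; apply: rep_contract (ltW e0) te; exact: (CstarB SC).
Qed.

End StarRep.

(** * Sums over words and evaluation of series *)

Section WordSums.
Context {n : nat} {V : nmodType}.
Implicit Types F : word n -> V.

Definition wsum (k : nat) F : V := \sum_(a : k.-tuple 'I_n) F a.

Lemma wsum0 F : wsum 0 F = F [::].
Proof.
rewrite /wsum (big_pred1 [tuple]) // => a; apply/esym/eqP; exact: tuple0.
Qed.

Lemma wsumS k F : wsum k.+1 F = \sum_i wsum k (fun a => F (i :: a)).
Proof.
rewrite /wsum pair_big /=.
rewrite (reindex (fun p : 'I_n * k.-tuple 'I_n => [tuple of p.1 :: p.2])) /=.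
  by apply: eq_bigr.
exists (fun a : k.+1.-tuple 'I_n => (thead a, [tuple of behead a])) => [[i a] _|a _] /=.
  by congr (_, _); apply: val_inj.
by rewrite [RHS]tuple_eta; apply: val_inj.
Qed.

Lemma wsumSr k F : wsum k.+1 F = wsum k (fun a => \sum_i F (rcons a i)).
Proof.
elim: k F => [|k IHk] F.
  rewrite wsumS wsum0; apply: eq_bigr => i _; exact: wsum0.
by rewrite wsumS [RHS]wsumS; apply: eq_bigr => i _; rewrite IHk.
Qed.

Lemma eq_wsum k F G : (forall a, size a = k -> F a = G a) -> wsum k F = wsum k G.
Proof. by move=> FG; apply: eq_bigr => a _; rewrite FG ?size_tuple. Qed.

Lemma wsumD k F G : wsum k (fun a => F a + G a) = wsum k F + wsum k G.
Proof. exact: big_split. Qed.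

Lemma wsum_eq0 k F : (forall a, size a = k -> F a = 0) -> wsum k F = 0.
Proof. by move=> F0; rewrite /wsum big1 // => a _; rewrite F0 ?size_tuple. Qed.

Lemma wsum_exchange (I : Type) (r : seq I) (P : pred I) k (F : I -> word n -> V) :
  wsum k (fun a => \sum_(i <- r | P i) F i a) = \sum_(i <- r | P i) wsum k (F i).
Proof. exact: exchange_big. Qed.

Lemma wsum_wsum k l (F : word n -> word n -> V) :
  wsum k (fun a => wsum l (F a)) = wsum l (fun b => wsum k (F^~ b)).
Proof. exact: exchange_big. Qed.

Lemma wsum_pred1 k (a : word n) F : size a = k ->
  (forall b, size b = k -> b <> a -> F b = 0) -> wsum k F = F a.
Proof.
move=> ak F0; rewrite /wsum (bigD1 (tcast ak (in_tuple a))) //= val_tcast.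
rewrite big1 ?addr0 // => b ba; apply: F0; first by rewrite size_tuple.
move=> e; move/eqP: ba; apply; apply: val_inj; rewrite /= val_tcast; exact: e.
Qed.

End WordSums.

Lemma wsum_mulr {n : nat} {S : pzSemiRingType} k (F : word n -> S) (c : S) :
  wsum k (fun a => c * F a) = c * wsum k F.
Proof. by rewrite /wsum mulr_sumr. Qed.

Lemma wsum_mull {n : nat} {S : pzSemiRingType} k (F : word n -> S) (c : S) :
  wsum k (fun a => F a * c) = wsum k F * c.
Proof. by rewrite /wsum mulr_suml. Qed.

Lemma wsum_ler {n : nat} {R : realType} k (F G : word n -> R) :
  (forall a, size a = k -> F a <= G a) -> wsum k F <= wsum k G.
Proof. by move=> FG; apply: ler_sum => a _; rewrite FG ?size_tuple. Qed.

Lemma wsum_ge0 {n : nat} {R : realType} k (F : word n -> R) :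
  (forall a, 0 <= F a) -> 0 <= wsum k F.
Proof. by move=> F0; apply: sumr_ge0. Qed.

Section OpWords.
Context {R : realType} {n : nat} {H : hilbertType R}.
Variables (Y : 'I_n -> H -> H) (Yb : forall i, bounded_op (Y i)).
Implicit Types psi : ncseries R n.

Lemma opword_cat (X : 'I_n -> H -> H) a b x :
  opword X (a ++ b) x = opword X a (opword X b x).
Proof. by elim: a => //= i a ->. Qed.

Lemma bounded_opword a : bounded_op (opword Y a).
Proof. by elim: a => [|i a IHa]; [exact: bounded_id | exact: bounded_comp]. Qed.

Lemma bounded_psum psi m : bounded_op (psum psi Y m).
Proof.
apply: bounded_sum => k _; apply: bounded_sum => a _.
exact/boundedZ/bounded_opword.
Qed.

Lemma bounded_opscale r i : bounded_op (opscale r Y i).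
Proof. exact: boundedZ. Qed.

Definition hpart psi (X : 'I_n -> H -> H) (k : nat) (x : H) : H :=
  wsum k (fun a => psi a *: opword X a x).

Lemma psumE psi (X : 'I_n -> H -> H) m x : psum psi X m x = \sum_(k < m) hpart psi X k x.
Proof.
rewrite /psum fct_sumE; apply: eq_bigr => k _.
by rewrite fct_sumE.
Qed.

Lemma opword_scale r a x : opword (opscale r Y) a x = (r ^+ size a)%:C *: opword Y a x.
Proof.
elim: a => [|i a IHa] /=; first by rewrite expr0 scale1r.
transitivity (r%:C *: Y i ((r ^+ size a)%:C *: opword Y a x)); first by rewrite -IHa.
by rewrite (linZ (bounded_linear (Yb i))) scalerA -rmorphM exprS.
Qed.

Lemma hpart_scale psi r k x :
  hpart psi (opscale r Y) k x = (r ^+ k)%:C *: hpart psi Y k x.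
Proof.
rewrite /hpart /wsum scaler_sumr; apply: eq_bigr => a _.
by rewrite opword_scale size_tuple !scalerA mulrC.
Qed.

End OpWords.

Lemma near_left1 (R : realType) (d : R) : d < 1 ->
  \forall r \near (1 : R)^'-, d < r < 1.
Proof.
move=> d1; apply: filterS2 (nbhs_left_gt d1) (nbhs_left_lt (1 : R)).
by move=> r -> ->.
Qed.

Section Abel.
Context {R : realType} {V : normedModType R[i]}.

Lemma abel_parts (x d : nat -> V) (s : V) (r : R) m :
  (forall k, d k = \sum_(j < k) x j - s) ->
  \sum_(k < m.+1) (r ^+ k)%:C *: x k - s =
  \sum_(j < m) ((1 - r) * r ^+ j)%:C *: d j.+1 + (r ^+ m)%:C *: d m.+1.
Proof.
move=> dE; elim: m => [|m IHm].
  by rewrite dE big_ord0 add0r !big_ord1 expr0 !scale1r.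
rewrite big_ord_recr /= addrAC IHm [in RHS]big_ord_recr /= -!addrA; congr (_ + _).
have -> : d m.+2 = d m.+1 + x m.+1.
  by rewrite !dE [in LHS]big_ord_recr /= addrAC.
move: (d m.+1) (x m.+1) => u v.
rewrite scalerDr addrA; congr (_ + _); rewrite -scalerDl -rmorphD exprS; congr (_%:C *: _).
ring.
Qed.

(** Abel's theorem: after summation by parts the partial sums within e of s carry
    total weight at most 1, and the finitely many others weight at most 1 - r
    each. *)
Lemma abel_bound (x : nat -> V) (s : V) : tends \oo (fun m => \sum_(k < m) x k) s ->
  forall e : R, 0 < e -> exists C : R, forall r, 0 <= r < 1 -> forall B,
    tends \oo (fun m => \sum_(k < m) (r ^+ k)%:C *: x k) B ->
    nm (B - s) <= (1 - r) * C + e.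
Proof.
move=> xs e e0; have [N _ Ne] := xs _ e0.
pose d k := \sum_(j < k) x j - s.
exists (\sum_(j < N) nm (d j.+1)) => r /andP[r0 r1] B rB.
have lim : tends \oo (fun m => \sum_(k < m) (r ^+ k)%:C *: x k - s) (B - s).
  by apply: tendsB => //; exact: tends_cst.
apply: (nm_tends_le lim); exists N.+1 => // -[|m] //= Nm.
rewrite (@abel_parts x d) //; apply: le_trans (nm_triangle _ _) _.
have geo k : \sum_(j < k) (1 - r) * r ^+ j + r ^+ k = 1.
  elim: k => [|k IHk]; first by rewrite big_ord0 add0r expr0.
  by rewrite big_ord_recr /= -[RHS]IHk exprS; ring.
have c0 j : 0 <= (1 - r) * r ^+ j by rewrite mulr_ge0 ?subr_ge0 ?exprn_ge0 // ltW.
have cN j : nm (((1 - r) * r ^+ j)%:C *: d j.+1) = (1 - r) * r ^+ j * nm (d j.+1).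
  by rewrite nmZ nm_real ger0_norm.
have small j : (N <= j.+1)%N -> nm (d j.+1) <= e by move=> Nj; exact/ltW/Ne.
rewrite -[X in _ <= _ + X]mulr1 -[X in _ <= _ + _ * X](geo m) mulrDr addrA.
apply: lerD; last first.
  rewrite nmZ nm_real ger0_norm ?exprn_ge0 // mulrC.
  by apply: ler_wpM2r; [exact: exprn_ge0 | apply: small; exact: leqW].
apply: le_trans (nm_sum _ _ _) _.
rewrite -(subnKC (Nm : (N <= m)%N)) !big_split_ord /= !mulr_sumr.
apply: (@le_trans _ _ (\sum_(i < N) (1 - r) * nm (d i.+1) + 
   \sum_(i < m - N) e * ((1 - r) * r ^+ (N + i)))).
  apply: lerD; apply: ler_sum => i _; rewrite cN.
    rewrite -mulrA; apply: ler_wpM2l; first by rewrite subr_ge0 ltW.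
    apply: ler_piMl; first exact: nm_ge0.
    by apply: exprn_ile1 => //; exact: ltW.
  rewrite mulrC; apply: ler_wpM2r => //; apply: small.
  by rewrite -addnS leq_addr.
rewrite mulrDr !mulr_sumr lerD2l lerDr sumr_ge0 // => i _.
by apply: mulr_ge0 => //; exact: ltW.
Qed.

End Abel.

Section Evaluations.
Context {R : realType} {n : nat} {H : hilbertType R}.
Variables (Y : 'I_n -> H -> H) (Yb : forall i, bounded_op (Y i)).
Implicit Types (psi : ncseries R n) (A : H -> H).

Lemma sum_normP psi A : sum_norm psi Y A <-> bounded_op A /\ ncvg \oo (psum psi Y) A.
Proof.
split=> -[Ab YA]; split=> //; apply/norm_cvgP => //; apply: nearW => m;
  exact: bounded_psum.
Qed.

Lemma sum_sotP psi A : sum_sot psi Y A <->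
  bounded_op A /\ forall x, tends \oo (fun m => psum psi Y m x) (A x).
Proof. by split=> -[Ab YA]; split=> //; apply/sot_cvgP. Qed.

Lemma norm_sot psi A : sum_norm psi Y A -> sum_sot psi Y A.
Proof.
by move=> /sum_normP[Ab YA]; apply/sum_sotP; split=> // x; exact: ncvg_tends.
Qed.

End Evaluations.

Section EvaluationsUnique.
Context {R : realType} {n : nat} {H : hilbertType R}.
Variables (Y : 'I_n -> H -> H) (Yb : forall i, bounded_op (Y i)).
Implicit Types (psi : ncseries R n) (A : H -> H).

Lemma sot_rad_eq psi A B : sum_sot psi Y A -> sum_rad psi Y B -> A = B.
Proof.
move=> /sum_sotP[Ab YA] [Bb [d [C [/andP[d0 d1] YC CB]]]].
apply/funext => x; apply/eqP; rewrite -subr_eq0; apply/eqP/nm_eq0/eqP.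
rewrite eq_le nm_ge0 andbT; apply/ler_addgt0Pr => e e0; rewrite add0r.
have hs : tends \oo (fun m => \sum_(k < m) hpart psi Y k x) (A x).
  by apply: tends_eq (YA x) => m; rewrite psumE.
have e3 : 0 < e / 3 by rewrite divr_gt0.
have [K Kr] := abel_bound (x := fun k => hpart psi Y k x) hs e3.
have CBx : tends (1 : R)^'- (fun r => C r x) (B x) by move/sot_cvgP: CB; exact.
pose q := Num.max d (1 - e / 3 / (`|K| + 1)).
have Kp : 0 < `|K| + 1 by rewrite ltr_wpDl.
have q1 : q < 1 by rewrite gt_max d1 /= gtrBl divr_gt0.
have [r [/andP[qr r1] rB]] := near_ex2 (near_left1 q1) (CBx _ e3).
move: qr; rewrite gt_max => /andP[dr qr].
have r01 : 0 <= r < 1 by rewrite r1 andbT ltW // (lt_trans d0).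
have hC : tends \oo (fun m => \sum_(k < m) (r ^+ k)%:C *: hpart psi Y k x) (C r x).
  have := YC r; rewrite dr r1 => /(_ isT).
  move/(sum_normP (bounded_opscale Yb r)) => [_ h].
  apply: tends_eq (ncvg_tends x h) => m; rewrite psumE.
  by apply: eq_bigr => k _; rewrite hpart_scale.
have h1 := Kr _ r01 _ hC.
have h2 : (1 - r) * K <= e / 3.
  apply: (@le_trans _ _ ((1 - r) * (`|K| + 1))).
    rewrite ler_wpM2l ?subr_ge0 ?ltW //.
    by rewrite (le_lt_trans (ler_norm K)) // ltrDl.
  by rewrite -ler_pdivlMr // lerBlDr addrC -lerBlDr ltW.
have := nm_dist_triangle (A x) (C r x) (B x).
rewrite [nm (A x - C r x)]nmBC; lra.
Qed.

(** Beyond the uniqueness of limits this needs the agreement of direct and radial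
    summation, which is Abel's theorem. *)
Lemma evals_unique (f : 'I_n -> ncseries R n) F G :
  evals f Y F -> evals f Y G -> F = G.
Proof.
move=> [YF|YF] [YG|YG]; apply/funext => i.
- move/sum_sotP: (YF i) => [_ hF]; move/sum_sotP: (YG i) => [_ hG].
  by apply/funext => x; exact: tends_unique (hF x) (hG x).
- exact: sot_rad_eq (YF i) (YG i).
- exact/esym/(sot_rad_eq (YG i) (YF i)).
have [_ [d [C [/andP[d0 d1] YC CF]]]] := YF i.
have [_ [d' [C' [/andP[d'0 d'1] YC' CG]]]] := YG i.
apply/funext => x.
have h1 : tends (1 : R)^'- (fun r => C r x) (F i x) by move/sot_cvgP: CF; exact.
have h2 : tends (1 : R)^'- (fun r => C' r x) (G i x) by move/sot_cvgP: CG; exact.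
apply: (tends_unique h1); apply: tends_near h2.
have m1 : Num.max d d' < 1 by rewrite gt_max d1.
apply: filterS (near_left1 m1) => r; rewrite gt_max => /andP[/andP[dr d'r] r1].
have := YC r; rewrite dr r1 => /(_ isT).
move/(sum_normP (bounded_opscale Yb r)) => [_ a1].
have := YC' r; rewrite d'r r1 => /(_ isT).
move/(sum_normP (bounded_opscale Yb r)) => [_ a2].
by rewrite (ncvg_unique a1 a2).
Qed.

(** Limits in norm, because representations of C*-algebras preserve these and not
    strong limits. *)
Definition norm_evals (f : 'I_n -> ncseries R n) (F : 'I_n -> H -> H) : Prop :=
  (forall i, bounded_op (F i)) /\
  ((forall i, ncvg \oo (psum (f i) Y) (F i)) \/
   (forall i, exists d : R, exists B : R -> H -> H,
      [/\ 0 < d < 1,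
          forall r, d < r < 1 -> bounded_op (B r) /\
            ncvg \oo (psum (f i) (opscale r Y)) (B r) &
          ncvg (1 : R)^'- B (F i)])).

Lemma norm_evals_evals f F : norm_evals f F -> evals f Y F.
Proof.
move=> [Fb [YF|YF]]; [left=> i|right=> i].
  by apply/sum_sotP; split=> // x; exact: ncvg_tends.
split=> //; have [d [B [d01 YB BF]]] := YF i; exists d, B; split=> //.
  by move=> r /YB[Bb h]; apply/(sum_normP (bounded_opscale Yb r)).
by apply/sot_cvgP => x; exact: ncvg_tends.
Qed.

End EvaluationsUnique.

(** * Formal composition and the uniqueness of the inverse series *)

Section Tannery.
Context {R : realType}.

Lemma geometric_sum_le (rho : R) k : 0 <= rho < 1 ->
  \sum_(j < k) rho ^+ j <= (1 - rho)^-1.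
Proof.
move=> /andP[r0 r1]; have rp : 0 < 1 - rho by rewrite subr_gt0.
have E : (1 - rho) * \sum_(j < k) rho ^+ j = 1 - rho ^+ k.
  elim: k => [|k IHk]; first by rewrite big_ord0 mulr0 expr0 subrr.
  by rewrite big_ord_recr /= mulrDr IHk exprS; ring.
by rewrite -(ler_pM2l rp) E divff ?gt_eqF // gerBl exprn_ge0.
Qed.

Lemma geometric_tail (C rho : R) : 0 <= C -> 0 <= rho < 1 -> forall e : R, 0 < e ->
  exists N, forall k, \sum_(j < k) C * rho ^+ (N + j) <= e.
Proof.
move=> C0 r01 e e0; have /andP[r0 r1] := r01.
have rp : 0 < 1 - rho by rewrite subr_gt0.
have Cp : 0 < C + 1 by rewrite ltr_wpDl.
have [N _ Ne] : \forall N \near \oo, `|rho ^+ N| < e * (1 - rho) / (C + 1).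
  have : (fun N => rho ^+ N) @ \oo --> (0 : R) by apply: cvg_expr; rewrite ger0_norm.
  by move=> /cvgr0Pnorm_lt; apply; rewrite divr_gt0 ?mulr_gt0.
exists N => k; have := Ne N (leqnn N); rewrite /= ger0_norm ?exprn_ge0 //.
rewrite ltr_pdivlMr // => small.
under eq_bigr do rewrite exprD mulrA.
rewrite -mulr_sumr.
apply: (@le_trans _ _ (C * rho ^+ N * (1 - rho)^-1)).
  by apply: ler_wpM2l; [rewrite mulr_ge0 ?exprn_ge0 | exact: geometric_sum_le].
rewrite ler_pdivrMr //; apply: le_trans (ltW small).
by rewrite mulrC ler_wpM2l ?exprn_ge0 // lerDl.
Qed.

(** Tannery's theorem: domination makes the tails uniformly small, and each of the
    finitely many remaining terms is eventually small. *)
Lemma tannery (I : Type) (F : set_system I) {FF : Filter F} (x : I -> nat -> R)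
    (C rho : R) : 0 <= C -> 0 <= rho < 1 ->
  (\forall t \near F, forall k, x t k <= C * rho ^+ k) ->
  (forall k e, 0 < e -> \forall t \near F, x t k < e) ->
  forall e, 0 < e -> \forall t \near F, forall N, \sum_(k < N) x t k <= e.
Proof.
move=> C0 r01 dom lim e e0; have e2 : 0 < e / 2 by rewrite divr_gt0.
have [M tail] := geometric_tail C0 r01 e2.
have d0 : 0 < e / 2 / M.+1%:R by rewrite divr_gt0.
have fin : \forall t \near F, forall k, (k < M)%N -> x t k < e / 2 / M.+1%:R.
  elim: {tail} M (e / 2 / M.+1%:R) d0 => [|M IHM] d d0; first exact: nearW.
  apply: filterS2 (IHM d d0) (lim M d d0) => t h1 h2 k.
  by rewrite ltnS leq_eqVlt => /predU1P[->|/h1].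
apply: filterS2 dom fin => t dom fin N.
pose b k := if (k < M)%N then e / 2 / M.+1%:R else C * rho ^+ k.
have b0 k : 0 <= b k.
  rewrite /b; case: ifP => _; first exact: ltW.
  by rewrite mulr_ge0 // exprn_ge0 //; case/andP: r01.
apply: (@le_trans _ _ (\sum_(k < N) b k)).
  by apply: ler_sum => k _; rewrite /b; case: ifP => [/fin/ltW|].
apply: (@le_trans _ _ (\sum_(k < M + N) b k)).
  by rewrite addnC big_split_ord /= lerDl sumr_ge0.
rewrite big_split_ord /= [e in _ <= e]splitr; apply: lerD.
  rewrite (eq_bigr (fun=> e / 2 / M.+1%:R)) => [|k _]; last by rewrite /b ltn_ord.
  rewrite sumr_const card_ord -[_ *+ M]mulr_natr mulrAC ler_pdivrMr //.
  by rewrite ler_wpM2l ?ltW // ltr_nat.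
apply: le_trans (tail N); apply: ler_sum => j _.
by rewrite /b /= ltnNge leq_addr.
Qed.

End Tannery.

Section SeriesAlgebra.
Context {R : realType} {n : nat}.
Implicit Types (psi phi c : ncseries R n) (f g : 'I_n -> ncseries R n) (a b : word n).

Lemma pmul_nil psi phi : pmul psi phi [::] = psi [::] * phi [::].
Proof. by rewrite /pmul big_ord1. Qed.

Lemma pmul_cons psi phi i b : pmul psi phi (i :: b) =
  psi [::] * phi (i :: b) + pmul (fun a => psi (i :: a)) phi b.
Proof. by rewrite /pmul big_ord_recl /=; congr (_ + _). Qed.

Lemma pmulDl psi psi' phi b :
  pmul (fun a => psi a + psi' a) phi b = pmul psi phi b + pmul psi' phi b.
Proof. by rewrite /pmul -big_split; apply: eq_bigr => k _; rewrite mulrDl. Qed.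

Lemma pmulZl (x : R[i]) psi phi b : pmul (fun a => x * psi a) phi b = x * pmul psi phi b.
Proof. by rewrite /pmul mulr_sumr; apply: eq_bigr => k _; rewrite mulrA. Qed.

Lemma pmulA psi phi c b : pmul (pmul psi phi) c b = pmul psi (pmul phi c) b.
Proof.
elim: b psi => [|i b IHb] psi; first by rewrite !pmul_nil mulrA.
rewrite !pmul_cons -IHb pmul_nil.
have -> : (fun a => pmul psi phi (i :: a)) =
    (fun a => psi [::] * phi (i :: a) + pmul (fun d => psi (i :: d)) phi a).
  by apply/funext => a; rewrite pmul_cons.
by rewrite pmulDl pmulZl addrA -mulrA -mulrDr.
Qed.

Lemma pmul1 psi b : pmul pone psi b = psi b.
Proof.
case: b => [|i b]; first by rewrite pmul_nil /pone eqxx mul1r.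
rewrite pmul_cons /pone eqxx mul1r [X in _ + X](_ : _ = 0) ?addr0 //.
by rewrite /pmul big1 // => k _; rewrite mul0r.
Qed.

Lemma eq_pmulr psi phi phi' b : (forall k, (k <= size b)%N -> phi (drop k b) = phi' (drop k b)) ->
  pmul psi phi b = pmul psi phi' b.
Proof. by move=> E; apply: eq_bigr => k _; rewrite E // -ltnS. Qed.

Lemma pword_cat f a b : pword f (a ++ b) = pmul (pword f a) (pword f b).
Proof.
elim: a => [|i a IHa] /=; first by apply/funext => d; rewrite pmul1.
by apply/funext => d; rewrite IHa pmulA.
Qed.

Lemma pmul_pvar i psi b :
  pmul (pvar i) psi b = if b is j :: b' then (j == i)%:R * psi b' else 0.
Proof.
case: b => [|j b]; first by rewrite pmul_nil /pvar mul0r.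
rewrite pmul_cons /pvar mul0r add0r.
case: b => [|k b]; first by rewrite pmul_nil eqseq_cons andbT.
rewrite pmul_cons eqseq_cons andbT [X in _ + X](_ : _ = 0) ?addr0 //.
by rewrite /pmul big1 // => l _; rewrite !eqseq_cons andbF mul0r.
Qed.

Lemma pword_pvar a b : pword (@pvar R n) a b = (b == a)%:R.
Proof.
elim: a b => [|i a IHa] [|j b] //=; first by rewrite pmul_pvar.
by rewrite pmul_pvar IHa eqseq_cons -mulnb natrM.
Qed.

Lemma pcompE m c f b : pcomp_upto m c f b =
  \sum_(k < m) wsum k (fun a => c a * pword f a b).
Proof. by []. Qed.

Lemma pcompD m c c' f b : pcomp_upto m (fun a => c a + c' a) f b =
  pcomp_upto m c f b + pcomp_upto m c' f b.
Proof.
rewrite !pcompE -big_split; apply: eq_bigr => k _ /=; rewrite -wsumD.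
by apply: eq_wsum => a _; rewrite mulrDl.
Qed.

Lemma pcompZ m (x : R[i]) c f b : pcomp_upto m (fun a => x * c a) f b =
  x * pcomp_upto m c f b.
Proof.
rewrite !pcompE mulr_sumr; apply: eq_bigr => k _ /=; rewrite -wsum_mulr.
by apply: eq_wsum => a _; rewrite mulrA.
Qed.

Lemma pcomp_stable N m c f b : deg_lt N c -> (N <= m)%N ->
  pcomp_upto m c f b = pcomp_upto N c f b.
Proof.
move=> cN Nm; rewrite !pcompE -(subnKC Nm) big_split_ord /= [X in _ + X]big1 ?addr0 //.
by move=> k _; apply: wsum_eq0 => a ak; rewrite cN ?mul0r // ak leq_addr.
Qed.

(** The coefficient of the monomial b in the product of the letters p_i + w_i along
    the word a. *)
Fixpoint trans (S : pzSemiRingType) (p : 'I_n -> S) (a b : word n) : S :=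
  if a is i :: a' then
    p i * trans p a' b + (if b is j :: b' then (j == i)%:R * trans p a' b' else 0)
  else (b == [::])%:R.

Lemma sum_cons_trans (V : pzSemiRingType) i a (p : 'I_n -> V) (F : word n -> V) N :
  \sum_(l < N.+1) wsum l (fun b =>
      (if b is j :: b' then (j == i)%:R * trans p a b' else 0) * F b) =
  \sum_(l < N) wsum l (fun b => trans p a b * F (i :: b)).
Proof.
rewrite big_ord_recl /= wsum0 mul0r add0r; apply: eq_bigr => l _.
rewrite wsumS (bigD1 i) //= [X in _ + X]big1 ?addr0.
  by apply: eq_wsum => b _; rewrite eqxx mul1r.
by move=> j /negbTE ji; apply: wsum_eq0 => b _; rewrite ji !mul0r.
Qed.

(** Translations compose. *)
Lemma trans_add (S : comPzSemiRingType) (p q : 'I_n -> S) a d N : (size a < N)%N ->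
  trans (fun i => p i + q i) a d =
  \sum_(l < N) wsum l (fun b => trans p a b * trans q b d).
Proof.
elim: a d N => [|i a IHa] d [|N] // aN.
  rewrite big_ord_recl wsum0 /= mul1r big1 ?addr0 // => l _.
  by apply: wsum_eq0 => -[|j b] // _; rewrite mul0r.
have -> : \sum_(l < N.+1) wsum l (fun b => trans p (i :: a) b * trans q b d) =
  p i * (\sum_(l < N.+1) wsum l (fun b => trans p a b * trans q b d)) +
  \sum_(l < N) wsum l (fun b => trans p a b * trans q (i :: b) d).
  rewrite -(sum_cons_trans i a p (fun b => trans q b d)) mulr_sumr -big_split; apply: eq_bigr => l _ /=.
  rewrite -wsum_mulr -wsumD; apply: eq_wsum => b _.
  by rewrite mulrDl mulrA.
rewrite -IHa; last exact: ltnW.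
have -> : \sum_(l < N) wsum l (fun b => trans p a b * trans q (i :: b) d) =
   q i * (\sum_(l < N) wsum l (fun b => trans p a b * trans q b d)) +
   (if d is j :: d' then (j == i)%:R *
      (\sum_(l < N) wsum l (fun b => trans p a b * trans q b d')) else 0).
  have -> : (if d is j :: d' then (j == i)%:R *
      (\sum_(l < N) wsum l (fun b => trans p a b * trans q b d')) else 0) =
    \sum_(l < N) wsum l (fun b => trans p a b *
      (if d is j :: d' then (j == i)%:R * trans q b d' else 0)).
    case: d => [|j d]; first by rewrite big1 // => l _; apply: wsum_eq0 => b _; rewrite mulr0.
    rewrite mulr_sumr; apply: eq_bigr => l _; rewrite -wsum_mulr.
    by apply: eq_wsum => b _; rewrite mulrCA.
  rewrite mulr_sumr -big_split; apply: eq_bigr => l _ /=.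
  rewrite -wsum_mulr -wsumD; apply: eq_wsum => b _.
  by rewrite mulrDr mulrCA.
by case: d => [|j d]; rewrite -!(IHa _ N aN) /= mulrDl addrA.
Qed.

Lemma trans0 (S : pzSemiRingType) (a b : word n) : trans (fun=> 0 : S) a b = (a == b)%:R.
Proof.
elim: a b => [|i a IHa] [|j b] //=; rewrite mul0r add0r //.
by rewrite IHa eqseq_cons [i == j]eq_sym -mulnb natrM.
Qed.

Definition centered f : 'I_n -> ncseries R n :=
  fun i b => if b is [::] then 0 else f i b.

Lemma pmul_centered f i phi b :
  pmul (f i) phi b = f i [::] * phi b + pmul (centered f i) phi b.
Proof.
by case: b => [|j b]; rewrite ?pmul_nil ?pmul_cons /= ?mul0r ?addr0 ?add0r.
Qed.

Lemma pword_centered_small f a b : (size b < size a)%N -> pword (centered f) a b = 0.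
Proof.
elim: a b => // i a IHa b /=; rewrite ltnS => ba.
rewrite /pmul big1 // => -[[|k] kb] _ /=; first by rewrite take0 mul0r.
rewrite IHa ?mulr0 // size_drop; case: b ba kb => // j b /= ba _.
by apply: leq_ltn_trans ba; rewrite subSS leq_subr.
Qed.

Lemma pword_centered_diag f i a j b : size b = size a ->
  pword (centered f) (i :: a) (j :: b) = f i [:: j] * pword (centered f) a b.
Proof.
move=> ba; rewrite /= pmul_cons mul0r add0r.
rewrite /pmul big_ord_recl /= take0 drop0 big1 ?addr0 // => k _.
rewrite pword_centered_small ?mulr0 // size_drop -ba ltn_subrL /=.
exact: leq_ltn_trans (ltn_ord k).
Qed.

(** Splitting f(0) off every letter: substituting f is translating by f(0) and then
    substituting series without constant terms. *)
Lemma pword_expand f a b N : (size b < N)%N ->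
  pword f a b = \sum_(l < N) wsum l (fun d =>
    trans (fun i => f i [::]) a d * pword (centered f) d b).
Proof.
elim: a b N => [|i a IHa] b [|N] // bN.
  rewrite big_ord_recl wsum0 /= mul1r big1 ?addr0 // => l _.
  by apply: wsum_eq0 => -[|j d] // _; rewrite mul0r.
rewrite [LHS]pmul_centered /=.
have -> : \sum_(l < N.+1) wsum l (fun d =>
    trans (fun i => f i [::]) (i :: a) d * pword (centered f) d b) =
  f i [::] * (\sum_(l < N.+1) wsum l (fun d =>
     trans (fun i => f i [::]) a d * pword (centered f) d b)) +
  \sum_(l < N) wsum l (fun d => trans (fun i => f i [::]) a d *
     pword (centered f) (i :: d) b).
  rewrite -(sum_cons_trans i a _ (fun d => pword (centered f) d b)) mulr_sumr -big_split; apply: eq_bigr => l _ /=.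
  rewrite -wsum_mulr -wsumD; apply: eq_wsum => d _.
  by rewrite mulrDl mulrA.
rewrite -IHa //; congr (_ + _).
have -> : \sum_(l < N) wsum l (fun d => trans (fun i => f i [::]) a d *
     pword (centered f) (i :: d) b) =
  \sum_(l < N.+1) wsum l (fun d => trans (fun i => f i [::]) a d *
     pword (centered f) (i :: d) b).
  rewrite big_ord_recr /= [X in _ = _ + X]wsum_eq0 ?addr0 // => d dN.
  have -> : pmul (centered f i) (pword (centered f) d) b = 0; last exact: mulr0.
  by apply: (@pword_centered_small f (i :: d)); rewrite /= dN.
rewrite [LHS](@eq_pmulr _ _ (fun b => \sum_(l < N.+1) wsum l (fun d =>
    trans (fun i => f i [::]) a d * pword (centered f) d b))); last first.
  move=> k kb; apply: IHa; apply: leq_ltn_trans bN.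
  by rewrite size_drop leq_subr.
rewrite /pmul; under eq_bigr do rewrite mulr_sumr.
rewrite exchange_big; apply: eq_bigr => l _ /=.
have -> : wsum l (fun d => trans (fun i => f i [::]) a d * pmul (centered f i)
    (pword (centered f) d) b) = wsum l (fun d => \sum_(k < (size b).+1)
     centered f i (take k b) * (trans (fun i => f i [::]) a d *
      pword (centered f) d (drop k b))).
  apply: eq_wsum => d _; rewrite /pmul mulr_sumr; apply: eq_bigr => k _.
  by rewrite mulrCA.
rewrite wsum_exchange; apply: eq_bigr => k _.
by rewrite -wsum_mulr.
Qed.

End SeriesAlgebra.

Section Translation.
Context {R : realType} {n : nat}.
Implicit Types (G : ncseries R n) (a b d : word n) (p q : 'I_n -> R[i]).

Definition wpow (w : 'I_n -> R) a : R := \prod_(i <- a) w i.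

Lemma wpow_cons w i a : wpow w (i :: a) = w i * wpow w a.
Proof. by rewrite /wpow big_cons. Qed.

Lemma wpow_cat w a b : wpow w (a ++ b) = wpow w a * wpow w b.
Proof. by rewrite /wpow big_cat. Qed.

Lemma wpow_ge0 w a : (forall i, 0 <= w i) -> 0 <= wpow w a.
Proof. by move=> w0; apply: prodr_ge0. Qed.

Lemma wpow_le w w' a : (forall i, 0 <= w i <= w' i) -> wpow w a <= wpow w' a.
Proof. by move=> ww; apply: ler_prod. Qed.

Lemma wpow_const (x : R) a : wpow (fun=> x) a = x ^+ size a.
Proof. by elim: a => [|i a IHa]; rewrite ?wpow_cons ?IHa ?exprS // /wpow big_nil. Qed.

Lemma wpow_scale (x : R) w a : wpow (fun i => x * w i) a = x ^+ size a * wpow w a.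
Proof.
elim: a => [|i a IHa]; first by rewrite /wpow !big_nil mul1r.
by rewrite !wpow_cons IHa exprS /=; ring.
Qed.

(** Geometric decay, rather than summability, is what [tannery] uses. *)
Definition wsummable (w : 'I_n -> R) G : Prop := exists C rho : R,
  [/\ 0 <= C, 0 <= rho < 1 & forall k, wsum k (fun a => nm (G a) * wpow w a) <= C * rho ^+ k].

Lemma trans_ge0 (x : 'I_n -> R) a b : (forall i, 0 <= x i) -> 0 <= trans x a b.
Proof.
move=> x0; elim: a b => [|i a IHa] b /=; first by case: b.
by apply: addr_ge0; [exact: mulr_ge0 | case: b => // j b; exact: mulr_ge0].
Qed.

Lemma nm_trans p a b : nm (trans p a b) <= trans (fun i => nm (p i)) a b.
Proof.
have nmb (t : bool) : nm (t%:R : R[i]) = t%:R.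
  by case: t; rewrite ?nm1 ?nm0.
elim: a b => [|i a IHa] b /=; first by rewrite nmb.
apply: le_trans (nm_triangle _ _) _; apply: lerD.
  by rewrite nmM ler_wpM2l ?nm_ge0.
case: b => [|j b]; first by rewrite nm0.
by rewrite nmM nmb ler_wpM2l.
Qed.

Lemma sum_trans_le (x w : 'I_n -> R) a N : (forall i, 0 <= x i) -> (forall i, 0 <= w i) ->
  \sum_(l < N) wsum l (fun b => trans x a b * wpow w b) <= wpow (fun i => x i + w i) a.
Proof.
move=> x0 w0; elim: a N => [|i a IHa] [|N].
- by rewrite big_ord0 /wpow big_nil.
- rewrite big_ord_recl wsum0 /= mul1r big1 ?addr0 /wpow ?big_nil // => l _.
  by apply: wsum_eq0 => -[|j b] // _; rewrite mul0r.
- by rewrite big_ord0 wpow_ge0 // => j; exact: addr_ge0.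
have -> : \sum_(l < N.+1) wsum l (fun b => trans x (i :: a) b * wpow w b) =
  x i * (\sum_(l < N.+1) wsum l (fun b => trans x a b * wpow w b)) +
  \sum_(l < N) wsum l (fun b => trans x a b * wpow w (i :: b)).
  rewrite -(sum_cons_trans i a x (wpow w)) mulr_sumr -big_split.
  apply: eq_bigr => l _ /=.
  by rewrite -wsum_mulr -wsumD; apply: eq_wsum => b _; rewrite mulrDl mulrA.
rewrite wpow_cons mulrDl; apply: lerD; first by rewrite ler_wpM2l.
have -> : \sum_(l < N) wsum l (fun b => trans x a b * wpow w (i :: b)) =
    w i * (\sum_(l < N) wsum l (fun b => trans x a b * wpow w b)).
  rewrite mulr_sumr; apply: eq_bigr => l _; rewrite -wsum_mulr.
  by apply: eq_wsum => b _; rewrite wpow_cons mulrCA.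
by rewrite ler_wpM2l.
Qed.

Lemma wsum_trans_le (x w : 'I_n -> R) a l : (forall i, 0 <= x i) -> (forall i, 0 <= w i) ->
  wsum l (fun b => trans x a b * wpow w b) <= wpow (fun i => x i + w i) a.
Proof.
move=> x0 w0; apply: le_trans (sum_trans_le a l.+1 x0 w0).
rewrite big_ord_recr /= lerDr sumr_ge0 // => k _; apply: wsum_ge0 => b.
by rewrite mulr_ge0 ?trans_ge0 ?wpow_ge0.
Qed.

(** A Cauchy estimate: one coefficient is bounded by the sum of all of them at
    radius e. *)
Lemma trans_le (x : 'I_n -> R) (e : R) a b : (forall i, 0 <= x i) -> 0 < e ->
  trans x a b <= (e ^+ size b)^-1 * wpow (fun i => x i + e) a.
Proof.
move=> x0 e0; rewrite -ler_pdivrMl ?invr_gt0 ?exprn_gt0 // invrK mulrC.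
apply: le_trans (@wsum_trans_le x (fun=> e) a (size b) x0 _) => [|i]; last exact: ltW.
rewrite -(wpow_const e b).
rewrite /wsum (bigD1 (in_tuple b)) //= lerDl sumr_ge0 // => c _.
by rewrite mulr_ge0 ?trans_ge0 ?wpow_ge0 // => i; exact: ltW.
Qed.

(** The Taylor coefficient of G at p in the monomial b, summed over degrees below m. *)
Definition taylor G p m b : R[i] :=
  \sum_(k < m) wsum k (fun a => G a * trans p a b).

Lemma geometric_weight_le (w : 'I_n -> R) G C rho m : 0 <= C -> 0 <= rho < 1 ->
  (forall k, wsum k (fun a => nm (G a) * wpow w a) <= C * rho ^+ k) ->
  \sum_(k < m) wsum k (fun a => nm (G a) * wpow w a) <= C * (1 - rho)^-1.
Proof.
move=> C0 r01 GC; apply: (@le_trans _ _ (\sum_(k < m) C * rho ^+ k)).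
  by apply: ler_sum => k _.
by rewrite -mulr_sumr ler_wpM2l // geometric_sum_le.
Qed.

Lemma nm_wsum k (F : word n -> R[i]) : nm (wsum k F) <= wsum k (fun a => nm (F a)).
Proof. exact: nm_sum. Qed.

(** Re-expanding at p + q the expansion at p: the double series converges
    absolutely when |p| + 2 |q| stays within the weight. *)
Lemma taylor_shift (w : 'I_n -> R) G p q (e : R) : wsummable w G -> 0 < e ->
  (forall i, nm (p i) + (2 * nm (q i) + 2 * e) <= w i) ->
  (forall b, tends \oo (fun m => taylor G p m b) 0) ->
  forall b, tends \oo (fun m => taylor G (fun i => p i + q i) m b) 0.
Proof.
move=> [C [rho [C0 r01 GC]]] e0 pqw Gp d.
have np0 i : 0 <= nm (p i) := nm_ge0 _.
have nq0 i : 0 <= nm (q i) := nm_ge0 _.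
pose x m l := nm (wsum l (fun b => taylor G p m b * trans q b d)).
have E m : taylor G (fun i => p i + q i) m d =
    \sum_(l < m) wsum l (fun b => taylor G p m b * trans q b d).
  rewrite /taylor (eq_bigr (fun k : 'I_m => \sum_(l < m) wsum l (fun b =>
      wsum k (fun a => G a * trans p a b * trans q b d)))); last first.
    move=> k _; transitivity (wsum k (fun a => \sum_(l < m) wsum l (fun b =>
        G a * trans p a b * trans q b d))).
      apply: eq_wsum => a ak.
      rewrite (trans_add _ _ _ (_ : (size a < m)%N)) ?ak // mulr_sumr.
      apply: eq_bigr => l _; rewrite -wsum_mulr.
      by apply: eq_wsum => b _; rewrite mulrA.
    by rewrite wsum_exchange; apply: eq_bigr => l _; rewrite wsum_wsum.
  rewrite exchange_big; apply: eq_bigr => l _ /=; apply/esym.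
  transitivity (wsum l (fun b => \sum_(k < m) wsum k (fun a =>
      G a * trans p a b * trans q b d))); last by rewrite wsum_exchange.
  apply: eq_wsum => b _; rewrite mulr_suml.
  by apply: eq_bigr => k _; rewrite wsum_mull.
(* The factor 2 in the weight kap leaves a factor 1/2 for every letter of b, which
   dominates the sum over l. *)
have dom m l : x m l <= (e ^+ size d)^-1 * (C * (1 - rho)^-1) * (2^-1) ^+ l.
  apply: le_trans (nm_wsum _ _) _.
  pose kap i := 2 * nm (q i) + 2 * e.
  have kap0 i : 0 <= kap i by rewrite /kap; have := nq0 i; lra.
  apply: (@le_trans _ _ (wsum l (fun b => 
    (\sum_(k < m) wsum k (fun a => nm (G a) * trans (fun i => nm (p i)) a b)) *
     ((e ^+ size d)^-1 * (2^-1 ^+ l * wpow kap b))))).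
    apply: wsum_ler => b bl; rewrite nmM; apply: ler_pM; rewrite ?nm_ge0 //.
      apply: le_trans (nm_sum _ _ _) _; apply: ler_sum => k _.
      apply: le_trans (nm_wsum _ _) _; apply: wsum_ler => a _.
      by rewrite nmM ler_wpM2l ?nm_ge0 // nm_trans.
    apply: le_trans (nm_trans _ _ _) _; apply: le_trans (trans_le _ _ nq0 e0) _.
    rewrite ler_wpM2l ?invr_ge0 ?exprn_ge0 ?(ltW e0) // -bl -wpow_scale.
    by rewrite /kap le_eqVlt; apply/orP; left; apply/eqP; congr wpow;
       apply/funext => i; field.
  have -> : wsum l (fun b => 
    (\sum_(k < m) wsum k (fun a => nm (G a) * trans (fun i => nm (p i)) a b)) *
     ((e ^+ size d)^-1 * (2^-1 ^+ l * wpow kap b))) =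
    ((e ^+ size d)^-1 * 2^-1 ^+ l) * \sum_(k < m) wsum k (fun a => nm (G a) *
       wsum l (fun b => trans (fun i => nm (p i)) a b * wpow kap b)).
    transitivity (wsum l (fun b => \sum_(k < m) wsum k (fun a => 
        nm (G a) * trans (fun i => nm (p i)) a b * 
         ((e ^+ size d)^-1 * (2^-1 ^+ l * wpow kap b))))).
      apply: eq_wsum => b _; rewrite mulr_suml; apply: eq_bigr => k _.
      by rewrite wsum_mull.
    rewrite wsum_exchange mulr_sumr; apply: eq_bigr => k _.
    rewrite wsum_wsum -wsum_mulr; apply: eq_wsum => a _.
    rewrite -[in RHS]wsum_mulr -[in RHS]wsum_mulr; apply: eq_wsum => b _; ring.
  rewrite [X in _ <= X]mulrAC ler_wpM2l ?mulr_ge0 ?invr_ge0 ?exprn_ge0 ?(ltW e0) //.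
  apply: le_trans (geometric_weight_le m C0 r01 GC); apply: ler_sum => k _.
  apply: wsum_ler => a _; rewrite ler_wpM2l ?nm_ge0 //.
  apply: le_trans (wsum_trans_le _ _ np0 kap0) _; apply: wpow_le => i.
  by rewrite addr_ge0 //= pqw.
have D0 : 0 <= (e ^+ size d)^-1 * (C * (1 - rho)^-1).
  case/andP: r01 => r0 r1.
  by rewrite !mulr_ge0 ?invr_ge0 ?exprn_ge0 ?(ltW e0) // subr_ge0 ltW.
have h01 : 0 <= (2^-1 : R) < 1 by rewrite invr_ge0 ler0n invf_lt1 // ltr1n.
have lim l (u : R) : 0 < u -> \forall m \near \oo, x m l < u.
  have : tends \oo (fun m => wsum l (fun b => taylor G p m b * trans q b d)) 0.
    rewrite [X in tends _ _ X](_ : 0 = wsum l (fun b : word n => 0)); last first.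
      by rewrite wsum_eq0.
    apply: tends_sum => b _; rewrite -[X in tends _ _ X](mulr0 (trans q b d)).
    by apply: tends_eq (tendsM _ (Gp b)) => m; rewrite mulrC.
  by move=> h u0; apply: filterS (h _ u0) => m; rewrite subr0.
move=> u u0; have u2 : 0 < u / 2 by rewrite divr_gt0.
have domn : \forall m \near \oo, forall k, x m k <= 
   (e ^+ size d)^-1 * (C * (1 - rho)^-1) * 2^-1 ^+ k by apply: nearW => m k.
apply: filterS (tannery D0 h01 domn lim u2) => m /(_ m) h.
rewrite subr0 E; apply: le_lt_trans (nm_sum _ _ _) _.
by apply: le_lt_trans h _; lra.
Qed.

(** The expansion at 0 is reached from the one at p by finitely many translations
    along the segment, each so short that the room dl in the weight absorbs it. *)
Lemma taylor_zero (dl : R) G p : 0 < dl -> wsummable (fun i => nm (p i) + dl) G ->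
  (forall b, tends \oo (fun m => taylor G p m b) 0) -> forall b, G b = 0.
Proof.
move=> dl0 Gs Gp.
pose B := \sum_i nm (p i).
have pB i : nm (p i) <= B.
  by rewrite /B (bigD1 i) //= lerDl sumr_ge0 // => j _; exact: nm_ge0.
have B0 : 0 <= B by apply: sumr_ge0 => i _; exact: nm_ge0.
have Bp : 0 < dl / (4 * (B + 1)) by rewrite divr_gt0 // mulr_gt0 // ltr_wpDl.
have [N Ne] := invrn_lt_exists Bp.
pose s : R := N.+1%:R^-1.
have s0 : 0 < s by rewrite invr_gt0.
have sB : 2 * (s * B) <= dl / 2.
  have : s * (4 * (B + 1)) <= dl.
    by rewrite -ler_pdivlMr; [exact: ltW | rewrite mulr_gt0 // ltr_wpDl].
  have : 0 <= s * B by apply: mulr_ge0 => //; exact: ltW.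
  by lra.
have step k : (k <= N.+1)%N -> forall b,
    tends \oo (fun m => taylor G (fun i => (1 - k%:R * s)%:C * p i) m b) 0.
  elim: k => [|k IHk] kN b.
    rewrite (_ : (fun i => _) = p) //; apply/funext => i.
    by rewrite mul0r subr0 mul1r.
  have e0 : 0 < dl / 4 by rewrite divr_gt0.
  have t0 : 0 <= 1 - k%:R * s.
    by rewrite subr_ge0 /s ler_pdivrMr // mul1r ler_nat; exact: ltnW.
  have t1 : 1 - k%:R * s <= 1 by rewrite gerBl mulr_ge0 // ltW.
  have := taylor_shift (q := fun i => - (s%:C * p i)) Gs e0 _ (IHk (ltnW kN)) b.
  rewrite (_ : (fun i => (1 - k%:R * s)%:C * p i + - (s%:C * p i)) =
    (fun i => (1 - k.+1%:R * s)%:C * p i)); last first.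
    apply/funext => i; rewrite -mulrBl -rmorphB; congr (_%:C * _).
    by rewrite -addn1 natrD; ring.
  apply=> i; rewrite nmN !nmM !nm_real [`|s|]ger0_norm ?(ltW s0) // ger0_norm //.
  have := pB i; have := nm_ge0 (p i) => h1 h2.
  have h3 : (1 - k%:R * s) * nm (p i) <= nm (p i) by rewrite ler_piMl.
  have h4 : s * nm (p i) <= s * B by rewrite ler_wpM2l // ltW.
  move: h1 h3 h4 sB; move: ((1 - k%:R * s) * nm (p i)) (s * nm (p i)) (s * B) => x y z.
  by lra.
move=> b; have := step _ (leqnn _) b.
rewrite /s mulfV // subrr (_ : (fun i => 0%:C * p i) = (fun=> 0)); last first.
  by apply/funext => i; rewrite mul0r.
move=> h; apply: (tends_unique (F := \oo) _ h).
apply: tends_near (tends_cst (G b)); exists (size b).+1 => // m /= bm.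
rewrite /taylor (bigD1 (Ordinal bm)) //= [X in _ = _ + X]big1.
  rewrite addr0 (@wsum_pred1 _ _ _ b) ?trans0 ?eqxx ?mulr1 // => a _ ab.
  by rewrite trans0 (_ : (a == b) = false) ?mulr0 //; apply/eqP.
move=> k kb; apply: wsum_eq0 => a ak; rewrite trans0 (_ : (a == b) = false) ?mulr0 //.
by apply/eqP => ab; move/eqP: kb; apply; apply: val_inj; rewrite /= -ak ab.
Qed.

End Translation.

Section InverseUnique.
Context {R : realType} {n : nat}.
Variable f : 'I_n -> ncseries R n.
Implicit Types (G : ncseries R n) (g : 'I_n -> ncseries R n) (b : word n).

Let p i := f i [::].

(** The composition G o f is the expansion of G at f(0), evaluated at f - f(0). *)
Lemma pcomp_taylor G m b N : (size b < N)%N ->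
  pcomp_upto m G f b =
  \sum_(l < N) wsum l (fun d => taylor G p m d * pword (centered f) d b).
Proof.
move=> bN; rewrite pcompE.
rewrite (eq_bigr (fun k : 'I_m => \sum_(l < N) wsum l (fun d =>
    wsum k (fun a => G a * trans p a d) * pword (centered f) d b))); last first.
  move=> k _; transitivity (wsum k (fun a => \sum_(l < N) wsum l (fun d =>
      G a * trans p a d * pword (centered f) d b))).
    apply: eq_wsum => a _; rewrite (pword_expand f a bN) mulr_sumr.
    apply: eq_bigr => l _.
    by rewrite -wsum_mulr; apply: eq_wsum => d _; rewrite mulrA.
  rewrite wsum_exchange; apply: eq_bigr => l _; rewrite wsum_wsum.
  by apply: eq_wsum => d _; rewrite wsum_mull.
rewrite exchange_big; apply: eq_bigr => l _ /=; rewrite -[LHS]wsum_exchange.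
by apply: eq_wsum => d _; rewrite -mulr_suml.
Qed.

Definition jac := linear_coefs f.

Lemma mxvec_tends0 (x : 'I_n -> nat -> R[i]) : jac \in unitmx ->
  (forall j, tends \oo (fun m => \sum_i x i m * f i [:: j]) 0) ->
  forall i, tends \oo (x i) 0.
Proof.
move=> Ju xJ i.
have : tends \oo (fun m => \sum_j (invmx jac) j i * (\sum_k x k m * f k [:: j]))
    (\sum_(j < n) 0).
  by apply: tends_sum => j _; rewrite -[X in tends _ _ X](mulr0 ((invmx jac) j i)); apply: tendsM.
rewrite big1 //; apply: tends_eq => m.
have JV k : \sum_j f k [:: j] * (invmx jac) j i = (k == i)%:R.
  have /matrixP/(_ k i) := mulmxV Ju; rewrite [RHS]mxE mxE => <-.
  by apply: eq_bigr => j _; rewrite [jac k j]mxE.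
under eq_bigr do rewrite mulr_sumr.
rewrite exchange_big /= (bigD1 i) //= [X in _ + X]big1 => [|k ki].
  under eq_bigr do rewrite mulrCA [_ * f _ _]mulrC.
  by rewrite -mulr_sumr JV eqxx mulr1 addr0.
under eq_bigr do rewrite mulrCA [_ * f _ _]mulrC.
by rewrite -mulr_sumr JV (negbTE ki) mulr0.
Qed.

(** Between words of equal length, substitution of f - f(0) acts through its linear
    part, one letter at a time. *)
Lemma leading_tends0 l (S : nat -> word n -> R[i]) : jac \in unitmx ->
  (forall b, size b = l ->
     tends \oo (fun m => wsum l (fun d => S m d * pword (centered f) d b)) 0) ->
  forall d, size d = l -> tends \oo (fun m => S m d) 0.
Proof.
move=> Ju; elim: l S => [|l IHl] S SJ d dl.
  move/size0nil: dl => ->; apply: tends_eq (SJ [::] erefl) => m.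
  by rewrite wsum0 /= mulr1.
case: d dl => // i d /= [dl].
apply: (IHl (fun m d => S m (i :: d))) => // b bl.
apply: (mxvec_tends0 (x := fun i m => wsum l (fun d => S m (i :: d) *
  pword (centered f) d b))) => // j.
have := SJ (j :: b); rewrite /= bl => /(_ erefl).
apply: tends_eq => m; rewrite wsumS; apply: eq_bigr => k _.
rewrite -wsum_mull; apply: eq_wsum => c cl.
have := @pword_centered_diag _ _ f k c j b; rewrite bl cl => /(_ erefl) /= ->.
by rewrite mulrA mulrAC.
Qed.

(** Since f - f(0) starts with an invertible linear part, the coefficients of G o f
    determine those of the expansion of G at f(0), by induction on the degree; that
    expansion determines G. *)
Lemma composition_injective (dl : R) G : 0 < dl ->
  wsummable (fun i => nm (f i [::]) + dl) G -> jac \in unitmx ->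
  (forall b, tends \oo (fun m => pcomp_upto m G f b) 0) -> forall a, G a = 0.
Proof.
move=> dl0 Gs Ju Gf; apply: (taylor_zero dl0 Gs) => b.
have [l bl] : exists l, (size b <= l)%N by exists (size b).
elim: l b bl => [|l IHl] b bl; apply: leading_tends0 (erefl (size b)) => // d db.
- move: bl db; rewrite leqn0 => /eqP b0; rewrite b0 => d0.
  apply: tends_eq (Gf d) => m; rewrite (@pcomp_taylor G m d 1) ?d0 //.
  by rewrite big_ord1.
have [lt|ge] := leqP (size b) l; last first.
  have bl1 : size b = l.+1 by apply/eqP; rewrite eqn_leq bl ge.
  have : tends \oo (fun m => pcomp_upto m G f d -
      \sum_(k < l.+1) wsum k (fun c => taylor G p m c * pword (centered f) c d))
      (0 - \sum_(k < l.+1) wsum k (fun c : word n => 0)).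
    apply: tendsB; first exact: Gf.
    apply: tends_sum => k _; apply: tends_sum => c _.
    rewrite -[X in tends _ _ X](mulr0 (pword (centered f) c d)).
    have := IHl c; rewrite size_tuple => /(_ (ltn_ord k)) h.
    by apply: tends_eq (tendsM _ h) => m; rewrite mulrC.
  rewrite [X in _ - X]big1 ?subr0 => [|k _]; last exact: wsum_eq0.
  apply: tends_eq => m; rewrite (@pcomp_taylor G m d l.+2) ?db ?bl1 //.
  by rewrite big_ord_recr /= addrAC subrr add0r.
rewrite [X in tends _ _ X](_ : 0 = wsum (size b) (fun b : word n => 0)); last first.
  by rewrite wsum_eq0.
apply: tends_sum => c _; rewrite -[X in tends _ _ X](mulr0 (pword (centered f) c d)).
have := IHl c; rewrite size_tuple => /(_ lt) h.
by apply: tends_eq (tendsM _ h) => m; rewrite mulrC.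
Qed.

(** The composition g o f is summed by degree in g: as f may have constant terms,
    each of its coefficients is an infinite sum. *)
Definition formal_left_inverse g : Prop :=
  forall i b, tends \oo (fun m => pcomp_upto m (g i) f b) (pvar i b).

(** By the chain rule for g o f, the linear part of f has trivial kernel. *)
Lemma formal_left_inverse_jac g : formal_left_inverse g -> jac \in unitmx.
Proof.
move=> gf; rewrite -unitmx_tr -row_free_unit; apply: inj_row_free => v vJ.
apply/rowP => i; rewrite mxE.
have Jv k : \sum_j f k [:: j] * v 0 j = 0.
  have /matrixP/(_ 0 k) := vJ; rewrite [RHS]mxE mxE => E; rewrite -[RHS]E.
  by apply: eq_bigr => j _; rewrite !mxE mulrC.
have h : tends \oo (fun m => \sum_j v 0 j * pcomp_upto m (g i) f [:: j])
    (\sum_j v 0 j * pvar i [:: j]).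
  by apply: tends_sum => j _; apply: tendsM; exact: gf.
have -> : v 0 i = \sum_j v 0 j * pvar i [:: j].
  rewrite (bigD1 i) //= big1 ?addr0 => [|j ji]; first by rewrite /pvar eqxx mulr1.
  by rewrite /pvar eqseq_cons andbT (negbTE ji) mulr0.
apply: (tends_unique h); apply: tends_eq (tends_cst 0) => m; apply/esym.
under eq_bigr do rewrite (@pcomp_taylor (g i) m [:: _] 2) // big_ord_recl big_ord1 wsum0
  /= /pone mulr0 add0r wsumS mulr_sumr.
rewrite exchange_big big1 // => k _ /=; rewrite -[RHS](mulr0 (taylor (g i) p m [:: k])).
rewrite -[in RHS](Jv k) mulr_sumr; apply: eq_bigr => j _.
rewrite wsum0 pmul_cons mul0r add0r pmul_nil mulr1 /=.
by rewrite mulrCA; congr (_ * _); rewrite mulrC.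
Qed.

End InverseUnique.

Section FormalInverse.
Context {R : realType} {n : nat}.
Implicit Types (f g : 'I_n -> ncseries R n) (G c : ncseries R n) (a b : word n).

(** The form of g o f = id that all models share, for which g is unique: the
    coefficients of g decay fast enough to be re-expanded at f(0). *)
Definition formal_inverse f g : Prop :=
  formal_left_inverse f g /\ exists2 dl : R, 0 < dl & forall i, wsummable (fun i => nm (f i [::]) + dl) (g i).

Lemma wsummable_le (w w' : 'I_n -> R) G : (forall i, 0 <= w i <= w' i) ->
  wsummable w' G -> wsummable w G.
Proof.
move=> ww [C [rho [C0 r01 GC]]]; exists C, rho; split=> // k.
apply: le_trans (GC k); apply: wsum_ler => a _.
by rewrite ler_wpM2l ?nm_ge0 // wpow_le.
Qed.

Lemma wsummableB (w : 'I_n -> R) G G' : (forall i, 0 <= w i) ->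
  wsummable w G -> wsummable w G' -> wsummable w (fun a => G a - G' a).
Proof.
move=> w0 [C [rho [C0 /andP[r0 r1] GC]]] [C' [rho' [C'0 /andP[r'0 r'1] GC']]].
exists (C + C'), (Num.max rho rho'); split; first exact: addr_ge0.
  by rewrite le_max r0 gt_max r1.
move=> k; apply: (@le_trans _ _ (C * rho ^+ k + C' * rho' ^+ k)).
  apply: le_trans (lerD (GC k) (GC' k)); rewrite -wsumD; apply: wsum_ler => a _.
  rewrite -mulrDl ler_wpM2r ?wpow_ge0 //; apply: le_trans (nm_triangle _ _) _.
  by rewrite nmN.
rewrite mulrDl; apply: lerD; apply: ler_wpM2l => //; apply: lerXn2r;
  by rewrite ?nnegrE ?le_max ?r0 ?lexx ?orbT.
Qed.

Lemma pcompB m c c' f b : pcomp_upto m (fun a => c a - c' a) f b =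
  pcomp_upto m c f b - pcomp_upto m c' f b.
Proof.
rewrite -[pcomp_upto m c' f b]mul1r -mulNr -pcompZ -pcompD.
by congr (pcomp_upto m _ f b); apply/funext => a; rewrite mulN1r.
Qed.

Lemma composition_unique (w : 'I_n -> R) f g c c' (s : ncseries R n) :
  formal_left_inverse f g -> (exists2 dl : R, 0 < dl & forall i, nm (f i [::]) + dl <= w i) ->
  wsummable w c -> wsummable w c' ->
  (forall b, tends \oo (fun m => pcomp_upto m c f b) (s b)) ->
  (forall b, tends \oo (fun m => pcomp_upto m c' f b) (s b)) -> c = c'.
Proof.
move=> /formal_left_inverse_jac Ju [dl dl0 dlw] cs c's cf c'f.
have w0 i : 0 <= w i.
  by apply: le_trans (dlw i); rewrite addr_ge0 ?nm_ge0 // ltW.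
apply/funext => a; apply/eqP; rewrite -subr_eq0; apply/eqP; move: a.
apply: (composition_injective dl0 _ Ju).
  apply: wsummable_le (wsummableB w0 cs c's) => i.
  by rewrite dlw addr_ge0 ?nm_ge0 // ltW.
move=> b; rewrite -(subrr (s b)).
by apply: tends_eq (tendsB (cf b) (c'f b)) => m; rewrite pcompB.
Qed.

Lemma formal_inverse_unique f g g' : formal_inverse f g -> formal_inverse f g' -> g = g'.
Proof.
move=> [gf [d d0 gs]] [g'f [d' d'0 g's]]; apply/funext => i.
have m0 : 0 < Num.min d d' by rewrite lt_min d0.
apply: (composition_unique (w := fun i => nm (f i [::]) + Num.min d d') gf) => //.
- by exists (Num.min d d').
- apply: wsummable_le (gs i) => j; rewrite lerD2l ge_min lexx addr_ge0 ?nm_ge0 //.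
  exact: ltW.
- apply: wsummable_le (g's i) => j; rewrite lerD2l ge_min lexx orbT addr_ge0 ?nm_ge0 //.
  exact: ltW.
Qed.

Definition hdil (x : R) c : ncseries R n := fun a => (x ^+ size a)%:C * c a.

Lemma pword_pscale (r : R) f a b : pword (pscale r f) a b = (r ^+ size a)%:C * pword f a b.
Proof.
elim: a b => [|i a IHa] b /=; first by rewrite expr0 mul1r.
rewrite (_ : pscale r f i = fun a => r%:C * f i a) // pmulZl.
rewrite (_ : pword (pscale r f) a = fun b => (r ^+ size a)%:C * pword f a b); last first.
  exact/funext.
rewrite exprS rmorphM -mulrA; congr (_ * _).
by rewrite /pmul mulr_sumr; apply: eq_bigr => k _; rewrite mulrCA.
Qed.

Lemma pcomp_pscale m r c f b :
  pcomp_upto m c (pscale r f) b = pcomp_upto m (hdil r c) f b.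
Proof.
rewrite !pcompE; apply: eq_bigr => k _; apply: eq_wsum => a _.
by rewrite pword_pscale /hdil mulrCA mulrA.
Qed.

Lemma pmul_hdil x c c' b : pmul (hdil x c) (hdil x c') b = hdil x (pmul c c') b.
Proof.
rewrite /pmul /hdil mulr_sumr; apply: eq_bigr => k _.
rewrite mulrACA -rmorphM -exprD size_take_min size_drop.
by have /minn_idPl -> : (k <= size b)%N; rewrite ?subnKC // -ltnS.
Qed.

Lemma pword_hdil x f a : pword (fun i => hdil x (f i)) a = hdil x (pword f a).
Proof.
elim: a => [|i a IHa] /=; apply/funext => b; last by rewrite IHa pmul_hdil.
by case: b => [|j b]; rewrite /hdil /pone ?mulr0 // expr0 mul1r.
Qed.

Lemma pcomp_hdil m x c f b :
  pcomp_upto m c (fun i => hdil x (f i)) b = (x ^+ size b)%:C * pcomp_upto m c f b.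
Proof.
rewrite !pcompE mulr_sumr; apply: eq_bigr => k _; rewrite -wsum_mulr.
by apply: eq_wsum => a _; rewrite pword_hdil /hdil mulrCA.
Qed.

Lemma formal_inverse_scale (r : R) f g : 0 < r <= 1 ->
  formal_inverse (pscale r f) g -> formal_inverse f (fun i => hdil r (g i)).
Proof.
move=> /andP[r0 r1] [gf [dl dl0 gs]]; split.
  by move=> i b; apply: tends_eq (gf i b) => m; rewrite pcomp_pscale.
exists dl => // i; have [C [rho [C0 r01 GC]]] := gs i; exists C, rho; split=> // k.
apply: le_trans (GC k); apply: wsum_ler => a _.
rewrite /hdil nmM nm_real ger0_norm ?exprn_ge0 ?(ltW r0) // mulrAC -wpow_scale mulrC.
rewrite ler_wpM2l ?nm_ge0 //; apply: wpow_le => j.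
rewrite mulr_ge0 ?addr_ge0 ?nm_ge0 ?(ltW r0) ?(ltW dl0) //= mulrDr /pscale nmM nm_real.
by rewrite (ger0_norm (ltW r0)) lerD2l ler_piMl // ltW.
Qed.

End FormalInverse.

(** * Power series in row contractions and in the creation operators *)

Section RowContractions.
Context {R : realType} {n : nat} {H : hilbertType R}.
Variables (F : 'I_n -> H -> H) (Fb : forall i, bounded_op (F i)).
Hypothesis F_row : row_contraction F.
Implicit Types psi : ncseries R n.

Lemma row_contraction_sqr (x : 'I_n -> H) :
  nm (\sum_i F i (x i)) ^+ 2 <= \sum_i nm (x i) ^+ 2.
Proof.
rewrite -lecR rmorphXn /= -nmE rmorph_sum; apply: le_trans (F_row x) _.
by apply: ler_sum => i _; rewrite rmorphXn /= -nmE.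
Qed.

Lemma row_contraction_words k (x : word n -> H) :
  nm (wsum k (fun a => opword F a (x a))) ^+ 2 <= wsum k (fun a => nm (x a) ^+ 2).
Proof.
elim: k x => [|k IHk] x; first by rewrite !wsum0.
rewrite !wsumS (eq_bigr (fun i => F i (wsum k (fun a => opword F a (x (i :: a)))))); last first.
  by move=> i _; rewrite /wsum lin_sum //; exact: bounded_linear.
by apply: le_trans (row_contraction_sqr _) _; apply: ler_sum => i _; exact: IHk.
Qed.

(** The norm of the degree-k part of psi in the Fock space. *)
Definition coef2 psi k : R := Num.sqrt (wsum k (fun a => nm (psi a) ^+ 2)).

Lemma coef2_ge0 psi k : 0 <= coef2 psi k. Proof. exact: sqrtr_ge0. Qed.

Lemma coef2_sqr psi k : coef2 psi k ^+ 2 = wsum k (fun a => nm (psi a) ^+ 2).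
Proof. by rewrite sqr_sqrtr // wsum_ge0 // => a; exact: sqr_ge0. Qed.

Lemma hpart_le psi k x : nm (hpart psi F k x) <= coef2 psi k * nm x.
Proof.
apply: le_of_sqr; first by rewrite mulr_ge0 ?coef2_ge0 ?nm_ge0.
have -> : hpart psi F k x = wsum k (fun a => opword F a (psi a *: x)).
  by apply: eq_wsum => a _; rewrite linZ //; exact/bounded_linear/bounded_opword.
apply: le_trans (row_contraction_words _ _) _; rewrite exprMn coef2_sqr -wsum_mull.
by apply: wsum_ler => a _; rewrite nmZ exprMn.
Qed.

Lemma psum_range_le psi i d x :
  nm (psum psi F (i + d) x - psum psi F i x) <= (\sum_(k < d) coef2 psi (i + k)) * nm x.
Proof.
rewrite !psumE big_split_ord /= addrAC subrr add0r mulr_suml.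
by apply: le_trans (nm_sum _ _ _) _; apply: ler_sum => k _; exact: hpart_le.
Qed.

(** The words of length k in a row contraction form a row contraction again, so the
    degree-k part of psi(F) has norm at most [coef2 psi k]. *)
Lemma series_row_contraction psi (M : R) : (forall N, \sum_(k < N) coef2 psi k <= M) ->
  exists A, [/\ bounded_op A, ncvg \oo (psum psi F) A & opb M A].
Proof.
move=> psiM.
have [|//|l l1 l2] := @monotone_bounded_tends R (fun N => \sum_(k < N) coef2 psi k) M.
  by move=> k; rewrite big_ord_recr lerDl coef2_ge0.
have [|e e0|A Ab FA] := @op_complete _ _ _ (psum psi F).
- by move=> k; exact: bounded_psum.
- have [N Ne] := l2 _ e0; exists N.
  have tail i d : (N <= i)%N -> opb e (psum psi F (i + d) - psum psi F i).
    move=> Ni x; apply: le_trans (psum_range_le _ _ _ _) _.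
    rewrite ler_wpM2r ?nm_ge0 //.
    have := l1 (i + d)%N; rewrite big_split_ord /=; have := Ne _ Ni; lra.
  move=> i j Ni Nj; have [ij|/ltnW ji] := leqP i j.
    by rewrite -(subnKC ij) -opprB; apply: opbN; exact: tail.
  by rewrite -(subnKC ji); exact: tail.
exists A; split=> //; apply: (ncvg_opb FA); apply: nearW => N x.
have := psum_range_le psi 0 N x; rewrite add0n [psum psi F 0 x]psumE big_ord0 subr0 => /le_trans; apply.
by rewrite ler_wpM2r ?nm_ge0.
Qed.

End RowContractions.

Section OrthonormalBasis.
Context {R : realType} {n : nat} {E : hilbertType R}.
Variables (e : word n -> E) (e_basis : orthonormal_basis e).

Lemma e_dot a b : hdot (e a) (e b) = (a == b)%:R.
Proof. by case: e_basis => ->. Qed.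

Lemma e_span : closed_span (range e) = setT.
Proof. by case: e_basis. Qed.

Lemma coords_inj x y : (forall a, coords e x a = coords e y a) -> x = y.
Proof. by move=> xy; exact: (dot_eq_span e_span). Qed.

Lemma coords_e a b : coords e (e a) b = (b == a)%:R.
Proof. by rewrite /coords e_dot eq_sym. Qed.

Lemma coords_lin (c : R[i]) x y a : coords e (c *: x + y) a = c * coords e x a + coords e y a.
Proof. by rewrite /coords dotDl dotZl. Qed.

Lemma bessel x k : wsum k (fun a => nm (coords e x a) ^+ 2) <= nm x ^+ 2.
Proof.
pose y := wsum k (fun a => coords e x a *: e a).
set S := wsum k _.
have yx : complex.Re (hdot x y) = S.
  rewrite /y /wsum dot_sumr cRe_sum; apply: eq_bigr => a _.
  by rewrite dotZr mulrC -sqr_nm.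
have yy : nm y ^+ 2 = S.
  rewrite nm_sqr_Re {1}/y /wsum dot_suml cRe_sum; apply: eq_bigr => a _.
  rewrite dotZl /y /wsum dot_sumr (bigD1 a) //= big1 => [|b ba]; last first.
    by rewrite dotZr e_dot (_ : (_ == _) = false) ?mulr0 //; rewrite eq_sym; apply/negbTE.
  by rewrite addr0 dotZr e_dot eqxx mulr1 -sqr_nm.
by have := sqr_ge0 (nm (x - y)); rewrite nm_sqrB yx yy; lra.
Qed.

(** Stated on coefficients, so that vectors of E need not be series themselves. *)
Definition mult (A : E -> E) (psi : ncseries R n) : Prop :=
  bounded_op A /\ forall x, coords e (A x) = pmul psi (coords e x).

Implicit Types (psi phi : ncseries R n) (A B : E -> E).

Lemma mult_unique A B psi : mult A psi -> mult B psi -> A = B.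
Proof. by move=> [_ Ap] [_ Bp]; apply/funext => x; apply: coords_inj => a; rewrite Ap Bp. Qed.

Lemma pmul_coords_nil psi : pmul psi (coords e (e [::])) = psi.
Proof.
apply/funext => b; rewrite /pmul big_ord_recr /= big1 => [|k _].
  by rewrite take_size drop_size coords_e eqxx mulr1 add0r.
rewrite coords_e -size_eq0 size_drop subn_eq0 leqNgt ltn_ord mulr0 //.
Qed.

Lemma mult_e0 A psi : mult A psi -> coords e (A (e [::])) = psi.
Proof. by move=> [_ ->]; exact: pmul_coords_nil. Qed.

Lemma mult_id : mult id pone.
Proof. by split; [exact: bounded_id | move=> x; apply/funext => b; rewrite pmul1]. Qed.

Lemma mult_comp A B psi phi : mult A psi -> mult B phi -> mult (A \o B) (pmul psi phi).
Proof.
move=> [Ab Ap] [Bb Bp]; split; first exact: bounded_comp.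
by move=> x; apply/funext => b; rewrite /= Ap Bp pmulA.
Qed.

Lemma mult_lin (c : R[i]) A B psi phi : mult A psi -> mult B phi ->
  mult (c *: A + B) (fun a => c * psi a + phi a).
Proof.
move=> [Ab Ap] [Bb Bp]; split; first exact: boundedP_lin.
move=> x; apply/funext => b; rewrite (_ : (c *: A + B) x = c *: A x + B x) //.
by rewrite coords_lin Ap Bp pmulDl pmulZl.
Qed.

Lemma mult0 : mult 0 (fun=> 0).
Proof.
split; first exact: bounded0; move=> x; apply/funext => b.
by rewrite /coords dot0l /pmul big1 // => k _; rewrite mul0r.
Qed.

Lemma mult_sum (I : Type) (r : seq I) (P : pred I) (A : I -> E -> E) (psi : I -> ncseries R n) :
  (forall i, P i -> mult (A i) (psi i)) ->
  mult (\sum_(i <- r | P i) A i) (fun a => \sum_(i <- r | P i) psi i a).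
Proof.
move=> Ap; elim: r => [|i r IHr].
  rewrite big_nil (_ : (fun a => _) = fun=> 0); first exact: mult0.
  by apply/funext => a; rewrite big_nil.
rewrite big_cons; case: ifP => Pi.
  have := mult_lin 1 (Ap i Pi) IHr; rewrite scale1r.
  by congr mult; apply/funext => a; rewrite big_cons Pi mul1r.
by move: IHr; congr mult; apply/funext => a; rewrite big_cons Pi.
Qed.

Lemma multZ (c : R[i]) A psi : mult A psi -> mult (c *: A) (fun a => c * psi a).
Proof.
move=> Ap; have := mult_lin c Ap mult0; rewrite addr0.
by congr mult; apply/funext => a; rewrite addr0.
Qed.

Lemma multB A B psi phi : mult A psi -> mult B phi -> mult (A - B) (fun a => psi a - phi a).
Proof.
move=> Ap Bp; have := mult_lin (-1) Bp Ap; rewrite scaleN1r addrC.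
by congr mult; apply/funext => a; rewrite mulN1r addrC.
Qed.

Lemma mult_opword (Y : 'I_n -> E -> E) (g : 'I_n -> ncseries R n) a :
  (forall i, mult (Y i) (g i)) -> mult (opword Y a) (pword g a).
Proof.
by move=> Yg; elim: a => [|i a IHa]; [exact: mult_id | exact: mult_comp].
Qed.

Lemma mult_psum (Y : 'I_n -> E -> E) (g : 'I_n -> ncseries R n) psi m :
  (forall i, mult (Y i) (g i)) -> mult (psum psi Y m) (pcomp_upto m psi g).
Proof.
move=> Yg; apply: mult_sum => k _; apply: mult_sum => a _; apply: multZ.
exact: mult_opword.
Qed.

(** Only the suffixes of b see the coefficient at b, so a bounded operator that
    acts as a left multiplication on the basis does so everywhere. *)
Lemma mult_basis A psi : bounded_op A ->
  (forall a b, coords e (A (e a)) b = pmul psi (coords e (e a)) b) -> mult A psi.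
Proof.
move=> Ab Ae; split=> // x; apply/funext => b.
have -> : coords e (A x) b = hdot x (adj A (e b)) by rewrite /coords adjP.
have -> : adj A (e b) = \sum_(k < (size b).+1) Num.conj (psi (take k b)) *: e (drop k b).
  apply: coords_inj => a; rewrite /coords adjPl // dotC -[hdot _ _]/(coords e _ _) Ae.
  rewrite /pmul rmorph_sum dot_suml; apply: eq_bigr => k _.
  by rewrite rmorphM coords_e dotZl e_dot; case: eqP => _; rewrite ?rmorph1 ?rmorph0.
by rewrite dot_sumr; apply: eq_bigr => k _; rewrite dotZr conjCK.
Qed.

Lemma tends_coords (I : Type) (F : set_system I) {FF : Filter F} (u : I -> E) l a :
  tends F u l -> tends F (fun t => coords e (u t) a) (coords e l a).
Proof. exact: tends_dotl. Qed.

Section Creation.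
Variables (L : 'I_n -> E -> E) (Lb : forall i, bounded_op (L i)).
Hypothesis Le : forall i a, L i (e a) = e (i :: a).

Lemma mult_creation i : mult (L i) (pvar i).
Proof.
apply: mult_basis => // a b; rewrite Le coords_e pmul_pvar.
case: b => [|j b] //; by rewrite coords_e eqseq_cons -mulnb natrM.
Qed.

Lemma adj_creation i j x : adj (L i) (L j x) = (i == j)%:R *: x.
Proof.
have E0 : adj (L i) \o L j = (i == j)%:R *: id.
  apply: (bounded_eq_span _ _ e_span).
  - by apply: bounded_comp => //; exact: bounded_adj.
  - by apply: boundedZ; exact: bounded_id.
  move=> a; apply: coords_inj => b; rewrite /= /coords adjPl // !Le e_dot eqseq_cons.
  rewrite (_ : ((i == j)%:R *: id) (e a) = (i == j)%:R *: e a) // dotZl e_dot.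
  by rewrite [j == i]eq_sym -mulnb natrM.
by rewrite -[LHS]/((adj (L i) \o L j) x) E0.
Qed.

End Creation.

End OrthonormalBasis.

Section RowIsometries.
Context {R : realType} {n : nat} {K : hilbertType R}.
Variables (W : 'I_n -> K -> K) (Wb : forall i, bounded_op (W i)).
Hypothesis W_iso : forall i j x, adj (W i) (W j x) = (i == j)%:R *: x.

Lemma row_iso_dot i j x y : hdot (W i x) (W j y) = (i == j)%:R * hdot x y.
Proof.
by rewrite adjP // W_iso dotZr; case: (i == j); rewrite ?rmorph1 ?rmorph0.
Qed.

Lemma row_iso_contraction : row_contraction W.
Proof.
move=> x; rewrite le_eqVlt; apply/orP; left; apply/eqP.
rewrite normr_hdot dot_suml; apply: eq_bigr => i _.
rewrite dot_sumr (bigD1 i) //= big1 => [|j ji]; last first.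
  by rewrite row_iso_dot eq_sym (negbTE ji) mul0r.
by rewrite addr0 row_iso_dot eqxx mul1r normr_hdot.
Qed.

End RowIsometries.

Section FockSeries.
Context {R : realType} {n : nat} {E : hilbertType R}.
Variables (e : word n -> E) (e_basis : orthonormal_basis e).
Variables (L : 'I_n -> E -> E) (Lb : forall i, bounded_op (L i)).
Hypothesis Le : forall i a, L i (e a) = e (i :: a).

Lemma pcomp_pvar m (psi : ncseries R n) b :
  pcomp_upto m psi (@pvar R n) b = if (size b < m)%N then psi b else 0.
Proof.
rewrite pcompE; case: ltnP => bm.
  rewrite (bigD1 (Ordinal bm)) //= [X in _ + X]big1 ?addr0 => [|k kb].
    rewrite (@wsum_pred1 _ _ _ b) // ?pword_pvar ?eqxx ?mulr1 // => a _ ab.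
    by rewrite pword_pvar (_ : (b == a) = false) ?mulr0 //; apply/eqP => /esym.
  apply: wsum_eq0 => a ak; rewrite pword_pvar (_ : (b == a) = false) ?mulr0 //.
  by apply/eqP => ba; move/eqP: kb; apply; apply: val_inj; rewrite /= -ak ba.
rewrite big1 // => k _; apply: wsum_eq0 => a ak.
rewrite pword_pvar (_ : (b == a) = false) ?mulr0 //.
by apply/eqP => ba; move: bm; rewrite ba ak leqNgt ltn_ord.
Qed.

(** Each coefficient of psi(L) x involves finitely many coefficients of psi, so
    the norm limit acts as the product does. *)
Lemma mult_series psi (M : R) : (forall N, \sum_(k < N) coef2 psi k <= M) ->
  exists A, [/\ mult e A psi, ncvg \oo (psum psi L) A & opb M A].
Proof.
move=> psiM; have Lrow := row_iso_contraction Lb (adj_creation e_basis Lb Le).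
have [A [Ab LA AM]] := series_row_contraction Lb Lrow psiM.
exists A; split=> //; split=> // x; apply/funext => b.
apply: (tends_unique (tends_coords e b (ncvg_tends x LA))).
apply: tends_near (tends_cst _); exists (size b).+1 => // m /= bm.
have [_ ->] := mult_psum psi m (mult_creation e_basis Lb Le).
apply: eq_bigr => k _; rewrite pcomp_pvar size_take_min.
by rewrite (leq_ltn_trans (geq_minr _ _) bm).
Qed.

Lemma mult_opb A psi (M : R) : mult e A psi ->
  (forall N, \sum_(k < N) coef2 psi k <= M) -> opb M A.
Proof.
move=> Ap psiM; have [B [Bp _ BM]] := mult_series psiM.
by rewrite (mult_unique e_basis Ap Bp).
Qed.

Lemma mult_ncvg A psi (M : R) : mult e A psi ->
  (forall N, \sum_(k < N) coef2 psi k <= M) -> ncvg \oo (psum psi L) A.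
Proof.
move=> Ap psiM; have [B [Bp LB _]] := mult_series psiM.
by rewrite (mult_unique e_basis Ap Bp).
Qed.

(** Bessel's inequality for the value of A at the vacuum vector. *)
Lemma coef2_mult A psi (M : R) k : mult e A psi -> 0 <= M -> opb M A -> coef2 psi k <= M.
Proof.
move=> Ap M0 AM; apply: le_of_sqr => //; rewrite coef2_sqr.
rewrite -(mult_e0 e_basis Ap); apply: le_trans (bessel e_basis _ _) _.
rewrite lerXn2r ?nnegrE ?nm_ge0 //; apply: le_trans (AM _) _.
have -> : nm (e [::]) = 1; last by rewrite mulr1.
apply/eqP; rewrite -(@eqrXn2 _ 2) ?nm_ge0 ?ler01 // nm_sqr_Re (e_dot e_basis) eqxx.
by rewrite expr1n.
Qed.

End FockSeries.

(** * Orthonormal lists *)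

Section GramSchmidt.
Context {R : realType} {H : hilbertType R}.
Implicit Types (t s : seq H) (x y : H).

Definition ortho t := forall i j, (i < size t)%N -> (j < size t)%N ->
  hdot t`_i t`_j = (i == j)%:R.

Definition residue t x := x - \sum_(i < size t) hdot x t`_i *: t`_i.

Lemma residue_ortho t x j : ortho t -> (j < size t)%N -> hdot (residue t x) t`_j = 0.
Proof.
move=> t1 jt; rewrite dotBl dot_suml (bigD1 (Ordinal jt)) //= big1 => [|i ij].
  by rewrite addr0 dotZl t1 // eqxx mulr1 subrr.
by rewrite dotZl t1 // (_ : (i == j :> nat) = false) ?mulr0 //; apply/negbTE.
Qed.

Lemma ortho_cons t x : ortho t -> residue t x != 0 ->
  ortho (((nm (residue t x))^-1)%:C *: residue t x :: t).
Proof.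
move=> t1 y0; set y := residue t x in y0 *.
have yn : nm y != 0 by apply: contra_neq y0; exact: nm_eq0.
have yt j : (j < size t)%N -> hdot y t`_j = 0 by exact: residue_ortho.
move=> [|i] [|j] /=; rewrite ?ltnS => it jt //.
- rewrite dotZl dotZr conj_real dotxx mulrA -!rmorphM /= expr2 mulrA.
  by rewrite -mulrA mulrACA mulVf // mulr1.
- by rewrite dotZl yt // mulr0.
- by rewrite dotZr dotC yt // rmorph0 mulr0.
by rewrite t1 // eqSS.
Qed.

Lemma gram_schmidt s : exists2 t, ortho t &
  forall x, x \in s -> x = \sum_(i < size t) hdot x t`_i *: t`_i.
Proof.
elim: s => [|x s [t t1 ts]]; first by exists [::].
have [y0|y0] := eqVneq (residue t x) 0.
  exists t => // u; rewrite inE => /predU1P[->|/ts //].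
  by apply/eqP; rewrite -subr_eq0; apply/eqP.
exists (((nm (residue t x))^-1)%:C *: residue t x :: t); first exact: ortho_cons.
have yn : nm (residue t x) != 0 by apply: contra_neq y0; exact: nm_eq0.
have ry : hdot x (residue t x) = (nm (residue t x) ^+ 2)%:C.
  rewrite -dotxx {2}/residue dotBl dot_suml big1 ?subr0 // => i _.
  by rewrite dotZl [hdot t`_i _]dotC residue_ortho // rmorph0 mulr0.
move=> u; rewrite inE => /predU1P[->|us]; rewrite big_ord_recl /=.
  rewrite dotZr conj_real ry scalerA -!rmorphM /=.
  have -> : (nm (residue t x))^-1 * nm (residue t x) ^+ 2 * (nm (residue t x))^-1 = 1.
    by field.
  by rewrite scale1r {1}/residue subrK.
have ur : hdot u (residue t x) = 0.
  rewrite (ts u us) dot_suml big1 // => i _.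
  by rewrite dotZl [hdot t`_i _]dotC residue_ortho // rmorph0 mulr0.
by rewrite dotZr ur mulr0 scale0r add0r; exact: ts.
Qed.

Lemma infinite_dim_ortho M : infinite_dim H -> exists2 t : seq H, ortho t & size t = M.
Proof.
move=> Hinf; elim: M => [|M [t t1 tM]]; first by exists [::].
have [x xt] := Hinf (size t) (fun i => t`_i).
have y0 : residue t x != 0.
  by apply/eqP => /eqP; rewrite subr_eq0 => /eqP; exact: xt.
by exists (((nm (residue t x))^-1)%:C *: residue t x :: t); [exact: ortho_cons | rewrite /= tM].
Qed.

End GramSchmidt.

(** * The three kinds of models *)

Section Weights.
Context {R : realType} {n : nat}.
Implicit Types (w : 'I_n -> R) (psi s : ncseries R n) (f g : 'I_n -> ncseries R n).

Lemma sum_cauchy_schwarz (I : Type) (r : seq I) (a b : I -> R) :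
  (forall i, 0 <= a i) -> (forall i, 0 <= b i) ->
  \sum_(i <- r) a i * b i <=
    Num.sqrt (\sum_(i <- r) a i ^+ 2) * Num.sqrt (\sum_(i <- r) b i ^+ 2).
Proof.
move=> a0 b0.
set A := \sum_(i <- r) a i ^+ 2; set B := \sum_(i <- r) b i ^+ 2.
set P := \sum_(i <- r) a i * b i.
have A0 : 0 <= A by apply: sumr_ge0 => i _; exact: sqr_ge0.
have B0 : 0 <= B by apply: sumr_ge0 => i _; exact: sqr_ge0.
have P0 : 0 <= P by apply: sumr_ge0 => i _; exact: mulr_ge0.
have key t : 0 <= A - 2 * t * P + t ^+ 2 * B.
  have -> : A - 2 * t * P + t ^+ 2 * B = \sum_(i <- r) (a i - t * b i) ^+ 2.
    rewrite /A /B /P !mulr_sumr -sumrB -big_split; apply: eq_bigr => i _ /=; ring.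
  by apply: sumr_ge0 => i _; exact: sqr_ge0.
rewrite -sqrtrM //; apply: le_of_sqr; rewrite ?sqrtr_ge0 // sqr_sqrtr ?mulr_ge0 //.
have [Bz|Bz] := eqVneq B 0.
  have [Pz|Pz] := eqVneq P 0; first by rewrite Pz expr0n mulr_ge0.
  have := key ((A + 1) / (2 * P)); rewrite Bz mulr0 addr0.
  have -> : 2 * ((A + 1) / (2 * P)) * P = A + 1 by field.
  by lra.
have := key (P / B).
have -> : A - 2 * (P / B) * P + (P / B) ^+ 2 * B = A - P ^+ 2 / B by field.
by rewrite subr_ge0 ler_pdivrMr // lt_neqAle eq_sym Bz.
Qed.

Lemma wsum_wpow2 w k : wsum k (fun a => wpow w a ^+ 2) = (\sum_i w i ^+ 2) ^+ k.
Proof.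
elim: k => [|k IHk]; first by rewrite wsum0 /wpow big_nil expr1n expr0.
rewrite wsumS exprS mulr_suml; apply: eq_bigr => i _.
by rewrite -IHk -wsum_mulr; apply: eq_wsum => a _; rewrite wpow_cons exprMn.
Qed.

(** Cauchy-Schwarz in each degree: the squared weights of the words of length k sum
    to the k-th power of a number below 1. *)
Lemma wsummable_ell2 w (c : ncseries R n) (M : R) : 0 <= M -> (forall i, 0 <= w i) ->
  \sum_i w i ^+ 2 < 1 -> (forall k, coef2 c k <= M) -> wsummable w c.
Proof.
move=> M0 w0 w1 cM; exists M, (Num.sqrt (\sum_i w i ^+ 2)).
have W0 : 0 <= \sum_i w i ^+ 2 by apply: sumr_ge0 => i _; exact: sqr_ge0.
split=> //; first by rewrite sqrtr_ge0 -[X in _ < X]sqrtr1 ltr_sqrt.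
move=> k; apply: le_trans (sum_cauchy_schwarz _ _ _) _ => [a|a|].
- exact: nm_ge0.
- exact: wpow_ge0.
apply: ler_pM; rewrite ?sqrtr_ge0 //; first exact: cM.
rewrite -[X in Num.sqrt X]/(wsum k (fun a => wpow w a ^+ 2)) wsum_wpow2.
apply: le_of_sqr; first by rewrite exprn_ge0 ?sqrtr_ge0.
by rewrite sqr_sqrtr ?exprn_ge0 // -exprM mulnC exprM sqr_sqrtr.
Qed.

Lemma wsummable_poly w (c : ncseries R n) N : (forall i, 0 <= w i) -> deg_lt N c -> wsummable w c.
Proof.
move=> w0 cN; pose s k := wsum k (fun a => nm (c a) * wpow w a).
have s0 k : 0 <= s k by apply: wsum_ge0 => a; rewrite mulr_ge0 ?nm_ge0 ?wpow_ge0.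
have C0 : 0 <= \sum_(k < N) s k * 2 ^+ k.
  by apply: sumr_ge0 => k _; rewrite mulr_ge0 ?exprn_ge0.
exists (\sum_(k < N) s k * 2 ^+ k), 2^-1; split=> //.
  by rewrite invr_ge0 ler0n invf_lt1 // ltr1n.
move=> k; rewrite -/(s k); have [kN|Nk] := ltnP k N.
  rewrite exprVn ler_pdivlMr ?exprn_gt0 // (bigD1 (Ordinal kN)) //= lerDl.
  by apply: sumr_ge0 => j _; rewrite mulr_ge0 ?exprn_ge0.
rewrite /s wsum_eq0 => [|a ak]; last by rewrite cN ?ak // nm0 mul0r.
by rewrite mulr_ge0 ?exprn_ge0 ?invr_ge0.
Qed.

Lemma weight_room (p : 'I_n -> R) : (forall i, 0 <= p i) -> \sum_i p i ^+ 2 < 1 ->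
  exists2 dl : R, 0 < dl & \sum_i (p i + dl) ^+ 2 < 1.
Proof.
move=> p0 p1; pose B := \sum_i p i.
have B0 : 0 <= B by apply: sumr_ge0.
pose D : R := 2 * B + n%:R + 1.
have Dp : 0 < D by rewrite /D; have : (0 : R) <= n%:R by []; lra.
pose dl := Num.min 1 ((1 - \sum_i p i ^+ 2) / (2 * D)).
have dl0 : 0 < dl by rewrite lt_min ltr01 divr_gt0 ?subr_gt0 ?mulr_gt0.
exists dl => //.
have -> : \sum_i (p i + dl) ^+ 2 = \sum_i p i ^+ 2 + 2 * dl * B + n%:R * dl ^+ 2.
  have -> : n%:R * dl ^+ 2 = \sum_(i < n) dl ^+ 2 by rewrite sumr_const card_ord mulr_natl.
  rewrite /B mulr_sumr -!big_split.
  by apply: eq_bigr => i _ /=; ring.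
have d1 : dl <= 1 by rewrite ge_min lexx.
have : dl <= (1 - \sum_i p i ^+ 2) / (2 * D) by rewrite ge_min lexx orbT.
rewrite ler_pdivlMr ?mulr_gt0 // => dD.
have h : n%:R * dl ^+ 2 <= n%:R * dl by rewrite ler_wpM2l // expr2 ler_piMl // ltW.
move: dD; rewrite /D; set s := \sum_i p i ^+ 2 in p1 *.
have : 0 <= (n%:R : R) by []; have : 0 <= dl * B by rewrite mulr_ge0 // ltW.
have : 0 <= dl * n%:R by rewrite mulr_ge0 // ltW.
by nra.
Qed.

Lemma wsum_cat (V : nmodType) k l (F : word n -> V) :
  wsum (k + l) F = wsum k (fun a => wsum l (fun b => F (a ++ b))).
Proof.
elim: k F => [|k IHk] F; first by rewrite wsum0.
by rewrite addSn !wsumS; apply: eq_bigr => i _; rewrite IHk.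
Qed.

Definition unit_at (a : word n) : ncseries R n := fun b => (b == a)%:R.

Lemma pmul_unit psi (a c d : word n) : size d = size a ->
  pmul psi (unit_at a) (c ++ d) = psi c * (d == a)%:R.
Proof.
move=> da; rewrite /pmul.
have kc : (size c < (size (c ++ d)).+1)%N by rewrite size_cat ltnS leq_addr.
rewrite (bigD1 (Ordinal kc)) //= take_size_cat // drop_size_cat // big1 ?addr0 // => k kk.
rewrite /unit_at (_ : (drop k (c ++ d) == a) = false) ?mulr0 //; apply/eqP => E.
move/eqP: kk; apply; apply: val_inj => /=.
have h : (size c + size d - k)%N = size a by rewrite -size_cat -size_drop E.
have kl : (k <= size c + size d)%N by rewrite -size_cat -ltnS.
apply/eqP; rewrite -(eqn_add2r (size a)) -{1}h subnKC //.
by rewrite da.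
Qed.

Lemma pmul_unit_small psi a b : (size b < size a)%N -> pmul psi (unit_at a) b = 0.
Proof.
move=> ba; rewrite /pmul big1 // => k _.
rewrite /unit_at (_ : (drop k b == a) = false) ?mulr0 //; apply/eqP => E.
by have := ba; rewrite -E size_drop ltnNge leq_subr.
Qed.

Lemma wsum_pmul_unit (S : pzSemiRingType) psi a k (G : R[i] -> word n -> S) :
  (forall b, G 0 b = 0) ->
  wsum k (fun b => G (pmul psi (unit_at a) b) b) =
  if (size a <= k)%N then wsum (k - size a) (fun c => G (psi c) (c ++ a)) else 0.
Proof.
move=> G0; case: leqP => ak; last by apply: wsum_eq0 => b bk; rewrite pmul_unit_small ?G0 ?bk.
rewrite -{1}(subnK ak) wsum_cat; apply: eq_wsum => c _.
rewrite (@wsum_pred1 _ _ _ a) // => [|d da ne].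
  by rewrite pmul_unit // eqxx mulr1.
by rewrite pmul_unit // (_ : (d == a) = false) ?mulr0 //; apply/eqP.
Qed.

Lemma wsummable_pmul_unit w psi a : (forall i, 0 <= w i) -> wsummable w psi ->
  wsummable w (pmul psi (unit_at a)).
Proof.
move=> w0 [C [rho [C0 /andP[r0 r1] pC]]].
pose r := Num.max rho 2^-1.
have r_gt0 : 0 < r by rewrite lt_max invr_gt0 ltr0n orbT.
have r_lt1 : r < 1 by rewrite gt_max r1 invf_lt1 // ltr1n.
exists (C * wpow w a / r ^+ size a), r; split.
- by rewrite !mulr_ge0 ?invr_ge0 ?exprn_ge0 ?wpow_ge0 // ltW.
- by rewrite ltW.
move=> k; rewrite (wsum_pmul_unit psi a k (G := fun x b => nm x * wpow w b)); last first.
  by move=> b; rewrite nm0 mul0r.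
case: leqP => ak; last by rewrite !mulr_ge0 ?invr_ge0 ?exprn_ge0 ?wpow_ge0 // ltW.
under eq_wsum do rewrite wpow_cat mulrA.
rewrite wsum_mull; apply: (@le_trans _ _ (C * r ^+ (k - size a) * wpow w a)).
  rewrite ler_wpM2r ?wpow_ge0 //; apply: le_trans (pC _) _.
  by rewrite ler_wpM2l // lerXn2r ?nnegrE ?(ltW r_gt0) // le_max lexx.
rewrite -{2}(subnK ak) exprD le_eqVlt; apply/orP; left; apply/eqP.
by field; rewrite expf_neq0 // gt_eqF.
Qed.

Lemma pcomp_pmul_unit f psi a b m :
  pcomp_upto (m + size a) (pmul psi (unit_at a)) f b =
  pmul (pcomp_upto m psi f) (pword f a) b.
Proof.
rewrite pcompE addnC big_split_ord /= [X in X + _]big1 ?add0r => [|k _]; last first.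
  by apply: wsum_eq0 => d dk; rewrite pmul_unit_small ?mul0r // dk.
transitivity (\sum_(k < m) wsum k (fun c => psi c * pword f (c ++ a) b)).
  apply: eq_bigr => k _.
  rewrite (wsum_pmul_unit psi a _ (G := fun x d => x * pword f d b)) => [|d]; last exact: mul0r.
  by rewrite leq_addr addKn.
transitivity (\sum_(k < m) \sum_(j < (size b).+1)
    wsum k (fun c => psi c * pword f c (take j b)) * pword f a (drop j b)).
  apply: eq_bigr => k _.
  transitivity (wsum k (fun c => \sum_(j < (size b).+1)
     psi c * pword f c (take j b) * pword f a (drop j b))).
    apply: eq_wsum => c _; rewrite pword_cat /pmul mulr_sumr.
    by apply: eq_bigr => j _; rewrite mulrA.
  by rewrite wsum_exchange; apply: eq_bigr => j _; rewrite wsum_mull.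
by rewrite exchange_big; apply: eq_bigr => j _ /=; rewrite -mulr_suml.
Qed.

Lemma tends_shift (V : normedZmodType R[i]) (u : nat -> V) l N :
  tends \oo (fun m => u (m + N)%N) l -> tends \oo u l.
Proof.
move=> ul e /ul[M _ uM]; exists (M + N)%N => // m /= Mm.
have Nm : (N <= m)%N by exact: leq_trans (leq_addl _ _) Mm.
by have := uM (m - N)%N; rewrite /= subnK //; apply; rewrite leq_subRL // addnC.
Qed.

(** In coordinates, right multiplication by f_a is right multiplication by Z_a. *)
Lemma tends_pcomp_pmul_unit f psi s a b :
  (forall b, tends \oo (fun m => pcomp_upto m psi f b) (s b)) ->
  tends \oo (fun m => pcomp_upto m (pmul psi (unit_at a)) f b) (pmul s (pword f a) b).
Proof.
move=> ps; apply: (tends_shift (N := size a)).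
apply: (@tends_eq _ _ _ _ (fun m => pmul (pcomp_upto m psi f) (pword f a) b)).
  by move=> m; rewrite pcomp_pmul_unit.
apply: tends_sum => k _; rewrite mulrC.
by apply: tends_eq (tendsM _ (ps (take k b))) => m; rewrite mulrC.
Qed.

Lemma pcomp_unit f a m b :
  pcomp_upto m (unit_at a) f b = if (size a < m)%N then pword f a b else 0.
Proof.
rewrite pcompE; case: ltnP => am.
  rewrite (bigD1 (Ordinal am)) //= [X in _ + X]big1 ?addr0 => [|k ka].
    rewrite (@wsum_pred1 _ _ _ a) // /unit_at ?eqxx ?mul1r // => d _ da.
    by rewrite (_ : (d == a) = false) ?mul0r //; apply/eqP.
  apply: wsum_eq0 => d dk; rewrite /unit_at (_ : (d == a) = false) ?mul0r //.
  by apply/eqP => da; move/eqP: ka; apply; apply: val_inj; rewrite /= -dk da.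
rewrite big1 // => k _; apply: wsum_eq0 => d dk.
rewrite /unit_at (_ : (d == a) = false) ?mul0r //.
by apply/eqP => da; move: am; rewrite -da dk leqNgt ltn_ord.
Qed.

End Weights.

(** What every model amounts to: f_j(M_Z) is the creation operator L_j, and
    M_(Z_i) is left multiplication by g_i. *)
Definition fock_model (R : realType) (n : nat) (E : hilbertType R)
    (f : 'I_n -> ncseries R n) (e : word n -> E) (z : 'I_n -> E)
    (MZ L : 'I_n -> E -> E) : Prop :=
  [/\ orthonormal_basis e, forall i, bounded_op (L i),
      forall i a, L i (e a) = e (i :: a), evals f MZ L &
      forall i, mult e (MZ i) (inverse_series e z i)].

Section Models.
Context {R : realType} {n : nat} {E : hilbertType R}.
Variables (f : 'I_n -> ncseries R n) (e : word n -> E) (z : 'I_n -> E).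
Variable MZ : 'I_n -> E -> E.
Hypothesis e_basis : orthonormal_basis e.

Let g := inverse_series e z.

Lemma coords_unit a : coords e (e a) = unit_at a.
Proof. by apply/funext => b; rewrite coords_e. Qed.

(** If A multiplies series in f by s and psi o f = s, then the coordinates of A e_a
    compose with f to s f_a, as those of psi Z_a do; compositions with f are
    unique. *)
Lemma mult_of_composition (w : 'I_n -> R) (A : E -> E) (psi s : ncseries R n) :
  formal_left_inverse f g -> (exists2 dl : R, 0 < dl & forall i, nm (f i [::]) + dl <= w i) ->
  bounded_op A -> wsummable w psi ->
  (forall b, tends \oo (fun m => pcomp_upto m psi f b) (s b)) ->
  (forall a, wsummable w (coords e (A (e a)))) ->
  (forall a b, tends \oo (fun m => pcomp_upto m (coords e (A (e a))) f b)
     (pmul s (pword f a) b)) ->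
  mult e A psi.
Proof.
move=> gf dlw Ab ps pf As Af; apply: mult_basis => // a b; rewrite coords_unit.
congr (_ b); apply: (composition_unique gf dlw) (Af a) _ => //.
  apply: wsummable_pmul_unit => // i; have [dl dl0 h] := dlw.
  by apply: le_trans (h i); rewrite addr_ge0 ?nm_ge0 // ltW.
by move=> d; exact: tends_pcomp_pmul_unit.
Qed.

Lemma mult_pvar_creation (A : E -> E) i a : mult e A (pvar i) -> A (e a) = e (i :: a).
Proof.
move=> [_ Ap]; apply: (coords_inj e_basis) => b; rewrite Ap pmul_pvar (coords_e e_basis).
by case: b => [|j b] //; rewrite (coords_e e_basis) eqseq_cons -mulnb natrM.
Qed.

Lemma coef2_coords x k : coef2 (coords e x) k <= nm x.
Proof.
by apply: le_of_sqr; rewrite ?nm_ge0 // coef2_sqr; exact: bessel.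
Qed.

(** As f(0) lies in the open unit ball, square summable coefficients decay fast
    enough at f(0) for compositions with f to be unique; so M_Z and f(M_Z) are
    identified by what they do to series. *)
Lemma hardy_fock (Mf : 'I_n -> E -> E) :
  \sum_i nm (f i [::]) ^+ 2 < 1 ->
  (forall i b, tends \oo (fun m => pcomp_upto m (g i) f b) (pvar i b)) ->
  (forall i, bounded_op (MZ i)) -> (forall i, bounded_op (Mf i)) -> evals f MZ Mf ->
  (forall i a b, tends \oo (fun m => pcomp_upto m (coords e (MZ i (e a))) f b)
     (pmul (pvar i) (pword f a) b)) ->
  (forall i a b, tends \oo (fun m => pcomp_upto m (coords e (Mf i (e a))) f b)
     (pmul (f i) (pword f a) b)) ->
  exists L, fock_model f e z MZ L /\ formal_inverse f g.
Proof.
move=> p1 gf MZb Mfb fMZ MZe Mfe.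
have [dl dl0 w1] := weight_room (fun i => nm_ge0 (f i [::])) p1.
pose w i := nm (f i [::]) + dl.
have w0 i : 0 <= w i by rewrite addr_ge0 ?nm_ge0 // ltW.
have ws x : wsummable w (coords e x).
  by apply: (wsummable_ell2 (nm_ge0 x) w0 w1) => k; exact: coef2_coords.
have dlw : exists2 dl : R, 0 < dl & forall i, nm (f i [::]) + dl <= w i by exists dl.
have Mf_mult i : mult e (Mf i) (pvar i).
  apply: (mult_of_composition (s := f i) gf dlw) => //.
    by have -> : pvar i = coords e (e [:: i]); [rewrite coords_unit | exact: ws].
  move=> b; apply: tends_near (tends_cst _); exists 2 => // m /= m1.
  rewrite (_ : pvar i = unit_at [:: i]) // pcomp_unit m1 /=.
  have := pmul_coords_nil e_basis (f i); rewrite coords_unit => {1}<-.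
  by congr (pmul _ _ _); apply/funext.
exists Mf; split; last by split; [exact: gf | exists dl => // i; exact: ws].
split; [exact: e_basis | exact: Mfb | | exact: fMZ | move=> i].
  by move=> i a; exact: (mult_pvar_creation a (Mf_mult i)).
exact: (mult_of_composition gf dlw (MZb i) (ws (z i)) (gf i) (fun a => ws _) (MZe i)).
Qed.

(** Without constant terms in f each coefficient of a composition is a finite
    sum. *)
Lemma model_S_fock : model_S f e z MZ ->
  exists L, fock_model f e z MZ L /\ formal_inverse f g.
Proof.
move=> [[f0 _] _ gf [MZb MZf] [Mf fMZ Mff]].
have cf : centered f = f.
  by apply/funext => i; apply/funext => -[|j b] //=; rewrite f0.
have comp c b : tends \oo (fun m => pcomp_upto m c f b) (series_comp c f b).
  apply: tends_near (tends_cst _); exists (size b).+1 => // m /= bm.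
  rewrite /series_comp !pcompE -(subnKC bm) big_split_ord /= [X in _ = _ + X]big1 ?addr0 //.
  move=> k _; apply: wsum_eq0 => a ak; rewrite -cf pword_centered_small ?mulr0 // ak.
  by rewrite addSn ltnS leq_addr.
have unit a : series_comp (coords e (e a)) f = pword f a.
  apply/funext => b; rewrite /series_comp coords_unit pcomp_unit ltnS; case: leqP => // ba.
  by rewrite -cf pword_centered_small.
have Mfb i : bounded_op (Mf i) by case: fMZ => h; case: (h i).
apply: (hardy_fock (Mf := Mf)) => //.
- by rewrite big1 // => i _; rewrite f0 nm0 expr0n.
- by move=> i b; rewrite -[pvar i]gf; exact: comp.
- by move=> i a b; rewrite -unit -MZf; exact: comp.
- by move=> i a b; rewrite -unit -Mff; exact: comp.
Qed.

Lemma poly_tends (c s : ncseries R n) : poly_comp c f s ->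
  forall b, tends \oo (fun m => pcomp_upto m c f b) (s b).
Proof.
move=> [N cN <-] b; apply: tends_near (tends_cst _); exists N => // m /= Nm.
by rewrite (pcomp_stable _ _ cN Nm).
Qed.

Lemma psum_stable (Y : 'I_n -> E -> E) c N m : deg_lt N c -> (N <= m)%N ->
  psum c Y m = psum c Y N.
Proof.
move=> cN Nm; rewrite /psum -(subnKC Nm) big_split_ord /= [X in _ + X]big1 ?addr0 //.
move=> k _; rewrite big1 // => a _.
by rewrite cN ?scale0r // size_tuple leq_addr.
Qed.

(** The coordinates that occur are polynomials, which decay at every radius.
    Here f(M_Z) = L comes from f o q = id, as q = g by uniqueness. *)
Lemma model_A_fock : model_A f e z MZ ->
  exists L, fock_model f e z MZ L /\ formal_inverse f g.
Proof.
move=> [f_poly [q fq] gf MZb MZf].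
pose w i := nm (f i [::]) + 1.
have w0 i : 0 <= w i by rewrite addr_ge0 ?nm_ge0.
have dlw : exists2 dl : R, 0 < dl & forall i, nm (f i [::]) + dl <= w i by exists 1.
have poly_ws c s : poly_comp c f s -> wsummable w c.
  by move=> [N cN _]; exact: wsummable_poly cN.
have g_left : formal_left_inverse f g by move=> i b; exact: (poly_tends (gf i)).
have g_ws i : wsummable w (g i) by exact: poly_ws (gf i).
have unit a : poly_comp (coords e (e a)) f (pword f a).
  exists (size a).+1; rewrite coords_unit.
    by move=> b ab; rewrite /unit_at (_ : (b == a) = false) //; apply/eqP => ba;
       move: ab; rewrite ba ltnn.
  by apply/funext => b; rewrite pcomp_unit ltnSn.
have MZ_mult i : mult e (MZ i) (g i).
  apply: (mult_of_composition (s := pvar i) g_left dlw) => //.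
  - by move=> a; apply: poly_ws (MZf i _ _ (unit a)).
  - by move=> a; apply: poly_tends; exact: MZf.
have q_g : q = g.
  apply/funext => i; have [_ qf] := fq i.
  apply: (composition_unique g_left dlw) (poly_tends qf) _ => //; first exact: poly_ws qf.
have ex i : exists N, deg_lt N (f i) /\ pcomp_upto N (f i) g = pvar i.
  by have [[N fN fqE] _] := fq i; exists N; rewrite -q_g.
have [N NP] := choice ex.
pose L i := psum (f i) MZ (N i).
have L_mult i : mult e (L i) (pvar i).
  by rewrite -(NP i).2; exact: mult_psum.
exists L; split; last by split; [exact: g_left | exists 1 => // i; exact: g_ws].
split; [exact: e_basis | | | | exact: MZ_mult].
- by move=> i; case: (L_mult i).
- by move=> i a; exact: (mult_pvar_creation a (L_mult i)).
left=> i; apply/sum_sotP; split; first by case: (L_mult i).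
move=> x; apply: tends_near (tends_cst _); exists (N i) => // m /= Nm.
by rewrite (psum_stable _ (NP i).1 Nm).
Qed.

End Models.

(** The compression of the creation operators to words of length at most N,
    scaled into a small ball; it is nilpotent, so a power series applied to it
    displays its own coefficients. *)
Section TruncatedShift.
Context {R : realType} {n : nat} {H : hilbertType R}.
Variables (v : word n -> H) (N : nat) (ep : R).
Hypothesis v_ortho : forall a b, (size a <= N)%N -> (size b <= N)%N ->
  hdot (v a) (v b) = (a == b)%:R.

Definition tshift (i : 'I_n) (h : H) : H :=
  ep%:C *: \sum_(k < N) wsum k (fun a => hdot h (v a) *: v (i :: a)).

(** The series c in the truncated shifts, applied to the vector of the empty word. *)
Definition tvec (c : ncseries R n) : H :=
  \sum_(k < N.+1) wsum k (fun a => (c a * (ep ^+ size a)%:C) *: v a).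

Lemma nm_v a : (size a <= N)%N -> nm (v a) = 1.
Proof.
move=> aN; apply/eqP; rewrite -(@eqrXn2 _ 2) ?nm_ge0 ?ler01 // nm_sqr_Re v_ortho //.
by rewrite eqxx expr1n.
Qed.

Definition word_count : R := \sum_(k < N) wsum k (fun a : word n => 1).

Lemma word_count_ge0 : 0 <= word_count.
Proof. by apply: sumr_ge0 => k _; apply: wsum_ge0. Qed.

Lemma tshift_linear i : linear (tshift i).
Proof.
move=> c x y; rewrite /tshift scalerA mulrC -scalerA -scalerDr; congr (_ *: _).
rewrite scaler_sumr -big_split; apply: eq_bigr => k _ /=.
rewrite /wsum scaler_sumr -big_split; apply: eq_bigr => a _ /=.
by rewrite dotDl dotZl scalerDl scalerA.
Qed.

Lemma tshift_opb i : opb (`|ep| * word_count) (tshift i).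
Proof.
move=> x; rewrite /tshift nmZ nm_real -mulrA ler_wpM2l //.
apply: le_trans (nm_sum _ _ _) _; rewrite mulr_suml; apply: ler_sum => k _.
apply: le_trans (nm_sum _ _ _) _; rewrite -wsum_mull; apply: ler_sum => a _.
rewrite nmZ nm_v /= ?size_tuple // mulr1 mul1r.
by apply: le_trans (cauchy_schwarz _ _) _; rewrite nm_v ?mulr1 // size_tuple ltnW.
Qed.

Lemma tshift_bounded i : bounded_op (tshift i).
Proof.
apply/bounded_opP; split; first exact: tshift_linear.
exists (`|ep| * word_count); first by rewrite mulr_ge0 ?word_count_ge0.
exact: tshift_opb.
Qed.

Lemma tshift_ball (gamma : R) : 0 < gamma ->
  n%:R * (`|ep| * word_count) ^+ 2 < gamma ^+ 2 -> op_ball gamma tshift.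
Proof.
move=> g0 small; split; first exact: tshift_bounded.
have M0 : 0 <= `|ep| * word_count by rewrite mulr_ge0 ?word_count_ge0.
rewrite -[gamma]ger0_norm ?ltW // -sqrtr_sqr ltr_sqrt ?exprn_gt0 //.
apply: le_lt_trans small; apply: opnorm_le.
  by rewrite mulr_ge0 ?sqr_ge0.
have E : \sum_(i < n) (`|ep| * word_count) ^+ 2 = n%:R * (`|ep| * word_count) ^+ 2.
  by rewrite sumr_const card_ord mulr_natl.
rewrite -E => x; rewrite fct_sumE mulr_suml.
apply: le_trans (nm_sum _ _ _) _; apply: ler_sum => i _.
rewrite expr2; apply: (opb_comp M0 (@tshift_opb i)).
exact: (opb_adj (tshift_bounded i) M0 (@tshift_opb i)).
Qed.

Lemma tvec_lin (x : R[i]) c c' : tvec (fun a => x * c a + c' a) = x *: tvec c + tvec c'.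
Proof.
rewrite /tvec scaler_sumr -big_split; apply: eq_bigr => k _ /=.
rewrite /wsum scaler_sumr -big_split; apply: eq_bigr => a _ /=.
by rewrite mulrDl scalerDl scalerA mulrA.
Qed.

Lemma tvec0 : tvec (fun=> 0) = 0.
Proof.
by rewrite /tvec big1 // => k _; apply: wsum_eq0 => a _; rewrite mul0r scale0r.
Qed.

Lemma tvec_sum (I : Type) (r : seq I) (P : pred I) (c : I -> ncseries R n) :
  tvec (fun a => \sum_(i <- r | P i) c i a) = \sum_(i <- r | P i) tvec (c i).
Proof.
elim: r => [|i r IHr].
  rewrite big_nil -[RHS]tvec0; congr tvec; apply/funext => a; exact: big_nil.
rewrite big_cons; case: ifP => Pi.
  rewrite -IHr -[tvec (c i)]scale1r -tvec_lin; congr tvec; apply/funext => a.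
  by rewrite big_cons Pi mul1r.
by rewrite -IHr; congr tvec; apply/funext => a; rewrite big_cons Pi.
Qed.

Lemma tvecZ (x : R[i]) c : tvec (fun a => x * c a) = x *: tvec c.
Proof.
rewrite -[RHS]addr0 -tvec0 -tvec_lin; congr tvec; apply/funext => a.
by rewrite addr0.
Qed.

Lemma tvec_dot c b : (size b <= N)%N -> hdot (tvec c) (v b) = c b * (ep ^+ size b)%:C.
Proof.
move=> bN; rewrite /tvec dot_suml.
have bN1 : (size b < N.+1)%N by rewrite ltnS.
have term a : (size a <= N)%N -> a <> b -> hdot ((c a * (ep ^+ size a)%:C) *: v a) (v b) = 0.
  by move=> aN ab; rewrite dotZl v_ortho // (_ : (a == b) = false) ?mulr0 //; apply/eqP.
rewrite (bigD1 (Ordinal bN1)) //= [X in _ + X]big1 ?addr0 => [|k kb].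
  rewrite /wsum dot_suml -[LHS]/(wsum _ (fun a => hdot ((c a * (ep ^+ size a)%:C) *: v a) (v b))).
  rewrite (@wsum_pred1 _ _ _ b) // ?dotZl ?v_ortho // ?eqxx ?mulr1 // => a ab ne.
  by rewrite term // ab.
rewrite /wsum dot_suml big1 // => a _; apply: term.
  by rewrite size_tuple -ltnS.
by move=> E; move/eqP: kb; apply; apply: val_inj; rewrite /= -E size_tuple.
Qed.

Lemma tvec_ext c c' : (forall a, (size a <= N)%N -> c a = c' a) -> tvec c = tvec c'.
Proof.
move=> cc; apply: eq_bigr => k _; apply: eq_wsum => a ak.
by rewrite cc // ak -ltnS.
Qed.

Lemma tshift_tvec i c : tshift i (tvec c) = tvec (pmul (pvar i) c).
Proof.
rewrite /tshift [RHS]big_ord_recl wsum0 pmul_pvar mul0r scale0r add0r scaler_sumr.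
apply: eq_bigr => k _; rewrite [RHS]wsumS (bigD1 i) //= [X in _ = _ + X]big1 ?addr0.
  rewrite /wsum scaler_sumr; apply: eq_bigr => a _.
  rewrite tvec_dot ?size_tuple 1?ltnW // pmul_pvar eqxx mul1r scalerA /= ?size_tuple.
  by rewrite mulrCA exprS rmorphM.
move=> j ji; apply: wsum_eq0 => a _.
by rewrite pmul_pvar (negbTE ji) !mul0r scale0r.
Qed.

Lemma tvec_opword (Y : 'I_n -> H -> H) (F : 'I_n -> ncseries R n) a c :
  (forall i c, Y i (tvec c) = tvec (pmul (F i) c)) ->
  opword Y a (tvec c) = tvec (pmul (pword F a) c).
Proof.
move=> YF; elim: a => [|i a IHa] /=.
  by congr tvec; apply/funext => b; rewrite pmul1.
by rewrite IHa YF; congr tvec; apply/funext => b; rewrite pmulA.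
Qed.

Lemma tvec_psum (Y : 'I_n -> H -> H) (F : 'I_n -> ncseries R n) psi m c :
  (forall i c, Y i (tvec c) = tvec (pmul (F i) c)) ->
  psum psi Y m (tvec c) = tvec (pmul (pcomp_upto m psi F) c).
Proof.
move=> YF; rewrite psumE /hpart /wsum.
transitivity (\sum_(k < m) \sum_(a : k.-tuple 'I_n)
   tvec (fun b => psi a * pmul (pword F a) c b)).
  by apply: eq_bigr => k _; apply: eq_bigr => a _; rewrite (tvec_opword _ _ YF) tvecZ.
under eq_bigr do rewrite -tvec_sum.
rewrite -tvec_sum; congr tvec; apply/funext => b.
rewrite /pmul; under [RHS]eq_bigr do rewrite pcompE mulr_suml.
rewrite exchange_big; apply: eq_bigr => k _ /=; rewrite /wsum.
under [RHS]eq_bigr do rewrite mulr_suml.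
rewrite exchange_big; apply: eq_bigr => a _ /=; rewrite mulr_sumr.
by apply: eq_bigr => j _; rewrite mulrA.
Qed.

End TruncatedShift.

Section FreeModels.
Context {R : realType} {n : nat} {H : hilbertType R}.
Implicit Types (c psi s : ncseries R n) (X F : 'I_n -> H -> H).

Lemma truncated_shift_exists (b0 : word n) (gamma : R) : infinite_dim H -> 0 < gamma ->
  exists v : word n -> H, exists2 ep : R, ep != 0 &
    (forall a b, (size a <= size b0)%N -> (size b <= size b0)%N ->
       hdot (v a) (v b) = (a == b)%:R) /\
    op_ball gamma (tshift v (size b0) ep).
Proof.
move=> Hinf g0; set N := size b0.
(* M exceeds the code of every word of length at most N. *)
pose M := (\sum_(k < N.+1) wsum k (fun a : word n => (pickle a).+1))%N.
have [t t1 tM] := infinite_dim_ortho M Hinf.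
have small (a : word n) : (size a <= N)%N -> (pickle a < size t)%N.
  rewrite -ltnS tM => aN; rewrite /M (bigD1 (Ordinal aN)) //= /wsum.
  rewrite (bigD1 (in_tuple a)) //= -addnA; exact: leq_addr.
pose v (a : word n) := t`_(pickle a).
have v1 a b : (size a <= N)%N -> (size b <= N)%N -> hdot (v a) (v b) = (a == b)%:R.
  move=> /small ta /small tb; rewrite /v t1 //; congr (_%:R); congr nat_of_bool.
  by apply/eqP/eqP => [/(pcan_inj pickleK)|->].
pose B := @word_count R n N.
have B0 : 0 <= B by exact: word_count_ge0.
have n0 : 0 <= (n%:R : R) by [].
pose D : R := (n%:R + 1) * (B + 1).
have D0 : 0 < D by rewrite /D mulr_gt0 // ltr_wpDl.
exists v, (gamma / D); first by rewrite gt_eqF // divr_gt0.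
split; first exact: v1.
apply: tshift_ball => //; rewrite ger0_norm ?divr_ge0 ?(ltW g0) ?(ltW D0) // -/B.
have -> : n%:R * (gamma / D * B) ^+ 2 = gamma ^+ 2 * (n%:R * B ^+ 2 / D ^+ 2).
  by field; rewrite gt_eqF.
rewrite gtr_pMr ?exprn_gt0 // ltr_pdivrMr ?exprn_gt0 // mul1r /D exprMn.
apply: (@le_lt_trans _ _ ((n%:R + 1) ^+ 2 * B ^+ 2)).
  by rewrite ler_wpM2r ?sqr_ge0 //; move: n0; set y := n%:R => n0; nra.
by rewrite ltr_pM2l ?exprn_gt0 ?ltr_wpDl // ltr_pXn2r ?nnegrE ?addr_ge0 // ltrDl.
Qed.

Lemma pmul_pone_r psi b : pmul psi pone b = psi b.
Proof.
have := @pmul_unit R n psi [::] b [::] erefl; rewrite cats0 eqxx mulr1 => <-.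
by [].
Qed.

Variables (f : 'I_n -> ncseries R n) (gamma : R).
Hypotheses (Hinf : infinite_dim H) (g0 : 0 < gamma).
Let f_at X fX := op_ball gamma X /\ forall i, sum_norm (f i) X (fX i).
Hypothesis f_ball : forall X, op_ball gamma X -> exists2 fX, f_at X fX & op_ball 1 fX.

(** Evaluated at a truncated shift, the operator identity c(f(X)) = A displays the
    coefficients of c o f up to the length of b. *)
Lemma free_eval_coefs c s (A : ('I_n -> H -> H) -> ('I_n -> H -> H) -> H -> H) :
  (forall X fX, f_at X fX -> sum_norm c fX (A X fX)) ->
  (forall X fX (V : ncseries R n -> H),
     (forall i c, X i (V c) = V (pmul (pvar i) c)) ->
     (forall i c, fX i (V c) = V (pmul (f i) c)) -> A X fX (V pone) = V s) ->
  forall b, tends \oo (fun m => pcomp_upto m c f b) (s b).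
Proof.
move=> cA As b.
have [v [ep ep0 [v1 Xball]]] := truncated_shift_exists b Hinf g0.
set X := tshift v (size b) ep in Xball.
have [fX [_ fXe] _] := f_ball Xball.
have Xb i : bounded_op (X i) by exact: tshift_bounded.
pose V := tvec v (size b) ep.
have XV i d : X i (V d) = V (pmul (pvar i) d) by exact: tshift_tvec.
have fXV i d : fX i (V d) = V (pmul (f i) d).
  have /sum_normP[|_ h] := fXe i; first exact: Xb.
  apply: (tends_unique (ncvg_tends (V d) h)); apply: tends_near (tends_cst _).
  exists (size b).+1 => // m /= bm; rewrite (tvec_psum _ _ _ XV); apply: tvec_ext => a ab.
  apply: eq_bigr => k _; rewrite pcomp_pvar size_take_min.
  by rewrite (leq_ltn_trans (geq_minr _ _) (leq_ltn_trans ab bm)).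
have fXb i : bounded_op (fX i) by case: (fXe i).
have /sum_normP[|_ h] := cA X fX (conj Xball fXe); first exact: fXb.
have lim : tends \oo (fun m => hdot (psum c fX m (V pone)) (v b))
    (s b * (ep ^+ size b)%:C).
  rewrite -(tvec_dot ep v1) // -[tvec _ _ _ s](As X fX V XV fXV).
  exact: (tends_dotl (v b) (ncvg_tends (V pone) h)).
have e0 : (ep ^+ size b)%:C != 0 :> R[i].
  apply/eqP => /complexI/eqP; rewrite expf_eq0 (negbTE ep0) andbF //.
have -> : s b = ((ep ^+ size b)%:C)^-1 * (s b * (ep ^+ size b)%:C).
  by rewrite mulrCA mulVf // mulr1.
apply: tends_eq (tendsM _ lim) => m.
rewrite (tvec_psum _ _ _ fXV) tvec_dot // mulrCA mulVf // mulr1.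
by rewrite pmul_pone_r.
Qed.

(** The value of f at the tuple 0 consists of the scalars f(0). *)
Lemma free_constant_coefs : \sum_i nm (f i [::]) ^+ 2 < 1.
Proof.
pose Z : 'I_n -> H -> H := fun=> 0.
have Zb i : bounded_op (Z i) by exact: bounded0.
have Zball : op_ball gamma Z.
  split=> //; rewrite ler0_sqrtr //; apply: opnorm_le => // x.
  rewrite fct_sumE mul0r big1 ?nm0 // => i _; exact: nm0.
have [fZ [_ fZe] [fZb fZ1]] := f_ball Zball.
have fZE i h : fZ i h = f i [::] *: h.
  have /sum_normP[|_ lim] := fZe i; first exact: Zb.
  apply: (tends_unique (ncvg_tends h lim)); apply: tends_near (tends_cst _).
  exists 1 => // -[|m] // _; rewrite psumE big_ord_recl /hpart wsum0 /= big1 ?addr0 //.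
  by move=> k _; rewrite wsumS big1 // => j _; apply: wsum_eq0 => a _; rewrite scaler0.
have adjE i : adj (fZ i) = fun h => Num.conj (f i [::]) *: h.
  by apply: adj_eq => x y; rewrite fZE dotZl dotZr conjCK.
have SE h : (\sum_i (fZ i \o adj (fZ i))) h = (\sum_i nm (f i [::]) ^+ 2)%:C *: h.
  rewrite fct_sumE rmorph_sum scaler_suml; apply: eq_bigr => i _.
  by rewrite /= fZE adjE scalerA -sqr_nm.
have [t t1 tM] := infinite_dim_ortho 1 Hinf.
have x1 : nm t`_0 = 1.
  apply/eqP; rewrite -(@eqrXn2 _ 2) ?nm_ge0 ?ler01 // nm_sqr_Re t1 ?tM //.
  by rewrite eqxx expr1n.
have Sb : bounded_op (\sum_i (fZ i \o adj (fZ i))).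
  by apply: bounded_sum => i _; apply: bounded_comp => //; exact: bounded_adj.
have := opb_opnorm Sb t`_0; rewrite SE nmZ x1 !mulr1 nm_real ger0_norm; last first.
  by apply: sumr_ge0 => i _; exact: sqr_ge0.
move=> h; apply: le_lt_trans h _.
have o0 := opnorm_ge0 Sb.
by rewrite -(sqr_sqrtr o0) expr_lt1 ?sqrtr_ge0.
Qed.

End FreeModels.

Section AllModels.
Context {R : realType} {n : nat} {E : hilbertType R}.
Variables (f : 'I_n -> ncseries R n) (e : word n -> E) (z : 'I_n -> E).
Variable MZ : 'I_n -> E -> E.

(** [free_eval_coefs] turns the operator identities of the model into formal ones. *)
Lemma model_F_fock : orthonormal_basis e -> model_F f e z MZ ->
  exists L, fock_model f e z MZ L /\ formal_inverse f (inverse_series e z).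
Proof.
move=> e_basis [gamma [H [[g0 Hinf] [_ f_ball] _ gX [MZb MZX [Mf fMZ MfX]]]]].
have Mfb i : bounded_op (Mf i) by case: fMZ => h; case: (h i).
have words a (V : ncseries R n -> H) (fX : 'I_n -> H -> H) :
    (forall i c, fX i (V c) = V (pmul (f i) c)) -> opword fX a (V pone) = V (pword f a).
  move=> fV; elim: a => [|i a IHa] //=; by rewrite IHa fV.
have unit a fX : (forall i, bounded_op (fX i)) ->
    sum_norm (coords e (e a)) fX (opword fX a).
  move=> fXb; apply/sum_normP => //; split; first exact: bounded_opword.
  move=> d d0; exists (size a).+1 => // m /= am x.
  have -> : psum (coords e (e a)) fX m = opword fX a; last first.
    by rewrite subrr nm0 mulr_ge0 ?nm_ge0 // ltW.
  apply/funext => y; rewrite (coords_unit e_basis) psumE (bigD1 (Ordinal am)) //=.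
  rewrite [X in _ + X]big1 ?addr0 /hpart => [|k ka].
    rewrite (@wsum_pred1 _ _ _ a) // /unit_at ?eqxx ?scale1r // => b _ ba.
    by rewrite (_ : (b == a) = false) ?scale0r //; apply/eqP.
  apply: wsum_eq0 => b bk; rewrite /unit_at (_ : (b == a) = false) ?scale0r //.
  by apply/eqP => ba; move/eqP: ka; apply; apply: val_inj; rewrite /= -bk ba.
apply: (hardy_fock e_basis (Mf := Mf)) => //.
- exact: (free_constant_coefs Hinf g0 f_ball).
- move=> i; apply: (free_eval_coefs Hinf g0 f_ball (A := fun X fX => X i)).
    by move=> X fX; exact: gX.
  move=> X fX V XV _; rewrite XV; congr V; apply/funext => b; exact: pmul_pone_r.
- move=> i a; apply: (free_eval_coefs Hinf g0 f_ball
    (A := fun X fX => X i \o opword fX a)).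
    move=> X fX XfX; apply: (MZX i (e a) _ _ _ XfX); apply: unit => j.
    by case: XfX => _ /(_ j) [].
  by move=> X fX V XV fV; rewrite /= (words _ _ _ fV) XV.
move=> i a; apply: (free_eval_coefs Hinf g0 f_ball
    (A := fun X fX => fX i \o opword fX a)).
  move=> X fX XfX; apply: (MfX i (e a) _ _ _ XfX); apply: unit => j.
  by case: XfX => _ /(_ j) [].
by move=> X fX V XV fV; rewrite /= (words _ _ _ fV) fV.
Qed.

Lemma model_fock : model f e z MZ ->
  exists L, fock_model f e z MZ L /\ formal_inverse f (inverse_series e z).
Proof.
move=> [e_basis [mA|mS|mF]].
- exact: model_A_fock.
- exact: model_S_fock.
exact: model_F_fock.
Qed.

End AllModels.

(** * The radial approximation property *)

Section Radial.
Context {R : realType} {n : nat} {E E' : hilbertType R}.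
Variables (e : word n -> E) (e_basis : orthonormal_basis e).
Variables (L : 'I_n -> E -> E) (Lb : forall i, bounded_op (L i)).
Hypothesis Le : forall i a, L i (e a) = e (i :: a).
Variables (e' : word n -> E') (e'_basis : orthonormal_basis e').
Implicit Types psi phi : ncseries R n.

Lemma coef2_hdil (r : R) psi k : 0 <= r -> coef2 (hdil r psi) k = r ^+ k * coef2 psi k.
Proof.
move=> r0; rewrite /coef2 (_ : wsum k _ = (r ^+ k) ^+ 2 * wsum k (fun a => nm (psi a) ^+ 2)).
  by rewrite sqrtrM ?sqr_ge0 // sqrtr_sqr ger0_norm // exprn_ge0.
rewrite -wsum_mulr; apply: eq_wsum => a ak.
by rewrite /hdil nmM nm_real ger0_norm ?exprn_ge0 // exprMn ak.
Qed.

Lemma coef2Z (x : R[i]) psi k : coef2 (fun a => x * psi a) k = nm x * coef2 psi k.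
Proof.
rewrite /coef2 (_ : wsum k _ = nm x ^+ 2 * wsum k (fun a => nm (psi a) ^+ 2)).
  by rewrite sqrtrM ?sqr_ge0 // sqrtr_sqr ger0_norm // nm_ge0.
by rewrite -wsum_mulr; apply: eq_wsum => a _; rewrite nmM exprMn.
Qed.

Lemma coef2_tends (I : Type) (F : set_system I) {FF : Filter F}
    (Phi : I -> ncseries R n) psi k :
  (forall b, tends F (fun t => Phi t b) (psi b)) ->
  forall d : R, 0 < d -> \forall t \near F, coef2 (fun b => Phi t b - psi b) k < d.
Proof.
move=> lim d d0.
pose M : R := wsum k (fun a : word n => 1) + 1.
have M0 : 0 < M by rewrite ltr_wpDl // wsum_ge0.
have c0 : 0 < d ^+ 2 / M by rewrite divr_gt0 // exprn_gt0.
pose c := Num.min 1 (d ^+ 2 / M); have cp : 0 < c by rewrite lt_min ltr01.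
have all : \forall t \near F, forall a : k.-tuple 'I_n, nm (Phi t a - psi a) < c.
  apply: filter_forall => a; exact: lim.
apply: filterS all => t ta.
rewrite -(ltr_pXn2r (_ : (0 < 2)%N)) ?nnegrE ?coef2_ge0 ?(ltW d0) // coef2_sqr.
apply: (@le_lt_trans _ _ (wsum k (fun a : word n => d ^+ 2 / M))).
  apply: ler_sum => a _; apply: (@le_trans _ _ c); last by rewrite ge_min lexx orbT.
  have h := ta a; have h0 := nm_ge0 (Phi t a - psi a).
  have c1 : c <= 1 by rewrite ge_min lexx.
  by rewrite expr2; nra.
rewrite -[d ^+ 2 / M]mul1r wsum_mull mulrCA gtr_pMr ?exprn_gt0 //.
by rewrite ltr_pdivrMr // mul1r /M ltrDl.
Qed.

(** Multipliers bounded on one Fock space and converging coefficientwise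
    converge in norm once their coefficients are contracted radially: degree k
    gains the factor r^k, and the sum over k is dominated. *)
Lemma radial_gain (I : Type) (F : set_system I) {FF : Filter F} (r C : R)
    (A : I -> E' -> E') (A0 : E' -> E') (B : I -> E -> E) (B0 : E -> E)
    (Phi : I -> ncseries R n) phi (x : R[i]) :
  0 <= r < 1 -> 0 <= C ->
  (\forall t \near F, mult e' (A t) (Phi t)) -> mult e' A0 phi ->
  (\forall t \near F, opb C (A t)) -> opb C A0 ->
  (forall b, tends F (fun t => Phi t b) (phi b)) ->
  (\forall t \near F, mult e (B t) (fun b => x * hdil r (Phi t) b)) ->
  mult e B0 (fun b => x * hdil r phi b) -> ncvg F B B0.
Proof.
move=> r01 C0 AP A0p AC A0C lim BP B0p d d0.
have /andP[r0 r1] := r01.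
pose y t k := nm x * (r ^+ k * coef2 (fun b => Phi t b - phi b) k).
have xC : 0 <= nm x * (C + C) by rewrite mulr_ge0 ?nm_ge0 ?addr_ge0.
have dom : \forall t \near F, forall k, y t k <= nm x * (C + C) * r ^+ k.
  apply: filterS2 AP AC => t tP tC k.
  rewrite /y -mulrA ler_wpM2l ?nm_ge0 // mulrC ler_wpM2r ?exprn_ge0 //.
  apply: (coef2_mult e'_basis k (multB tP A0p)); first by rewrite addr_ge0.
  exact: opbD tC (opbN A0C).
have van k (c : R) : 0 < c -> \forall t \near F, y t k < c.
  move=> c0; have xr : 0 < nm x * r ^+ k + 1.
    by rewrite ltr_wpDl // mulr_ge0 ?nm_ge0 ?exprn_ge0.
  apply: filterS (coef2_tends k lim (divr_gt0 c0 xr)) => t.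
  rewrite ltr_pdivlMr // => small; rewrite /y mulrA; apply: le_lt_trans small.
  by rewrite mulrC ler_wpM2l ?coef2_ge0 // lerDl.
apply: filterS2 BP (tannery xC r01 dom van d0) => t tP ty.
apply: (mult_opb e_basis Lb Le (multB tP B0p)) => N.
apply: le_trans (ty N); apply: ler_sum => k _.
rewrite (_ : (fun a => _) = (fun b => x * hdil r (fun b => Phi t b - phi b) b)).
  by rewrite coef2Z coef2_hdil.
by apply/funext => b; rewrite /hdil !mulrBr.
Qed.

End Radial.

Section RadialModels.
Context {R : realType} {n : nat}.
Variable f : 'I_n -> ncseries R n.

Lemma pscale1 (F : 'I_n -> ncseries R n) : pscale 1 F = F.
Proof. by apply/funext => i; apply/funext => a; rewrite /pscale mul1r. Qed.

Lemma in_Mradb_rad : in_Mradb f -> in_Mrad f.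
Proof.
move=> [d d01 fM]; exists d => // r /fM[E [e [z [MZ [m _]]]]].
by exists E, e, z, MZ.
Qed.

Lemma exists_between (d : R) : 0 < d < 1 -> exists2 r : R, d < r <= 1 & 0 < r < 1.
Proof.
move=> /andP[d0 d1]; exists ((d + 1) / 2); apply/andP; split; lra.
Qed.

(** By uniqueness, the inverse of f is the inverse of r f for some r < 1 with its
    degree-k coefficients multiplied by r^k, and the latter lie in a Fock space. *)
Lemma inverse_radius (g : 'I_n -> ncseries R n) : in_Mrad f -> formal_inverse f g ->
  exists r C : R, [/\ 0 <= r < 1, 0 <= C & forall i k, coef2 (g i) k <= C * r ^+ k].
Proof.
move=> [d d01 fM] fg; have [r dr /andP[r0 r1]] := exists_between d01.
have [E [e [z [MZ m]]]] := fM _ dr; have [L [[e_basis _ _ _ _] inv]] := model_fock m.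
have r01 : 0 < r <= 1 by rewrite r0 ltW.
have gE := formal_inverse_unique fg (formal_inverse_scale r01 inv).
exists r, (\sum_i nm (z i)); split; first by rewrite ltW.
  by apply: sumr_ge0 => i _; exact: nm_ge0.
move=> i k; rewrite gE coef2_hdil ?(ltW r0) // mulrC ler_wpM2r ?exprn_ge0 ?(ltW r0) //.
apply: le_trans (coef2_coords e_basis _ _) _; rewrite (bigD1 i) //= lerDl.
by apply: sumr_ge0 => j _; exact: nm_ge0.
Qed.

End RadialModels.

Section NormEvaluation.
Context {R : realType} {n : nat} {E : hilbertType R}.
Variables (f : 'I_n -> ncseries R n) (e : word n -> E) (z : 'I_n -> E).
Variables (MZ L : 'I_n -> E -> E).
Hypothesis fm : fock_model f e z MZ L.
Let g := inverse_series e z.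

Lemma fock_basis : orthonormal_basis e. Proof. by case: fm. Qed.
Lemma fock_Lb i : bounded_op (L i). Proof. by case: fm. Qed.
Lemma fock_Le i a : L i (e a) = e (i :: a). Proof. by case: fm. Qed.
Lemma fock_MZ i : mult e (MZ i) (g i). Proof. by case: fm. Qed.
Lemma fock_MZb i : bounded_op (MZ i). Proof. by case: (fock_MZ i). Qed.

Lemma mult_opscale (s : R) i : mult e (opscale s MZ i) (pscale s g i).
Proof. exact: (multZ _ (fock_MZ i)). Qed.

End NormEvaluation.

Section BoundedClass.
Context {R : realType} {n : nat} {E : hilbertType R}.
Variables (f : 'I_n -> ncseries R n) (e : word n -> E) (z : 'I_n -> E).
Variables (MZ L : 'I_n -> E -> E).
Hypothesis fm : fock_model f e z MZ L.
Let g := inverse_series e z.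
Hypothesis fg : formal_inverse f g.

(** A strong limit of multipliers is a multiplier, whose coefficients appear at the
    vacuum vector. *)
Lemma mult_limit (H : hilbertType R) (u : word n -> H) (A : nat -> H -> H) B
    (Phi : nat -> ncseries R n) :
  orthonormal_basis u -> (forall m, mult u (A m) (Phi m)) -> bounded_op B ->
  (forall x, tends \oo (fun m => A m x) (B x)) ->
  mult u B (coords u (B (u [::]))) /\
  forall b, tends \oo (fun m => Phi m b) (coords u (B (u [::])) b).
Proof.
move=> u_basis AP Bb AB.
have lim b : tends \oo (fun m => Phi m b) (coords u (B (u [::])) b).
  apply: tends_eq (tends_coords u b (AB (u [::]))) => m.
  by rewrite (mult_e0 u_basis (AP m)).
split=> //; apply: (mult_basis u_basis) => // a b.
apply: (tends_unique (tends_coords u b (AB (u a)))).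
apply: (@tends_eq _ _ _ _ (fun m => pmul (Phi m) (coords u (u a)) b)).
  by move=> m; have [_ ->] := AP m.
apply: tends_sum => k _; rewrite mulrC.
by apply: tends_eq (tendsM _ (lim (take k b))) => m; rewrite mulrC.
Qed.

(** The approximants of f(M_Z) arise from those of r f by the factor r^k in degree k,
    because the inverse series do. The latter are bounded by hypothesis, so
    [radial_gain] makes the former converge in norm. *)
Lemma bounded_class_norm : in_Mradb f -> norm_evals MZ f L.
Proof.
move=> [d d01 fM]; have [r dr /andP[r0 r1]] := exists_between d01.
have [E' [e' [z' [MZ' [m bnd]]]]] := fM _ dr; have [L' [fm' fg']] := model_fock m.
have r01 : 0 < r <= 1 by rewrite r0 ltW.
have r01' : 0 <= r < 1 by rewrite ltW.
have gE : g = _ := formal_inverse_unique fg (formal_inverse_scale r01 fg').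
set g' := inverse_series e' z' in gE fg'.
have b1 := fock_basis fm; have b2 := fock_basis fm'.
have Lb := fock_Lb fm; have Le := fock_Le fm.
have MZ'b := fock_MZb fm'.
have rn : r%:C != 0 :> R[i] by apply/eqP => /complexI/eqP; rewrite gt_eqF.
(* f at s g is r f at s g', up to the change of variables g = g'(r .). *)
have sym s i m' b : pcomp_upto m' (f i) (pscale s g) b =
    (r%:C)^-1 * hdil r (pcomp_upto m' (pscale r f i) (pscale s g')) b.
  have -> : pscale s g = fun i => hdil r (pscale s g' i).
    apply/funext => j; apply/funext => a; rewrite gE /pscale /hdil; exact: mulrCA.
  rewrite pcomp_hdil /hdil (_ : pscale r f i = fun a => r%:C * f i a) // pcompZ.
  by rewrite [RHS]mulrCA mulKf.
have Lmult i : mult e (L i) (fun b => (r%:C)^-1 * hdil r (pvar i) b).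
  have := mult_creation b1 Lb Le i; congr mult; apply/funext => b.
  rewrite /hdil /pvar; case: eqP => [->|_]; last by rewrite !mulr0.
  by rewrite expr1 mulr1 mulVf.
have L'mult i : mult e' (L' i) (pvar i).
  exact: (mult_creation b2 (fock_Lb fm') (fock_Le fm') i).
have vac i b : coords e' (L' i (e' [::])) b = pvar i b.
  by rewrite (mult_e0 b2 (L'mult i)).
have evL : evals (pscale r f) MZ' L' by case: fm'.
split; first exact: Lb.
case: bnd => -[[F FP] bnd].
  left=> i; have FL : F = L' by apply: (evals_unique MZ'b (f := pscale r f)); [left|].
  have /sum_sotP[L'b lim] := FP i; rewrite FL in L'b lim.
  have [C CP] := bnd i.
  have /bounded_opP[_ [C' C'0 L'C]] := L'b.
  have CM : 0 <= Num.max `|C| C' by rewrite le_max normr_ge0.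
  have pm k : mult e' (psum (pscale r f i) MZ' k) (pcomp_upto k (pscale r f i) g').
    exact: (mult_psum _ k (fock_MZ fm')).
  apply: (@radial_gain R n E E' e b1 L Lb Le e' b2 nat \oo _ r _
    (psum (pscale r f i) MZ') (L' i) (psum (f i) MZ) (L i)
    (fun k => pcomp_upto k (pscale r f i) g') (pvar i) ((r%:C)^-1)
    r01' CM (nearW _ pm) (L'mult i)).
  - apply: nearW => k; apply: opb_le (opb_opnorm (bounded_psum MZ'b _ k)).
    by rewrite le_max (le_trans (CP k)) // ler_norm.
  - by apply: opb_le L'C; rewrite le_max lexx orbT.
  - move=> b; rewrite -vac; apply: tends_eq (tends_coords e' b (lim (e' [::]))) => k.
    by rewrite (mult_e0 b2 (pm k)).
  - apply: nearW => k; have := mult_psum (f i) k (fock_MZ fm); congr mult.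
    by apply/funext => b; have := sym 1 i k b; rewrite !pscale1.
  exact: Lmult.
right=> i; have FL : F = L' by apply: (evals_unique MZ'b (f := pscale r f)); [right|].
have [L'b [dl [B' [/andP[dl0 dl1] B'P B'L]]]] := FP i; rewrite FL in L'b B'L.
have [C CP] := bnd i.
have /bounded_opP[_ [C' C'0 L'C]] := L'b.
have CM : 0 <= Num.max `|C| C' by rewrite le_max normr_ge0.
have sb s : forall j, bounded_op (opscale s MZ' j) by exact: bounded_opscale.
pose Th s k := pcomp_upto k (pscale r f i) (pscale s g').
have Thm s k : mult e' (psum (pscale r f i) (opscale s MZ') k) (Th s k).
  exact: (mult_psum _ k (mult_opscale fm' s)).
have B'n s : dl < s < 1 -> bounded_op (B' s) /\
    ncvg \oo (psum (pscale r f i) (opscale s MZ')) (B' s).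
  by move=> /B'P /(sum_normP (sb s)).
pose Ph s := coords e' (B' s (e' [::])).
have B'm s : dl < s < 1 -> mult e' (B' s) (Ph s) /\
    forall b, tends \oo (fun k => Th s k b) (Ph s b).
  move=> /B'n[B'b lim]; apply: (mult_limit b2 (Thm s)) => // x; exact: ncvg_tends.
have B'C s : dl < s < 1 -> opb (Num.max `|C| C') (B' s).
  move=> sd; have /andP[ds s1] := sd; have [B'b lim] := B'n _ sd.
  have [A] := CP s ltac:(by rewrite s1 (le_trans (ltW dl0)) // ltW).
  move=> /(sum_normP (sb s))[Ab limA] AC.
  rewrite (ncvg_unique lim limA); apply: opb_le (opb_opnorm Ab).
  by rewrite le_max (le_trans AC) // ler_norm.
(* The values f(s M_Z) for s < 1 are constructed from their coefficients, which
   become summable after the contraction by r. *)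
have rad C0 psi : (forall k, coef2 psi k <= C0) ->
    exists A, mult e A (fun b => (r%:C)^-1 * hdil r psi b).
  move=> psiC; have C00 : 0 <= C0 := le_trans (coef2_ge0 psi 0) (psiC 0).
  have [|A [Am _ _]] := @mult_series _ _ _ e b1 L Lb Le
    (fun b => (r%:C)^-1 * hdil r psi b) (nm ((r%:C : R[i])^-1) * (C0 * (1 - r)^-1)).
    move=> N; apply: (@le_trans _ _ (\sum_(k < N) nm ((r%:C : R[i])^-1) * (C0 * r ^+ k))).
      apply: ler_sum => k _; rewrite coef2Z ler_wpM2l ?nm_ge0 // coef2_hdil ?(ltW r0) //.
      by rewrite mulrC ler_wpM2r ?exprn_ge0 ?(ltW r0).
    by rewrite -!mulr_sumr !ler_wpM2l ?nm_ge0 // geometric_sum_le.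
  by exists A.
pose B s := xget 0 [set A : E -> E | mult e A (fun b => (r%:C)^-1 * hdil r (Ph s) b)].
have Bm s : dl < s < 1 -> mult e (B s) (fun b => (r%:C)^-1 * hdil r (Ph s) b).
  move=> sd; rewrite /B; case: xgetP => [A -> //|no].
  have [|A Am] := rad (Num.max `|C| C') (Ph s); last by case: (no A Am).
  by move=> k; apply: (coef2_mult b2 k (B'm s sd).1 CM); exact: B'C.
exists dl, B; split; first by rewrite dl0.
  move=> s sd; split; first by case: (Bm s sd).
  have [B'b lim] := B'n _ sd; have [M M0 TM] := ncvg_bound B'b lim.
  have /bounded_opP[_ [M' M'0 B'M]] := B'b.
  have MM : 0 <= Num.max M M' by rewrite le_max M0.
  have [B'mm coefs] := B'm s sd.
  apply: (@radial_gain R n E E' e b1 L Lb Le e' b2 nat \oo _ r _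
    (psum (pscale r f i) (opscale s MZ')) (B' s) (psum (f i) (opscale s MZ)) (B s)
    (Th s) (Ph s) ((r%:C)^-1) r01' MM (nearW _ (Thm s)) B'mm _ _ coefs _ (Bm s sd)).
  - by apply: filterS TM => k; apply: opb_le; rewrite le_max lexx.
  - by apply: opb_le B'M; rewrite le_max lexx orbT.
  apply: nearW => k; have := mult_psum (f i) k (mult_opscale fm s); congr mult.
  by apply/funext => b; rewrite sym.
have nd : \forall s \near (1 : R)^'-, dl < s < 1 by exact: near_left1.
apply: (@radial_gain R n E E' e b1 L Lb Le e' b2 R ((1 : R)^'-) _ r _ B' (L' i) B (L i)
    Ph (pvar i) ((r%:C)^-1) r01' CM _ (L'mult i) _ _ _ _ (Lmult i)).
- by apply: filterS nd => s /B'm[].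
- by apply: filterS nd => s; exact: B'C.
- by apply: opb_le L'C; rewrite le_max lexx orbT.
- move=> b; rewrite -vac; apply: tends_coords.
  by move/sot_cvgP: B'L; exact.
by apply: filterS nd => s; exact: Bm.
Qed.

End BoundedClass.

Section NormClass.
Context {R : realType} {n : nat} {E E' : hilbertType R}.
Variables (e : word n -> E) (e_basis : orthonormal_basis e).
Variables (e' : word n -> E') (e'_basis : orthonormal_basis e').

Lemma fock_unitary : exists U : E -> E', exists V : E' -> E,
  [/\ isometric U, isometric V & forall A' psi, mult e' A' psi -> mult e (V \o A' \o U) psi].
Proof.
have [U [Ui _] Ue] : exists2 U : E -> E', unitary U & forall a, U (e a) = e' a.
  apply: gram_unitary; [|exact: e_span e_basis|exact: e_span e'_basis].
  by move=> a b; rewrite (e_dot e_basis) (e_dot e'_basis).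
have [V [Vi _] Ve] : exists2 V : E' -> E, unitary V & forall a, V (e' a) = e a.
  apply: gram_unitary; [|exact: e_span e'_basis|exact: e_span e_basis].
  by move=> a b; rewrite (e_dot e_basis) (e_dot e'_basis).
have cU x : coords e' (U x) = coords e x.
  by apply/funext => a; rewrite /coords -Ue; case: Ui => _ ->.
have cV y : coords e (V y) = coords e' y.
  by apply/funext => a; rewrite /coords -Ve; case: Vi => _ ->.
exists U, V; split=> // A' psi [A'b A'p]; split.
  apply: bounded_comp; last exact: bounded_isometric.
  by apply: bounded_comp => //; exact: bounded_isometric.
by move=> x; rewrite /= cV A'p cU.
Qed.

End NormClass.

Section NormClassEvaluation.
Context {R : realType} {n : nat} {E : hilbertType R}.
Variables (f : 'I_n -> ncseries R n) (e : word n -> E) (z : 'I_n -> E).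
Variables (MZ L : 'I_n -> E -> E).
Hypothesis fm : fock_model f e z MZ L.
Hypothesis fg : formal_inverse f (inverse_series e z).

Lemma isometric_nm (H K : hilbertType R) (U : H -> K) x : isometric U -> nm (U x) = nm x.
Proof.
by move=> [_ UU]; apply/eqP; rewrite -(@eqrXn2 _ 2) ?nm_ge0 // !nm_sqr_Re UU.
Qed.

(** Two models of f have the same g, so the unitary that matches the bases carries
    one onto the other. *)
Lemma norm_class_norm : in_Mnorm f -> norm_evals MZ f L.
Proof.
move=> [E' [e' [z' [MZ' [m nmod]]]]]; have [L' [fm' fg']] := model_fock m.
have gE := formal_inverse_unique fg fg'.
have b1 := fock_basis fm; have b2 := fock_basis fm'.
have MZ'b := fock_MZb fm'.
have [U [V [Ui Vi UV]]] := fock_unitary b1 b2.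
have Lm i : mult e (L i) (pvar i).
  exact: (mult_creation b1 (fock_Lb fm) (fock_Le fm) i).
have L'm i : mult e' (L' i) (pvar i).
  exact: (mult_creation b2 (fock_Lb fm') (fock_Le fm') i).
have LE i : L i = V \o L' i \o U by exact: (mult_unique b1 (Lm i) (UV _ _ (L'm i))).
have PE s psi k : psum psi (opscale s MZ) k = V \o psum psi (opscale s MZ') k \o U.
  apply: (mult_unique b1 (psi := pcomp_upto k psi (pscale s (inverse_series e z)))).
    exact: (mult_psum _ _ (mult_opscale fm s)).
  by rewrite gE; apply: UV; exact: (mult_psum _ _ (mult_opscale fm' s)).
have tr (I : Type) (F : set_system I) (FF : Filter F) (A' : I -> E' -> E') B' :
    ncvg F A' B' -> ncvg F (fun t => V \o A' t \o U) (V \o B' \o U).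
  move=> lim d d0; apply: filterS (lim _ d0) => t tB x.
  have -> : ((V \o A' t \o U) - (V \o B' \o U)) x = V ((A' t - B') (U x)).
    by rewrite [RHS](linB Vi.1).
  by rewrite (isometric_nm _ Vi) -(isometric_nm x Ui); exact: tB.
have trb A' : bounded_op A' -> bounded_op (V \o A' \o U).
  move=> A'b; apply: bounded_comp; last exact: bounded_isometric.
  by apply: bounded_comp => //; exact: bounded_isometric.
have evL : evals f MZ' L' by case: fm'.
have id1 (Y : 'I_n -> E -> E) : opscale 1 Y = Y.
  by apply/funext => i; rewrite /opscale scale1r.
have id1' (Y : 'I_n -> E' -> E') : opscale 1 Y = Y.
  by apply/funext => i; rewrite /opscale scale1r.
split; first exact: (fock_Lb fm).
case: nmod => [[F FP]|[F [evF FP]]].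
  have FL : F = L' by apply: (evals_unique MZ'b (f := f)); [left=> i; exact: norm_sot|].
  left=> i; have /(sum_normP MZ'b)[_] := FP i; rewrite FL => /tr.
  rewrite -LE.
  have -> // : (fun t => V \o psum (f i) MZ' t \o U) = psum (f i) MZ.
  by apply: funext => k; rewrite -[MZ]id1 PE id1'.
have FL : F = L' by exact: (evals_unique MZ'b (f := f)).
right=> i; have [d [B [d01 BP BF]]] := FP i.
exists d, (fun s => V \o B s \o U); split=> //; last first.
  rewrite LE; apply: tr; rewrite -FL; apply/norm_cvgP => //.
    have /andP[_ d1] := d01; apply: filterS (near_left1 d1) => s /BP[]; exact.
  rewrite FL; exact: (fock_Lb fm').
move=> s /BP/(sum_normP (bounded_opscale MZ'b s))[Bb lim]; split; first exact: trb.
have <- : (fun t => V \o psum (f i) (opscale s MZ') t \o U) = psum (f i) (opscale s MZ).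
  by apply: funext => k; rewrite PE.
exact: tr.
Qed.

End NormClassEvaluation.

(** * Star-polynomials in a row isometry *)

Section Monomials.
Context {R : realType} {n : nat}.

(** Combinations of the operators Y_a Y_b^*. These are closed under products when Y
    is a row isometry, since Y_i^* Y_j is then 0 or 1. *)
Definition starpoly : Type := seq (R[i] * (word n * word n)).

Section Evaluate.
Context {H : hilbertType R}.
Variables (Y : 'I_n -> H -> H) (Yb : forall i, bounded_op (Y i)).
Hypothesis Y_iso : forall i j x, adj (Y i) (Y j x) = (i == j)%:R *: x.

Definition star_ev (s : starpoly) : H -> H :=
  \sum_(p <- s) p.1 *: (opword Y p.2.1 \o adj (opword Y p.2.2)).

Definition star_scale (c : R[i]) (s : starpoly) : starpoly :=
  [seq (c * p.1, p.2) | p <- s].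

Definition star_adj (s : starpoly) : starpoly :=
  [seq (Num.conj p.1, (p.2.2, p.2.1)) | p <- s].

(** The reduced form u v^* of the product Y_b^* Y_c for a row isometry Y, or None
    when it vanishes. *)
Fixpoint reduce (b c : word n) : option (word n * word n) :=
  match b, c with
  | [::], _ => Some (c, [::])
  | _, [::] => Some ([::], b)
  | i :: b', j :: c' => if i == j then reduce b' c' else None
  end.

Definition star_mono (p q : R[i] * (word n * word n)) : starpoly :=
  if reduce p.2.2 q.2.1 is Some (c, d)
  then [:: (p.1 * q.1, (p.2.1 ++ c, q.2.2 ++ d))] else [::].

Definition star_mul (s t : starpoly) : starpoly :=
  flatten [seq flatten [seq star_mono p q | q <- t] | p <- s].

Lemma star_ev_cat s t : star_ev (s ++ t) = star_ev s + star_ev t.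
Proof. by rewrite /star_ev big_cat. Qed.

Lemma star_ev_scale c s : star_ev (star_scale c s) = c *: star_ev s.
Proof.
rewrite /star_ev big_map scaler_sumr; apply: eq_bigr => p _.
by rewrite scalerA.
Qed.

Lemma star_term_bounded (a b : word n) : bounded_op (opword Y a \o adj (opword Y b)).
Proof.
apply: bounded_comp; first exact: bounded_opword.
exact/bounded_adj/bounded_opword.
Qed.

Lemma star_ev_bounded s : bounded_op (star_ev s).
Proof. by apply: bounded_sum => p _; exact/boundedZ/star_term_bounded. Qed.

Lemma adj_opword_cat (a b : word n) x :
  adj (opword Y (a ++ b)) x = adj (opword Y b) (adj (opword Y a) x).
Proof.
have -> : opword Y (a ++ b) = opword Y a \o opword Y b.
  by apply/funext => y; exact: opword_cat.
by rewrite adj_comp //; exact: bounded_opword.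
Qed.

Lemma star_ev_adj s : adj (star_ev s) = star_ev (star_adj s).
Proof.
apply: adj_eq => x y; rewrite /star_ev big_map !fct_sumE dot_suml dot_sumr.
apply: eq_bigr => p _; rewrite !fctE /= dotZl dotZr conjCK; congr (_ * _).
by rewrite adjP ?adjPl //; exact: bounded_opword.
Qed.

Lemma reduceP (b c : word n) x : adj (opword Y b) (opword Y c x) =
  if reduce b c is Some (u, v) then opword Y u (adj (opword Y v) x) else 0.
Proof.
elim: b c => [|i b IHb] [|j c] /=; rewrite ?adj_id //.
have -> : adj (Y i \o opword Y b) = adj (opword Y b) \o adj (Y i).
  by rewrite adj_comp //; exact: bounded_opword.
rewrite /= Y_iso; case: eqP => _; first by rewrite scale1r IHb.
by rewrite scale0r lin0 //; apply/bounded_linear/bounded_adj/bounded_opword.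
Qed.

Lemma star_ev_mul s t : star_ev (star_mul s t) = star_ev s \o star_ev t.
Proof.
apply/funext => x; rewrite /star_mul.
have E (p : R[i] * (word n * word n)) : star_ev (flatten [seq star_mono p q | q <- t]) x =
    p.1 *: opword Y p.2.1 (adj (opword Y p.2.2) (star_ev t x)).
  have Tl : linear (fun y => p.1 *: opword Y p.2.1 (adj (opword Y p.2.2) y)).
    by apply/bounded_linear/(boundedZ p.1 (star_term_bounded p.2.1 p.2.2)).
  rewrite [star_ev t]/star_ev fct_sumE (lin_sum Tl) /star_ev big_flatten big_map fct_sumE.
  apply: eq_bigr => q _; rewrite fctE (linZ Tl) /= reduceP /star_mono.
  case: reduce => [[c d]|]; last first.
    rewrite big_nil [RHS](_ : _ = 0) // lin0 ?scaler0 //.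
    exact/bounded_linear/bounded_opword.
  rewrite big_seq1 !fctE /= opword_cat adj_opword_cat.
  by rewrite !scalerA mulrC.
rewrite {1}/star_ev big_flatten big_map /= /star_ev !fct_sumE.
by apply: eq_bigr => p _; rewrite [LHS]E /star_ev fct_sumE.
Qed.

End Evaluate.
End Monomials.

Section Amplification.
Context {R : realType} {n : nat} {E K : hilbertType R}.
Variables (e : word n -> E) (e_basis : orthonormal_basis e).

Definition word_sum (V : nmodType) (N : nat) (F : word n -> V) : V :=
  \sum_(k < N) wsum k F.

Fixpoint words_of (k : nat) : seq (word n) :=
  if k is j.+1 then [seq i :: a | i <- enum 'I_n, a <- words_of j] else [:: [::]].

Lemma mem_words (a : word n) : a \in words_of (size a).
Proof.
elim: a => [|i a IHa] //=; apply/allpairsP; exists (i, a); split=> //=.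
by rewrite mem_enum.
Qed.

Lemma word_sum_orthonormal N (c : word n -> R[i]) :
  nm (word_sum N (fun a => c a *: e a)) ^+ 2 = word_sum N (fun a => nm (c a) ^+ 2).
Proof.
rewrite /word_sum nm_sqr_Re dot_suml cRe_sum; apply: eq_bigr => k _.
rewrite {1}/wsum dot_suml cRe_sum; apply: eq_bigr => a _.
rewrite dotZl dot_sumr (bigD1 k) //= big1 => [|j jk]; last first.
  rewrite /wsum dot_sumr big1 // => b _; rewrite dotZr (e_dot e_basis).
  rewrite (_ : (_ == _) = false) ?mulr0 //; apply/eqP => ab.
  by move/eqP: jk; apply; apply: val_inj; rewrite /= -(size_tuple b) -ab size_tuple.
rewrite addr0 /wsum dot_sumr (bigD1 a) //= big1 => [|b ba]; last first.
  rewrite dotZr (e_dot e_basis) (_ : (_ == _) = false) ?mulr0 //.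
  by rewrite eq_sym; apply/negbTE.
by rewrite addr0 dotZr (e_dot e_basis) eqxx mulr1 -sqr_nm.
Qed.

(** The amplification of A to vector coefficients has the norm of A: expanded in an
    orthonormal list, it is a direct sum of copies of A. *)
Lemma amplification (A : E -> E) (M : R) (N N' : nat) (x y : word n -> K) :
  bounded_op A -> 0 <= M -> opb M A ->
  nm (word_sum N (fun a => word_sum N' (fun b =>
        hdot (A (e a)) (e b) * hdot (x a) (y b)))) <=
  M * (Num.sqrt (word_sum N (fun a => nm (x a) ^+ 2)) *
       Num.sqrt (word_sum N' (fun a => nm (y a) ^+ 2))).
Proof.
move=> Ab M0 AM; have Al := bounded_linear Ab.
pose ws := flatten [seq words_of k | k <- iota 0 (N + N')].
have wsP (a : word n) : (size a < N + N')%N -> a \in ws.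
  move=> aN; apply/flattenP; exists (words_of (size a)); last exact: mem_words.
  by apply/mapP; exists (size a); rewrite // mem_iota.
have [t t1 tP] := gram_schmidt ([seq x a | a <- ws] ++ [seq y a | a <- ws]).
have xt a : (size a < N + N')%N -> x a = \sum_(i < size t) hdot (x a) t`_i *: t`_i.
  by move=> /wsP aw; apply: tP; rewrite mem_cat map_f.
have yt a : (size a < N + N')%N -> y a = \sum_(i < size t) hdot (y a) t`_i *: t`_i.
  by move=> /wsP aw; apply: tP; rewrite mem_cat map_f ?orbT.
have dot2 (u w : K) : u = \sum_(i < size t) hdot u t`_i *: t`_i ->
    hdot u w = \sum_(i < size t) hdot u t`_i * Num.conj (hdot w t`_i).
  move=> uE; rewrite {1}uE dot_suml; apply: eq_bigr => i _.
  by rewrite dotZl [hdot t`_i w]dotC.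
have pars m (u : word n -> K) : (m <= N + N')%N -> (forall a, (size a < N + N')%N ->
      u a = \sum_(i < size t) hdot (u a) t`_i *: t`_i) ->
    \sum_(i < size t) nm (word_sum m (fun a => hdot (u a) t`_i *: e a)) ^+ 2 =
    word_sum m (fun a => nm (u a) ^+ 2).
  move=> mN ut; under eq_bigr do rewrite word_sum_orthonormal.
  rewrite /word_sum exchange_big; apply: eq_bigr => k _ /=.
  rewrite /wsum exchange_big; apply: eq_bigr => a _ /=.
  have aN : (size a < N + N')%N by rewrite size_tuple (leq_trans (ltn_ord k)).
  rewrite nm_sqr_Re (dot2 _ _ (ut _ aN)) cRe_sum; apply: eq_bigr => i _.
  by rewrite -sqr_nm.
have -> : word_sum N (fun a => word_sum N' (fun b =>
        hdot (A (e a)) (e b) * hdot (x a) (y b))) =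
   \sum_(i < size t) hdot (A (word_sum N (fun a => hdot (x a) t`_i *: e a)))
      (word_sum N' (fun b => hdot (y b) t`_i *: e b)).
  transitivity (word_sum N (fun a => word_sum N' (fun b => \sum_(i < size t)
      hdot (A (hdot (x a) t`_i *: e a)) (hdot (y b) t`_i *: e b)))).
    apply: eq_bigr => k _; apply: eq_bigr => a _.
    apply: eq_bigr => l _; apply: eq_bigr => b _.
    have aN : (size a < N + N')%N by rewrite size_tuple (leq_trans (ltn_ord k)) ?leq_addr.
    rewrite (dot2 _ _ (xt _ aN)) mulr_sumr; apply: eq_bigr => i _.
    by rewrite (linZ Al) dotZl dotZr; ring.
  rewrite /word_sum /wsum.
  transitivity (\sum_(k < N) \sum_(a : k.-tuple 'I_n) \sum_(i < size t)
     hdot (A (hdot (x a) t`_i *: e a)) (word_sum N' (fun b => hdot (y b) t`_i *: e b))).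
    apply: eq_bigr => k _; apply: eq_bigr => a _.
    transitivity (\sum_(l < N') \sum_(i < size t) \sum_(b : l.-tuple 'I_n)
      hdot (A (hdot (x a) t`_i *: e a)) (hdot (y b) t`_i *: e b)).
      by apply: eq_bigr => l _; exact: exchange_big.
    rewrite exchange_big; apply: eq_bigr => i _ /=.
    rewrite /word_sum dot_sumr; apply: eq_bigr => l _.
    by rewrite /wsum dot_sumr.
  transitivity (\sum_(k < N) \sum_(i < size t) \sum_(a : k.-tuple 'I_n)
     hdot (A (hdot (x a) t`_i *: e a)) (word_sum N' (fun b => hdot (y b) t`_i *: e b))).
    by apply: eq_bigr => k _; exact: exchange_big.
  rewrite exchange_big; apply: eq_bigr => i _ /=.
  rewrite (lin_sum Al) dot_suml; apply: eq_bigr => k _.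
  by rewrite (lin_sum Al) dot_suml.
apply: le_trans (nm_sum _ _ _) _.
rewrite -(pars _ x (leq_addr _ _) xt) -(pars _ y (leq_addl _ _) yt).
apply: le_trans (_ : _ <= \sum_(i < size t)
   M * (nm (word_sum N (fun a => hdot (x a) t`_i *: e a)) *
        nm (word_sum N' (fun b => hdot (y b) t`_i *: e b)))) _.
  apply: ler_sum => i _; apply: le_trans (cauchy_schwarz _ _) _.
  by rewrite mulrA ler_wpM2r ?nm_ge0.
rewrite -mulr_sumr ler_wpM2l //; apply: sum_cauchy_schwarz => i; exact: nm_ge0.
Qed.

End Amplification.

Lemma wsumB {n : nat} {V : zmodType} k (F G : word n -> V) :
  wsum k (fun a => F a - G a) = wsum k F - wsum k G.
Proof. exact: sumrB. Qed.

Section WordSumPick.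
Context {R : realType} {n : nat}.
Implicit Types (b : word n).

Lemma word_sumS (V : nmodType) N (F : word n -> V) :
  word_sum N.+1 F = F [::] + word_sum N (fun a => \sum_i F (i :: a)).
Proof.
rewrite /word_sum big_ord_recl wsum0; congr (_ + _); apply: eq_bigr => k _.
by rewrite wsumS wsum_exchange.
Qed.

Lemma eq_word_sum (V : nmodType) N (F G : word n -> V) :
  (forall a, (size a < N)%N -> F a = G a) -> word_sum N F = word_sum N G.
Proof. by move=> FG; apply: eq_bigr => k _; apply: eq_wsum => a ak; rewrite FG ?ak. Qed.

Lemma word_sum_prefix (V : nmodType) N b (F : word n -> V) :
  word_sum (size b + N) (fun a => if prefix b a then F (drop (size b) a) else 0) =
  word_sum N F.
Proof.
elim: b => [|i b IHb] /=.
  by apply: eq_word_sum => a _; rewrite prefix0s drop0.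
rewrite addSn word_sumS /= add0r -[RHS]IHb; apply: eq_word_sum => a _.
rewrite (bigD1 i) //= eqxx /= big1 ?addr0 // => j ji.
by rewrite eq_sym (negbTE ji).
Qed.

Lemma word_sum_pick N b (F : word n -> R[i]) : (size b < N)%N ->
  word_sum N (fun a => (b == a)%:R * F a) = F b.
Proof.
move=> bN; rewrite /word_sum (bigD1 (Ordinal bN)) //= (@wsum_pred1 _ _ _ b) // => [|a _ ab].
  rewrite eqxx mul1r big1 ?addr0 // => k kb; apply: wsum_eq0 => a ak.
  rewrite (_ : (b == a) = false) ?mul0r //; apply/eqP => ba.
  by case/eqP: kb; apply: val_inj; rewrite /= ba ak.
by rewrite (_ : (b == a) = false) ?mul0r //; apply/eqP => ba; apply: ab.
Qed.

Context {E : hilbertType R}.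
Variables (e : word n -> E) (e_basis : orthonormal_basis e).
Variables (L : 'I_n -> E -> E) (Lb : forall i, bounded_op (L i)).
Hypothesis Le : forall i a, L i (e a) = e (i :: a).

Lemma opword_creation a b : opword L a (e b) = e (a ++ b).
Proof. by elim: a => //= i a ->. Qed.

Lemma adj_opword_creation a b :
  adj (opword L a) (e b) = if prefix a b then e (drop (size a) b) else 0.
Proof.
have ob := bounded_opword Lb; apply: (coords_inj e_basis) => c.
rewrite /coords adjPl // opword_creation (e_dot e_basis).
case: ifP => ab; last first.
  rewrite dot0l (_ : (_ == _) = false) //; apply: contraFF ab => /eqP ->.
  exact: prefix_prefix.
have [d bE] := prefixP ab.
by rewrite bE drop_size_cat // (e_dot e_basis) eqseq_cat // eqxx.
Qed.

(** The matrix of L_a L_b^* couples b ++ d with a ++ d only. *)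
Lemma star_monomial_sum (V : hilbertType R) (x y : word n -> V) a b N N' :
  (size a + N <= N')%N ->
  word_sum (size b + N) (fun c => word_sum N' (fun d =>
    hdot (opword L a (adj (opword L b) (e c))) (e d) * hdot (x c) (y d))) =
  word_sum N (fun d => hdot (x (b ++ d)) (y (a ++ d))).
Proof.
move=> aN; rewrite -(word_sum_prefix N b); apply: eq_word_sum => c cN.
rewrite adj_opword_creation; case: ifP => bc; last first.
  rewrite lin0; last exact/bounded_linear/bounded_opword.
  by rewrite /word_sum big1 // => k _; apply: wsum_eq0 => d _; rewrite dot0l mul0r.
have [d cE] := prefixP bc; rewrite cE drop_size_cat // opword_creation.
transitivity (word_sum N' (fun d' => (a ++ d == d')%:R * hdot (x (b ++ d)) (y d'))).
  by apply: eq_word_sum => d' _; rewrite (e_dot e_basis).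
apply: word_sum_pick; apply: leq_trans aN.
by rewrite size_cat ltn_add2l -(ltn_add2l (size b)) -size_cat -cE.
Qed.

End WordSumPick.

(** * The Poisson kernel of a row isometry *)

Section PoissonKernel.
Context {R : realType} {n : nat} {K : hilbertType R}.
Variables (W : 'I_n -> K -> K) (Wb : forall i, bounded_op (W i)).
Hypothesis W_iso : forall i j x, adj (W i) (W j x) = (i == j)%:R *: x.
Implicit Types x y k : K.

Definition range_proj x : K := \sum_i W i (adj (W i) x).

Lemma range_proj_dot x y :
  hdot (range_proj x) y = \sum_i hdot (adj (W i) x) (adj (W i) y).
Proof. by rewrite dot_suml; apply: eq_bigr => i _; rewrite adjP. Qed.

Lemma range_proj_sym x y : hdot (range_proj x) y = hdot x (range_proj y).
Proof.
by rewrite range_proj_dot dot_sumr; apply: eq_bigr => i _; rewrite adjPl.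
Qed.

Lemma range_proj_idem x : range_proj (range_proj x) = range_proj x.
Proof.
apply: eq_bigr => i _; congr (W i _).
rewrite (lin_sum (bounded_linear (bounded_adj (Wb i)))) (bigD1 i) //= W_iso eqxx scale1r.
by rewrite big1 ?addr0 // => j ji; rewrite W_iso eq_sym (negbTE ji) scale0r.
Qed.

Lemma row_iso_adj_le x : \sum_i nm (adj (W i) x) ^+ 2 <= nm x ^+ 2.
Proof.
have E : complex.Re (hdot x (range_proj x)) = \sum_i nm (adj (W i) x) ^+ 2.
  rewrite -range_proj_sym range_proj_dot cRe_sum.
  by apply: eq_bigr => i _; rewrite nm_sqr_Re.
have := sqr_ge0 (nm (x - range_proj x)); rewrite nm_sqrB.
rewrite [nm (range_proj x) ^+ 2]nm_sqr_Re range_proj_sym range_proj_idem E; lra.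
Qed.

(** The positive square root of 1 - r^2 Q for the projection Q onto the range of
    the row W. *)
Definition row_defect (r : R) x : K :=
  x - (1 - Num.sqrt (1 - r ^+ 2))%:C *: range_proj x.

Lemma row_defect_dot (r : R) x y : 0 <= r <= 1 ->
  hdot (row_defect r x) (row_defect r y) =
  hdot x y - (r ^+ 2)%:C * \sum_i hdot (adj (W i) x) (adj (W i) y).
Proof.
move=> /andP[r0 r1]; rewrite -range_proj_dot /row_defect.
have := sqr_sqrtr (_ : 0 <= 1 - r ^+ 2); rewrite subr_ge0 expr_le1 // => /(_ r1).
move: (Num.sqrt _) => s ss; rewrite -[r ^+ 2](subKr 1) -ss.
rewrite dotBl !dotBr !dotZl !dotZr conj_real -!range_proj_sym range_proj_idem.
rewrite !rmorphB rmorph1 rmorphXn /=; ring.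
Qed.

(** The noncommutative Poisson kernel of W applied to k. *)
Definition poisson (r : R) k (a : word n) : K :=
  (r ^+ size a)%:C *: row_defect r (adj (opword W a) k).

Lemma poisson_cat r k a b :
  poisson r k (a ++ b) = (r ^+ size a)%:C *: poisson r (adj (opword W a) k) b.
Proof.
by rewrite /poisson scalerA -rmorphM -exprD size_cat adj_opword_cat.
Qed.

Definition shell k k' N : R[i] :=
  wsum N (fun a => hdot (adj (opword W a) k) (adj (opword W a) k')).

Lemma adj_rcons a i k : adj (opword W (rcons a i)) k = adj (W i) (adj (opword W a) k).
Proof.
by rewrite -cats1 adj_opword_cat //=.
Qed.

(** The sum telescopes, as the defect subtracts from each word its extensions by
    one letter. *)
Lemma poisson_dot_sum r k k' N : 0 <= r <= 1 ->
  word_sum N (fun a => hdot (poisson r k a) (poisson r k' a)) =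
  hdot k k' - (r ^+ (2 * N))%:C * shell k k' N.
Proof.
move=> r01; elim: N => [|N IHN].
  by rewrite /word_sum big_ord0 /shell wsum0 /= !adj_id mul1r subrr.
rewrite /word_sum big_ord_recr /= [X in X + _]IHN.
suff -> : wsum N (fun a => hdot (poisson r k a) (poisson r k' a)) =
    (r ^+ (2 * N))%:C * shell k k' N - (r ^+ (2 * N.+1))%:C * shell k k' N.+1.
  by rewrite addrA subrK.
rewrite /shell wsumSr -!wsum_mulr -wsumB; apply: eq_wsum => a aN.
rewrite /poisson dotZl dotZr conj_real row_defect_dot // aN.
under [in RHS]eq_bigr do rewrite !adj_rcons.
rewrite mulrA -rmorphM -exprD addnn -mul2n mulrBr mulrA -rmorphM -exprD.
by rewrite mulnS addnC.
Qed.

Lemma shell_sqr k N : wsum N (fun a => nm (adj (opword W a) k) ^+ 2) <= nm k ^+ 2.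
Proof.
elim: N => [|N IHN]; first by rewrite wsum0 /= adj_id.
apply: le_trans IHN; rewrite wsumSr; apply: wsum_ler => a _.
under eq_bigr do rewrite adj_rcons; exact: row_iso_adj_le.
Qed.

Lemma shell_le k k' N : nm (shell k k' N) <= nm k * nm k'.
Proof.
apply: le_trans (nm_sum _ _ _) _.
apply: le_trans (ler_sum (G := fun a : N.-tuple 'I_n =>
  nm (adj (opword W a) k) * nm (adj (opword W a) k')) _ _) _ => [a _|].
  exact: cauchy_schwarz.
apply: le_trans (sum_cauchy_schwarz _ _ _) _ => [a|a|]; rewrite ?nm_ge0 //.
have le x : Num.sqrt (\sum_(a : N.-tuple 'I_n) nm (adj (opword W a) x) ^+ 2) <= nm x.
  by rewrite -[leRHS]ger0_norm ?nm_ge0 // -sqrtr_sqr ler_wsqrtr // shell_sqr.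
by apply: ler_pM; rewrite ?sqrtr_ge0 // le.
Qed.

Lemma poisson_norm r k N : 0 <= r <= 1 ->
  Num.sqrt (word_sum N (fun a => nm (poisson r k a) ^+ 2)) <= nm k.
Proof.
move=> r01; rewrite -[leRHS]ger0_norm ?nm_ge0 // -sqrtr_sqr ler_wsqrtr //.
have -> : word_sum N (fun a => nm (poisson r k a) ^+ 2) =
    complex.Re (word_sum N (fun a => hdot (poisson r k a) (poisson r k a))).
  rewrite /word_sum cRe_sum; apply: eq_bigr => j _.
  by rewrite /wsum cRe_sum; apply: eq_bigr => a _; rewrite nm_sqr_Re.
rewrite poisson_dot_sum // cReD cReN cReM -nm_sqr_Re gerBl.
have /andP[r0 _] := r01; rewrite mulr_ge0 ?exprn_ge0 // /shell /wsum cRe_sum.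
by apply: sumr_ge0 => a _; rewrite -nm_sqr_Re sqr_ge0.
Qed.

Lemma poisson_dot_lim r k k' : 0 <= r < 1 ->
  tends \oo (fun N => word_sum N (fun a => hdot (poisson r k a) (poisson r k' a)))
    (hdot k k').
Proof.
move=> /andP[r0 r1]; have r01 : 0 <= r <= 1 by rewrite r0 ltW.
apply: (tends_squeeze (b := fun N => r ^+ N * (nm k * nm k'))).
  apply: nearW => N; rewrite poisson_dot_sum // addrAC subrr add0r nmN nmM nm_real.
  rewrite ger0_norm ?exprn_ge0 //; apply: ler_pM; rewrite ?exprn_ge0 ?nm_ge0 ?shell_le //.
  by rewrite mul2n -addnn exprD ler_piMr ?exprn_ge0 ?exprn_ile1 // ltW.
move=> d d0; have C0 : 0 < nm k * nm k' + 1 by rewrite ltr_wpDl ?mulr_ge0 ?nm_ge0.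
have : (fun N => r ^+ N) @ \oo --> (0 : R) by apply: cvg_expr; rewrite ger0_norm.
move/cvgrPdist_lt => /(_ (d / (nm k * nm k' + 1))).
rewrite divr_gt0 // => /(_ isT); apply: filterS => N.
rewrite sub0r normrN ger0_norm ?exprn_ge0 // ltr_pdivlMr // => h.
by apply: le_lt_trans h; rewrite ler_wpM2l ?exprn_ge0 // lerDl.
Qed.

End PoissonKernel.

(** * The universal representation of the creation operators *)

Lemma word_sum_exchange (R : realType) (n : nat) (I : Type) (s : seq I) (P : pred I) N
    (F : I -> word n -> R[i]) :
  word_sum N (fun a => \sum_(p <- s | P p) F p a) = \sum_(p <- s | P p) word_sum N (F p).
Proof.
rewrite /word_sum exchange_big; apply: eq_bigr => k _.
exact: wsum_exchange.
Qed.

Lemma word_sum_mulr (R : realType) (n : nat) (c : R[i]) N (F : word n -> R[i]) :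
  word_sum N (fun a => c * F a) = c * word_sum N F.
Proof. by rewrite mulr_sumr; apply: eq_bigr => k _; exact: wsum_mulr. Qed.

Lemma tends_expr_left (R : realType) m (c : R[i]) :
  tends (1 : R)^'- (fun r : R => (r ^+ m)%:C * c) ((1 ^+ m)%:C * c).
Proof.
have h : (fun r : R => r ^+ m) @ (1 : R)^'- --> (1 : R) ^+ m.
  by apply: cvg_at_left_filter; exact: exprn_continuous.
apply: (tends_squeeze (b := fun r => `|1 ^+ m - r ^+ m| * nm c)).
  by apply: nearW => r; rewrite -mulrBl -rmorphB nmM nm_real distrC.
move=> d d0; have c0 : 0 < nm c + 1 by rewrite ltr_wpDl ?nm_ge0.
move/cvgrPdist_lt: h => /(_ (d / (nm c + 1))); rewrite divr_gt0 // => /(_ isT).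
apply: filterS => r; rewrite ltr_pdivlMr //; apply: le_lt_trans.
by rewrite ler_wpM2l // lerDl.
Qed.

Section UniversalNorm.
Context {R : realType} {n : nat} {E K : hilbertType R}.
Variables (e : word n -> E) (e_basis : orthonormal_basis e).
Variables (L : 'I_n -> E -> E) (Lb : forall i, bounded_op (L i)).
Hypothesis Le : forall i a, L i (e a) = e (i :: a).
Variables (W : 'I_n -> K -> K) (Wb : forall i, bounded_op (W i)).
Hypothesis W_iso : forall i j x, adj (W i) (W j x) = (i == j)%:R *: x.

(** The von Neumann inequality for *-polynomials. Paired with the Poisson kernels of
    k and k', the matrix of p(L) yields <p(W) k, k'> with the factor r^(|a| + |b|) in
    front of the monomial W_a W_b^*. The amplification of p(L) bounds the pairing by
    M |k| |k'| for every r < 1. *)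
Lemma star_ev_opb (s : @starpoly R n) (M : R) : 0 <= M ->
  opb M (star_ev L s) -> opb M (star_ev W s).
Proof.
move=> M0 LM.
suff key k k' : nm (hdot (star_ev W s k) k') <= M * (nm k * nm k').
  move=> k; set y := star_ev W s k; have := key k y.
  rewrite dotxx nm_real ger0_norm ?sqr_ge0 //.
  have := nm_ge0 y; rewrite le_eqVlt => /orP[/eqP <- _|y0].
    by rewrite mulr_ge0 ?nm_ge0.
  by rewrite expr2 mulrA ler_pM2r.
pose b (r : R) := \sum_(p <- s) p.1 * ((r ^+ (size p.2.2 + size p.2.1))%:C *
  hdot (adj (opword W p.2.2) k) (adj (opword W p.2.1) k')).
have b1 : hdot (star_ev W s k) k' = b 1.
  rewrite /star_ev fct_sumE dot_suml; apply: eq_bigr => p _.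
  by rewrite fctE dotZl expr1n mul1r /= -adjP //; exact: bounded_opword.
have br r : 0 < r < 1 -> nm (b r) <= M * (nm k * nm k').
  move=> /andP[r0 r1]; have r01 : 0 <= r <= 1 by rewrite !ltW.
  (* The second sum has to contain a ++ d whenever the first contains b ++ d. *)
  pose P := \max_(p <- s) size p.2.1.
  pose u N := word_sum N (fun a => word_sum (N + P) (fun c =>
    hdot (star_ev L s (e a)) (e c) * hdot (poisson W r k a) (poisson W r k' c))).
  have ub : tends \oo u (b r).
    pose t (p : R[i] * (word n * word n)) N := word_sum N (fun a => word_sum (N + P) (fun c =>
      hdot (opword L p.2.1 (adj (opword L p.2.2) (e a))) (e c) *
      hdot (poisson W r k a) (poisson W r k' c))).
    have uE N : u N = \sum_(p <- s) p.1 * t p N.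
      transitivity (word_sum N (fun a => \sum_(p <- s) word_sum (N + P) (fun c =>
          p.1 * (hdot (opword L p.2.1 (adj (opword L p.2.2) (e a))) (e c) *
                 hdot (poisson W r k a) (poisson W r k' c))))).
        apply: eq_word_sum => a _; rewrite -word_sum_exchange.
        apply: eq_word_sum => c _; rewrite /star_ev fct_sumE dot_suml mulr_suml.
        by apply: eq_bigr => p _; rewrite fctE dotZl mulrA.
      rewrite word_sum_exchange; apply: eq_bigr => p _; rewrite -word_sum_mulr.
      by apply: eq_word_sum => a _; rewrite word_sum_mulr.
    apply: (tends_eq (u := fun N => \sum_(p <- s) p.1 * t p N)) => [N|].
      by rewrite uE.
    rewrite /b big_seq; under [X in tends _ X _]funext do rewrite big_seq.
    apply: tends_sum => p ps; apply: tendsM; apply: (tends_shift (N := size p.2.2)).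
    have pP : (size p.2.1 <= P)%N by exact: leq_bigmax_seq.
    have lim := poisson_dot_lim Wb W_iso (adj (opword W p.2.2) k) (adj (opword W p.2.1) k').
    have {}lim := lim r; rewrite (ltW r0) r1 in lim.
    apply: tends_eq (tendsM _ (lim isT)) => N.
    rewrite /t [(N + size p.2.2)%N]addnC (star_monomial_sum e_basis Lb Le); last first.
      by rewrite addnC leq_add ?leq_addl.
    rewrite -word_sum_mulr; apply: eq_word_sum => a _.
    by rewrite !poisson_cat // dotZl dotZr conj_real mulrA -rmorphM -exprD.
  apply: (nm_tends_le ub); apply: nearW => N.
  apply: le_trans (amplification e_basis _ _ _ _ (star_ev_bounded Lb s) M0 LM) _.
  by rewrite ler_wpM2l // ler_pM ?sqrtr_ge0 // poisson_norm.
rewrite b1; apply: (nm_tends_le (F := (1 : R)^'-) (u := b)).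
  by apply: tends_sum => p _; apply: tendsM; exact: tends_expr_left.
exact: filterS br (near_left1 ltr01).
Qed.

End UniversalNorm.

Lemma ncvg_adj (R : realType) (H : hilbertType R) (I : Type) (F : set_system I)
    {FF : Filter F} (T : I -> H -> H) A :
  (forall t, bounded_op (T t)) -> bounded_op A -> ncvg F T A ->
  ncvg F (fun t => adj (T t)) (adj A).
Proof.
move=> Tb Ab TA d d0; apply: filterS (TA _ d0) => t Td.
have -> : adj (T t) - adj A = adj (T t - A).
  by rewrite [T t - A]addrC -[- A]scaleN1r adjZD // rmorphN1 scaleN1r addrC.
by apply: opb_adj => //; [exact: boundedB | exact: ltW].
Qed.

Section UniversalRepresentation.
Context {R : realType} {n : nat} {E K : hilbertType R}.
Variables (e : word n -> E) (e_basis : orthonormal_basis e).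
Variables (L : 'I_n -> E -> E) (Lb : forall i, bounded_op (L i)).
Hypothesis Le : forall i a, L i (e a) = e (i :: a).
Variables (W : 'I_n -> K -> K) (Wb : forall i, bounded_op (W i)).
Hypothesis W_iso : forall i j x, adj (W i) (W j x) = (i == j)%:R *: x.

Let L_iso := adj_creation e_basis Lb Le.
Let Lsb := star_ev_bounded Lb.
Let Wsb := star_ev_bounded Wb.

(** The graph of the representation: limits of the same *-polynomials. *)
Definition toeplitz_rel (A : E -> E) (B : K -> K) : Prop :=
  [/\ bounded_op A, bounded_op B & exists s : nat -> @starpoly R n,
    ncvg \oo (fun m => star_ev L (s m)) A /\ ncvg \oo (fun m => star_ev W (s m)) B].

Definition toeplitz : set (E -> E) := [set A | bounded_op A /\
  exists s : nat -> @starpoly R n, ncvg \oo (fun m => star_ev L (s m)) A].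

Lemma star_ev_sub (H : hilbertType R) (Y : 'I_n -> H -> H) (s t : @starpoly R n) :
  star_ev Y s - star_ev Y t = star_ev Y (s ++ star_scale (-1) t).
Proof. by rewrite star_ev_cat star_ev_scale scaleN1r. Qed.

Lemma toeplitz_rel_ex A : toeplitz A -> exists B, toeplitz_rel A B.
Proof.
move=> [Ab [s sA]]; have [|d d0|B Bb sB] := @op_complete R K K (fun m => star_ev W (s m)).
- by move=> m; exact: Wsb.
- have [N _ sN] := sA _ (divr_gt0 d0 (ltr0n _ 2)).
  exists N => i j Ni Nj; rewrite star_ev_sub.
  apply: (star_ev_opb e_basis Lb Le Wb W_iso (ltW d0)); rewrite -star_ev_sub.
  have -> : star_ev L (s i) - star_ev L (s j) =
      (star_ev L (s i) - A) + - (star_ev L (s j) - A).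
    by rewrite opprB addrA subrK.
  by rewrite [d]splitr; apply: opbD; [exact: sN | apply: opbN; exact: sN].
by exists B; split=> //; exists s.
Qed.

Lemma toeplitz_rel_in A B : toeplitz_rel A B -> toeplitz A.
Proof. by move=> [Ab _ [s [sA _]]]; split=> //; exists s. Qed.

Lemma toeplitz_rel_opb A B (M : R) : 0 <= M -> toeplitz_rel A B -> opb M A -> opb M B.
Proof.
move=> M0 [Ab Bb [s [sA sB]]] AM x; apply/ler_addgt0Pr => d d0.
have x0 : 0 < nm x + 1 by rewrite ltr_wpDl ?nm_ge0.
pose c := d / (nm x + 1); have c0 : 0 < c by rewrite divr_gt0.
have Bc : opb (M + c) B.
  apply: (ncvg_opb sB); apply: filterS (sA _ c0) => m sc.
  apply: (star_ev_opb e_basis Lb Le Wb W_iso); first by rewrite addr_ge0 // ltW.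
  rewrite -[star_ev L (s m)](subrK A) addrC; exact: opbD.
apply: le_trans (Bc x) _; rewrite mulrDl lerD2l /c mulrAC ler_pdivrMr // ler_wpM2l ?ltW //.
by rewrite ltrDl.
Qed.

Lemma toeplitz_rel_lin (c : R[i]) A B A' B' : toeplitz_rel A B -> toeplitz_rel A' B' ->
  toeplitz_rel (c *: A + A') (c *: B + B').
Proof.
move=> [Ab Bb [s [sA sB]]] [A'b B'b [t [tA tB]]].
split; [exact: boundedP_lin | exact: boundedP_lin|].
exists (fun m => star_scale c (s m) ++ t m).
have evE (H : hilbertType R) (Y : 'I_n -> H -> H) :
    (fun m => star_ev Y (star_scale c (s m) ++ t m)) =
    (fun m => c *: star_ev Y (s m) + star_ev Y (t m)).
  by apply: funext => m; rewrite star_ev_cat star_ev_scale.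
by rewrite !evE; split; apply: ncvgD => //; exact: ncvgZ.
Qed.

Lemma toeplitz_rel_uniq A B B' : toeplitz_rel A B -> toeplitz_rel A B' -> B = B'.
Proof.
move=> AB AB'; have := toeplitz_rel_lin (-1) AB AB'.
rewrite !scaleN1r addNr => /(toeplitz_rel_opb (lexx 0)) h.
have {}h : opb 0 (- B + B') by apply: h => x; rewrite nm0 mul0r.
apply/funext => x; apply/esym/eqP; rewrite -subr_eq0 addrC; apply/eqP/nm_eq0/eqP.
by rewrite eq_le nm_ge0 andbT; have := h x; rewrite mul0r.
Qed.

Lemma toeplitz_rel_star s : toeplitz_rel (star_ev L s) (star_ev W s).
Proof.
split; [exact: Lsb | exact: Wsb |].
by exists (fun=> s); split=> d d0; apply: nearW => _ x;
  rewrite subrr nm0 mulr_ge0 ?nm_ge0 // ltW.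
Qed.

Lemma toeplitz_rel_comp A B A' B' : toeplitz_rel A B -> toeplitz_rel A' B' ->
  toeplitz_rel (A \o A') (B \o B').
Proof.
move=> [Ab Bb [s [sA sB]]] [A'b B'b [t [tA tB]]].
split; [exact: bounded_comp | exact: bounded_comp |].
exists (fun m => star_mul (s m) (t m)).
have evE (H : hilbertType R) (Y : 'I_n -> H -> H) (Yb : forall i, bounded_op (Y i)) :
    (forall i j x, adj (Y i) (Y j x) = (i == j)%:R *: x) ->
    (fun m => star_ev Y (star_mul (s m) (t m))) =
    (fun m => star_ev Y (s m) \o star_ev Y (t m)).
  by move=> Yi; apply: funext => m; rewrite star_ev_mul.
by rewrite !evE //; split; apply: ncvg_comp => //; apply: nearW => m;
  exact/bounded_linear/star_ev_bounded.
Qed.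

Lemma toeplitz_rel_adj A B : toeplitz_rel A B -> toeplitz_rel (adj A) (adj B).
Proof.
move=> [Ab Bb [s [sA sB]]]; split; [exact: bounded_adj | exact: bounded_adj |].
exists (fun m => star_adj (s m)).
have evE (H : hilbertType R) (Y : 'I_n -> H -> H) (Yb : forall i, bounded_op (Y i)) :
    (fun m => star_ev Y (star_adj (s m))) = (fun m => adj (star_ev Y (s m))).
  by apply: funext => m; rewrite star_ev_adj.
by rewrite !evE //; split; apply: ncvg_adj => // m; exact: star_ev_bounded.
Qed.

Lemma toeplitz_lim (A : nat -> E -> E) B : (forall m, toeplitz (A m)) ->
  bounded_op B -> ncvg \oo A B -> toeplitz B.
Proof.
move=> AT Bb AB; split=> //.
have ex m : exists s : @starpoly R n, opb m.+1%:R^-1 (star_ev L s - A m).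
  have [_ [s sA]] := AT m.
  have [N _ sN] := sA m.+1%:R^-1 ltac:(by rewrite invr_gt0).
  by exists (s N); apply: sN => /=.
have [s sP] := choice ex; exists s => d d0.
have d2 : 0 < d / 2 by rewrite divr_gt0.
have [N Nd] := invrn_lt_exists d2.
apply: filterS2 (AB _ d2) (nbhs_infty_ge N) => m Am Nm.
have -> : star_ev L (s m) - B = (star_ev L (s m) - A m) + (A m - B) by rewrite addrA subrK.
rewrite [d]splitr; apply: opbD => //; apply: opb_le (sP m).
by apply: le_trans (ltW Nd); rewrite lef_pV2 ?posrE // ler_nat.
Qed.

Definition toeplitz_rep (A : E -> E) : K -> K := xget 0 [set B | toeplitz_rel A B].

Lemma toeplitz_repP A : toeplitz A -> toeplitz_rel A (toeplitz_rep A).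
Proof.
move=> AT; rewrite /toeplitz_rep; case: xgetP => [B -> //|no].
by have [B AB] := toeplitz_rel_ex AT; case: (no B AB).
Qed.

Lemma toeplitz_repE A B : toeplitz_rel A B -> toeplitz_rep A = B.
Proof.
by move=> AB; apply: (toeplitz_rel_uniq _ AB); exact/toeplitz_repP/(toeplitz_rel_in AB).
Qed.

Lemma toeplitz_rel_id : toeplitz_rel id id.
Proof.
have evE (H : hilbertType R) (Y : 'I_n -> H -> H) :
    star_ev Y [:: (1, ([::], [::]))] = id.
  by rewrite /star_ev big_seq1 scale1r /= adj_id.
by rewrite -(evE _ L) -(evE _ W); exact: toeplitz_rel_star.
Qed.

Lemma toeplitz_rel_gen i : toeplitz_rel (L i) (W i).
Proof.
have evE (H : hilbertType R) (Y : 'I_n -> H -> H) :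
    star_ev Y [:: (1, ([:: i], [::]))] = Y i.
  by rewrite /star_ev big_seq1 scale1r /= adj_id.
by rewrite -(evE _ L) -(evE _ W); exact: toeplitz_rel_star.
Qed.

Lemma toeplitz_subalgebra : Cstar_subalgebra toeplitz.
Proof.
split.
- by move=> A [].
- exact: toeplitz_rel_in toeplitz_rel_id.
- move=> c A B /toeplitz_repP hA /toeplitz_repP hB.
  exact: toeplitz_rel_in (toeplitz_rel_lin c hA hB).
- move=> A B /toeplitz_repP hA /toeplitz_repP hB.
  exact: toeplitz_rel_in (toeplitz_rel_comp hA hB).
split=> [A /toeplitz_repP hA|A B AT Bb AB].
  exact: toeplitz_rel_in (toeplitz_rel_adj hA).
by apply: (toeplitz_lim AT Bb); apply/norm_cvgP => //; apply: nearW => m; case: (AT m).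
Qed.

Lemma toeplitz_rep_star : unital_star_rep toeplitz toeplitz_rep.
Proof.
split.
- by move=> A /toeplitz_repP[].
- exact: toeplitz_repE toeplitz_rel_id.
- move=> c A B /toeplitz_repP hA /toeplitz_repP hB.
  exact: toeplitz_repE (toeplitz_rel_lin c hA hB).
- move=> A B /toeplitz_repP hA /toeplitz_repP hB.
  exact: toeplitz_repE (toeplitz_rel_comp hA hB).
by move=> A /toeplitz_repP hA; exact: toeplitz_repE (toeplitz_rel_adj hA).
Qed.

(** By [star_ev_opb] the map p(L) -> p(W) is contractive, hence extends to norm
    limits. *)
Lemma universal_representation : exists (S : set (E -> E)) (pi : (E -> E) -> (K -> K)),
  [/\ Cstar_subalgebra S, forall i, S (L i), unital_star_rep S pi &
      forall i, pi (L i) = W i].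
Proof.
exists toeplitz, toeplitz_rep; split.
- exact: toeplitz_subalgebra.
- by move=> i; exact: toeplitz_rel_in (toeplitz_rel_gen i).
- exact: toeplitz_rep_star.
by move=> i; exact: toeplitz_repE (toeplitz_rel_gen i).
Qed.

End UniversalRepresentation.

(** * Minimal isometric dilations *)

Section RowDefect.
Context {R : realType} {n : nat} {H : hilbertType R}.
Variables (F : 'I_n -> H -> H) (Fb : forall i, bounded_op (F i)).
Hypothesis F_row : row_contraction F.

(** The row F on the sum of n copies of H, realised as the first n entries of
    [ell2 H]; its adjoint is the column [col_op]. *)
Definition row_op (x : ell2 H) : H := \sum_i F i (val x i).
Definition col_op (h : H) : ell2 H := \sum_(i < n) slot i (adj (F i) h).

Lemma col_row_dot h x : hdot (col_op h) x = hdot h (row_op x).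
Proof.
by rewrite dot_suml dot_sumr; apply: eq_bigr => i _; rewrite dot_slotl adjPl.
Qed.

Lemma row_op_le x : nm (row_op x) <= nm x.
Proof.
apply: le_of_sqr; first exact: nm_ge0.
apply: le_trans (row_contraction_sqr F_row _) _.
by rewrite [leRHS]nm_sqr_Re; exact: sqsum_le.
Qed.

Lemma col_op_le h : nm (col_op h) <= nm h.
Proof.
have [->|c0] := eqVneq (nm (col_op h)) 0; first exact: nm_ge0.
have cp : 0 < nm (col_op h) by rewrite lt_neqAle eq_sym c0 nm_ge0.
rewrite -(ler_pM2r cp) -expr2 nm_sqr_Re col_row_dot.
apply: le_trans (real_cauchy_schwarz _ _) _.
by rewrite ler_wpM2l ?nm_ge0 ?row_op_le.
Qed.

Lemma row_op_linear : linear row_op.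
Proof.
move=> a x y; rewrite /row_op scaler_sumr -big_split; apply: eq_bigr => i _ /=.
by rewrite -(linZ (bounded_linear (Fb i))) -(linD (bounded_linear (Fb i))).
Qed.

Lemma row_op_slot (i : 'I_n) h : row_op (slot i h) = F i h.
Proof.
rewrite /row_op (bigD1 i) //= eqxx big1 ?addr0 // => j ji.
rewrite (_ : (j == i :> nat) = false) ?lin0 //; [exact: bounded_linear | exact/negbTE].
Qed.

(** D i is the restriction to the i-th summand of the defect operator
    (1 - F^* F)^(1/2) of the row F. *)
Lemma defect_vectors : exists D : 'I_n -> H -> ell2 H, forall i j h h',
  hdot (D i h) (D j h') = (i == j)%:R * hdot h h' - hdot (F i h) (F j h').
Proof.
pose A := col_op \o row_op.
have A1 : opb 1 A.
  by move=> x; rewrite mul1r; apply: le_trans (col_op_le _) (row_op_le _).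
have AE x y : hdot (A x) y = hdot (row_op x) (row_op y) by exact: col_row_dot.
have Ab : bounded_op A.
  apply/bounded_opP; split; last by exists 1.
  move=> a x y; apply: dot_ext => w.
  by rewrite dotDl dotZl !AE row_op_linear dotDl dotZl.
have Asym x y : hdot (A x) y = hdot x (A y).
  by rewrite AE [RHS]dotC AE -dotC.
have [d [_ dsym dd]] := sqrt_defect (@Cstar_all R (ell2 H)) Ab Asym A1.
exists (fun i h => d (slot i h)) => i j h h'.
by rewrite -dsym dd dotBl AE dot_slot !row_op_slot val_eqE.
Qed.

End RowDefect.

Section SubspaceSpan.
Context {R : realType} {X : hilbertType R} {I : Type} (v : I -> X).

Definition span_subspace : closed_subspace X :=
  ClosedSubspace (closed_span_is (range v)) (@closed_span_closed R X (range v)).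

Lemma span_subspace_proof i : v i \in cpred span_subspace.
Proof. by apply/cpredP; apply: (@closed_span_gen R X (range v)); exists i. Qed.

Definition span_vec i : subspace_type span_subspace :=
  exist (fun x : X => x \in cpred span_subspace) _ (span_subspace_proof i).

Lemma span_vec_total : closed_span (range span_vec) = setT.
Proof.
rewrite -subTset => x _; apply: (closed_approx (@closed_span_closed _ _ _)) => d d0.
have /cpredP/closed_span_approx/(_ _ d0)[s xs] := valP x.
exists (lincomb span_vec s).
  rewrite /lincomb; elim: s {xs} => [|p s IHs].
    by rewrite big_nil; case: (closed_span_is (range span_vec)).
  rewrite big_cons; case: (closed_span_is (range span_vec)) => _; apply=> //.
  by apply: (@closed_span_gen _ _ (range span_vec)); exists p.2.
rewrite sub_nmE; have -> : val (x - lincomb span_vec s) = val x - lincomb v s; last by [].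
have -> : val (x - lincomb span_vec s) = val x - val (lincomb span_vec s) by [].
by congr (_ - _); rewrite /lincomb; elim: s {xs} => [|p s IHs];
   rewrite ?big_nil // !big_cons -IHs.
Qed.

(** The closed span of v. It is kept abstract, as only its inner products matter. *)
Lemma span_hilbert : exists (K : hilbertType R) (u : I -> K),
  closed_span (range u) = setT /\ forall p q, hdot (u p) (u q) = hdot (v p) (v q).
Proof. by exists (subspace_type span_subspace), span_vec; split=> //; exact: span_vec_total. Qed.

End SubspaceSpan.

Section IsometricDilation.
Context {R : realType} {n : nat} {H : hilbertType R}.
Variables (F : 'I_n -> H -> H) (D : 'I_n -> H -> ell2 H).
Hypothesis D_dot : forall i j h h',
  hdot (D i h) (D j h') = (i == j)%:R * hdot h h' - hdot (F i h) (F j h').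

(** The component of W_a h in the Fock space with coefficients in the defect space,
    listed by words: each letter shifts the words and adds a defect vector at the
    empty word. *)
Fixpoint dilation_tail (a : word n) (h : H) : seq (word n * ell2 H) :=
  if a is i :: b then
    ([::], D i (opword F b h)) :: [seq (i :: p.1, p.2) | p <- dilation_tail b h]
  else [::].

(** Schaeffer's form of W_a h: the entry at 0 holds the component in H (itself at
    entry 0 of [ell2 H]), the entry at [(pickle w).+1] the coefficient of w. *)
Definition dilation_vec (q : word n * H) : ell2 (ell2 H) :=
  slot 0 (slot 0 (opword F q.1 q.2)) +
  \sum_(p <- dilation_tail q.1 q.2) slot (pickle p.1).+1 p.2.

Definition tail_dot (s t : seq (word n * ell2 H)) : R[i] :=
  \sum_(p <- s) \sum_(q <- t) (p.1 == q.1)%:R * hdot p.2 q.2.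

Lemma dilation_vec_dot p q : hdot (dilation_vec p) (dilation_vec q) =
  hdot (opword F p.1 p.2) (opword F q.1 q.2) +
  tail_dot (dilation_tail p.1 p.2) (dilation_tail q.1 q.2).
Proof.
rewrite /dilation_vec dotDl !dotDr !dot_slot eqxx !mul1r.
rewrite dot_sumr big1 ?addr0 => [|r _]; last by rewrite dot_slot mul0r.
rewrite dot_suml big1 ?add0r => [|r _]; last by rewrite dot_slot mul0r.
congr (_ + _); rewrite dot_suml; apply: eq_bigr => r _; rewrite dot_sumr.
apply: eq_bigr => s _; rewrite dot_slot eqSS.
by rewrite (inj_eq (pcan_inj pickleK)).
Qed.

Lemma tail_dot_cons i j x y s t :
  tail_dot (([::], x) :: [seq (i :: p.1, p.2) | p <- s])
           (([::], y) :: [seq (j :: p.1, p.2) | p <- t]) =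
  hdot x y + (i == j)%:R * tail_dot s t.
Proof.
rewrite /tail_dot big_cons big_map; congr (_ + _).
  by rewrite big_cons big_map mul1r big1 ?addr0 // => r _; rewrite mul0r.
rewrite mulr_sumr; apply: eq_bigr => r _; rewrite big_cons big_map mul0r add0r.
rewrite mulr_sumr; apply: eq_bigr => q _.
by rewrite eqseq_cons -mulnb natrM mulrA.
Qed.

Lemma dilation_vec_cons i j a b h h' :
  hdot (dilation_vec (i :: a, h)) (dilation_vec (j :: b, h')) =
  (i == j)%:R * hdot (dilation_vec (a, h)) (dilation_vec (b, h')).
Proof.
rewrite !dilation_vec_dot tail_dot_cons D_dot mulrDr addrA; congr (_ + _).
by rewrite addrC subrK.
Qed.

Lemma dilation_vec_nil h q :
  hdot (dilation_vec ([::], h)) (dilation_vec q) = hdot h (opword F q.1 q.2).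
Proof. by rewrite dilation_vec_dot /tail_dot big_nil addr0. Qed.

Lemma isometric_of_dot (K : hilbertType R) (J : H -> K) :
  (forall h h', hdot (J h) (J h') = hdot h h') -> isometric J.
Proof.
move=> JJ; split=> // a x y; apply/eqP; rewrite -subr_eq0; apply/eqP/nm_eq0/eqP.
rewrite -sqrf_eq0 nm_sqr_Re !(dotBl, dotBr, dotDl, dotDr, dotZl, dotZr) !JJ.
by rewrite !(dotDl, dotDr, dotZl, dotZr); apply/eqP; rewrite (_ : _ - _ = 0) //; ring.
Qed.

(** By [dilation_vec_cons], prepending the letter i preserves inner products, so it
    defines the isometry W_i on the closed span. *)
Lemma isometric_dilation_ex : (forall i, bounded_op (F i)) ->
  exists (K : hilbertType R) (J : H -> K) (W : 'I_n -> K -> K),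
  minimal_isometric_dilation F J W.
Proof.
move=> Fb; have [K [u [uT uu]]] := span_hilbert dilation_vec.
have ex i : exists W, isometric W /\ forall a h, W (u (a, h)) = u (i :: a, h).
  have [|W Wi Wu] := gram_isometry (w := fun p => u (i :: p.1, p.2)) _ uT.
    by move=> [a h] [b h']; rewrite !uu dilation_vec_cons eqxx mul1r.
  by exists W; split=> // a h; rewrite Wu.
have [W WP] := choice ex; have Wb i : bounded_op (W i).
  by apply: bounded_isometric; case: (WP i).
have Wu i a h : W i (u (a, h)) = u (i :: a, h) by case: (WP i) => _ ->.
exists K, (fun h => u ([::], h)), W.
have opu a h : opword W a (u ([::], h)) = u (a, h) by elim: a => //= i a ->.
split=> //.
- by apply: isometric_of_dot => h h'; rewrite uu dilation_vec_nil.
- move=> i j x; have E : adj (W i) \o W j = (i == j)%:R *: id.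
    apply: (bounded_eq_span _ _ uT) => [||[a h]].
    + by apply: bounded_comp => //; exact: bounded_adj.
    + by apply: boundedZ; exact: bounded_id.
    apply: (dot_eq_span uT) => -[b h']; rewrite fctE adjPl // !Wu uu dilation_vec_cons.
    by rewrite eq_sym [in RHS]fctE dotZl uu.
  exact: (congr1 (fun T => T x) E).
- move=> i h; apply: (dot_eq_span uT) => -[a h'].
  by rewrite adjPl // Wu !uu !dilation_vec_nil /= adjPl.
rewrite /cyclic_for -subTset -uT; apply: closed_span_sub.
- exact: closed_span_is.
- exact: closed_span_closed.
move=> _ [[a h] _ <-]; apply: (@closed_span_gen _ _ (\bigcup_a _)); exists a => //; exists h => //.
by rewrite /= opu.
Qed.

End IsometricDilation.

(** * Dilations and evaluations *)

Lemma evals_bounded (R : realType) (n : nat) (H : hilbertType R) (Y F : 'I_n -> H -> H)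
  (f : 'I_n -> ncseries R n) : evals f Y F -> forall i, bounded_op (F i).
Proof. by move=> [YF|YF] i; case: (YF i). Qed.

Section RepresentationEvaluation.
Context {R : realType} {n : nat} {E K : hilbertType R}.
Variables (S : set (E -> E)) (SC : Cstar_subalgebra S).
Variables (pi : (E -> E) -> (K -> K)) (pi_rep : unital_star_rep S pi).
Variables (Y : 'I_n -> E -> E) (SY : forall i, S (Y i)).
Implicit Types (psi : ncseries R n) (f : 'I_n -> ncseries R n).

Lemma rep_series psi A : bounded_op A -> ncvg \oo (psum psi Y) A ->
  S A /\ ncvg \oo (psum psi (fun i => pi (Y i))) (pi A).
Proof.
move=> Ab YA; have Sp m : S (psum psi Y m) by apply: (Cstar_psum SC).
have SA : S A by exact: (Cstar_lim SC Sp).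
split=> //; have -> : psum psi (fun i => pi (Y i)) = fun m => pi (psum psi Y m).
  by apply: funext => m; rewrite (rep_psum SC pi_rep).
by apply: (rep_ncvg SC pi_rep) => //; exact: nearW.
Qed.

End RepresentationEvaluation.

Section RepresentationNormEvaluation.
Context {R : realType} {n : nat} {E K : hilbertType R}.
Variables (S : set (E -> E)) (SC : Cstar_subalgebra S).
Variables (pi : (E -> E) -> (K -> K)) (pi_rep : unital_star_rep S pi).
Variables (Y : 'I_n -> E -> E) (SY : forall i, S (Y i)).

(** Representations are norm continuous, so they commute with evaluations that
    converge in norm. *)
Lemma rep_norm_evals (f : 'I_n -> ncseries R n) F : norm_evals Y f F ->
  (forall i, S (F i)) /\ norm_evals (fun i => pi (Y i)) f (fun i => pi (F i)).
Proof.
move=> [Fb [YF|YF]].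
  have FP i := rep_series SC pi_rep SY (Fb i) (YF i).
  split=> [i|]; first by case: (FP i).
  split=> [i|]; first by apply: (rep_bounded pi_rep); case: (FP i).
  by left=> i; case: (FP i).
have scale r i : pi (opscale r Y i) = opscale r (fun i => pi (Y i)) i.
  by rewrite /opscale (repZ SC pi_rep).
have Ss r i : S (opscale r Y i) by exact: (CstarZ SC).
have FP i : exists d : R, exists B : R -> E -> E, [/\ 0 < d < 1,
    forall r, d < r < 1 -> S (B r) /\
      ncvg \oo (psum (f i) (opscale r (fun i => pi (Y i)))) (pi (B r)),
    S (F i) & ncvg (1 : R)^'- B (F i)].
  have [d [B [d01 BP BF]]] := YF i; have /andP[d0 d1] := d01.
  have BP' r : d < r < 1 -> S (B r) /\
      ncvg \oo (psum (f i) (opscale r (fun i => pi (Y i)))) (pi (B r)).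
    move=> /BP[Bb YB]; have [SB lim] := rep_series SC pi_rep (Ss r) Bb YB.
    split=> //; rewrite (_ : opscale r _ = fun i => pi (opscale r Y i)) //.
    by apply: funext => j; rewrite scale.
  exists d, B; split=> //.
  have ex m : exists r, d < r < 1 /\ opb m.+1%:R^-1 (B r - F i).
    have m0 : 0 < m.+1%:R^-1 :> R by rewrite invr_gt0.
    exact: near_ex2 (near_left1 d1) (BF _ m0).
  have [s sP] := choice ex; apply: (Cstar_lim SC (T := fun m => B (s m))) => //.
    by move=> m; have [/BP'[]] := sP m.
  move=> c c0; have [N Nc] := invrn_lt_exists c0; exists N => // m /= Nm.
  have [_ h] := sP m; apply: opb_le h; apply: le_trans (ltW Nc).
  by rewrite lef_pV2 ?posrE // ler_nat.
split=> [i|]; first by have [d [B []]] := FP i.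
split=> [i|]; first by have [d [B [_ _ SF _]]] := FP i; exact: (rep_bounded pi_rep).
right=> i; have [d [B [d01 BP SF BF]]] := FP i; have /andP[_ d1] := d01.
exists d, (fun r => pi (B r)); split=> //.
  by move=> r /BP[SB lim]; split=> //; exact: (rep_bounded pi_rep).
apply: (rep_ncvg SC pi_rep) => //.
by apply: filterS (near_left1 d1) => r /BP[].
Qed.

End RepresentationNormEvaluation.

Section Compression.
Context {R : realType} {n : nat} {H K : hilbertType R}.
Variables (J : H -> K) (J_iso : isometric J).
Variables (J' : K -> H) (J'b : bounded_op J').
Hypothesis JJ' : forall h k, hdot (J h) k = hdot h (J' k).

Lemma adj_isometry h : J' (J h) = h.
Proof. by apply: dot_extr => x; rewrite -JJ'; case: J_iso => _ ->. Qed.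

(** In terms of the adjoint J' of the inclusion, which is the compression to H. *)
Lemma coextendsP (T : 'I_n -> H -> H) (V : 'I_n -> K -> K) :
  (forall i, bounded_op (T i)) -> (forall i, bounded_op (V i)) ->
  coextends T J V <-> forall i k, J' (V i k) = T i (J' k).
Proof.
move=> Tb Vb; split=> TV i.
  by move=> k; apply: dot_extr => h; rewrite -JJ' -adjPl // TV JJ' adjPl.
by move=> h; apply: dot_ext => k; rewrite adjPl // !JJ' TV adjPl.
Qed.

Section Intertwined.
Variables (T : 'I_n -> H -> H) (V : 'I_n -> K -> K).
Hypothesis TV : forall i k, J' (V i k) = T i (J' k).

Lemma compress_psum psi m k : J' (psum psi V m k) = psum psi T m (J' k).
Proof.
have J'l := bounded_linear J'b.
have word a x : J' (opword V a x) = opword T a (J' x).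
  by elim: a x => //= i a IHa x; rewrite TV IHa.
rewrite !psumE (lin_sum J'l); apply: eq_bigr => j _.
rewrite /hpart /wsum (lin_sum J'l); apply: eq_bigr => a _.
by rewrite (linZ J'l) word.
Qed.

End Intertwined.

(** J' carries every partial sum of f_i(V) to that of f_i(T), so the limits
    correspond as well; f(T) is unique. *)
Lemma compress_evals (T : 'I_n -> H -> H) (V G : 'I_n -> K -> K)
    (f : 'I_n -> ncseries R n) (F : 'I_n -> H -> H) :
  (forall i, bounded_op (T i)) -> (forall i, bounded_op (V i)) ->
  (forall i k, J' (V i k) = T i (J' k)) -> evals f V G -> evals f T F ->
  forall i k, J' (G i k) = F i (J' k).
Proof.
move=> Tb Vb TV VG TF.
have Jb := bounded_isometric J_iso.
have lim (I : Type) (Fl : set_system I) (FF : ProperFilter Fl) (P : I -> K -> K)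
    (Q : I -> H -> H) A B : (\forall t \near Fl, forall k, J' (P t k) = Q t (J' k)) ->
    (forall x, tends Fl (fun t => P t x) (A x)) ->
    (forall x, tends Fl (fun t => Q t x) (B x)) -> forall k, J' (A k) = B (J' k).
  move=> PQ PA QB k; apply: (tends_unique _ (QB (J' k))).
  by apply: tends_near (tends_op J'b (PA k)); apply: filterS PQ => t ->.
have TVs r i k : J' (opscale r V i k) = opscale r T i (J' k).
  by rewrite [LHS](linZ (bounded_linear J'b)) TV.
have evG : evals f T (fun i => J' \o G i \o J).
  case: VG => VG; [left=> i|right=> i].
    have /sum_sotP[Gb VGi] := VG i; apply/sum_sotP; split.
      by apply: bounded_comp => //; exact: bounded_comp.
    move=> x; apply: tends_eq (tends_op J'b (VGi (J x))) => m.
    by rewrite (compress_psum TV) adj_isometry.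
  have [Gb [d [B [d01 VB BG]]]] := VG i.
  split; first by apply: bounded_comp => //; exact: bounded_comp.
  exists d, (fun r => J' \o B r \o J); split=> //.
    move=> r /VB/(sum_normP (bounded_opscale Vb r))[Bb h].
    apply/(sum_normP (bounded_opscale Tb r)); split.
      by apply: bounded_comp => //; exact: bounded_comp.
    have /bounded_opP[_ [M M0 J'M]] := J'b.
    move=> c c0; have Mp : 0 < M + 1 by rewrite ltr_wpDl.
    apply: filterS (h _ (divr_gt0 c0 Mp)) => m hm x.
    have -> : (psum (f i) (opscale r T) m - (J' \o B r \o J)) x =
        J' ((psum (f i) (opscale r V) m - B r) (J x)).
      rewrite [RHS](linB (bounded_linear J'b)) (compress_psum (TVs r)).
      by rewrite adj_isometry.
    apply: le_trans (J'M _) _; apply: le_trans (ler_wpM2l M0 (hm _)) _.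
    rewrite (isometric_nm _ J_iso) mulrA ler_wpM2r ?nm_ge0 //.
    by rewrite mulrCA ger_pMr // ler_pdivrMr // mul1r lerDl ler01.
  apply/sot_cvgP => x; move/sot_cvgP: BG => /(_ (J x)) h.
  exact: (tends_op J'b h).
rewrite -(evals_unique Tb evG TF).
move=> i k /=.
have ct : (forall m x, J' (psum (f i) V m x) = J' (psum (f i) V m (J (J' x)))).
  by move=> m x; rewrite !(compress_psum TV) adj_isometry.
have cts r m x : J' (psum (f i) (opscale r V) m x) =
    J' (psum (f i) (opscale r V) m (J (J' x))).
  by rewrite !(compress_psum (TVs r)) adj_isometry.
have ctl (I : Type) (Fl : set_system I) (FF : ProperFilter Fl) (P : I -> K -> K) A :
    (\forall t \near Fl, forall x, J' (P t x) = J' (P t (J (J' x)))) ->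
    (forall x, tends Fl (fun t => P t x) (A x)) ->
    forall x, J' (A x) = J' (A (J (J' x))).
  move=> PJ PA x; apply: (tends_unique _ (tends_op J'b (PA (J (J' x))))).
  by apply: tends_near (tends_op J'b (PA x)); apply: filterS PJ => t ->.
case: VG => VG.
  have /sum_sotP[Gb VGi] := VG i.
  by apply: (ctl _ \oo _ (psum (f i) V)) => //; apply: nearW => m; exact: ct.
have [Gb [d [B [d01 VB BG]]]] := VG i; have /andP[_ d1] := d01.
apply: (ctl _ (1 : R)^'- _ B); last by apply/sot_cvgP.
apply: filterS (near_left1 d1) => r /VB/(sum_normP (bounded_opscale Vb r))[Bb h].
apply: (ctl _ \oo _ (psum (f i) (opscale r V))).
  by apply: nearW => m; exact: cts.
by move=> x; exact: ncvg_tends.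
Qed.

End Compression.

Section Cyclic.
Context {R : realType} {n : nat} {H K : hilbertType R}.
Variables (J : H -> K) (V W : 'I_n -> K -> K).
Hypothesis Vb : forall i, bounded_op (V i).

Lemma cyclic_vector_range : \bigcup_(a : word n) range (opword V a \o J) =
  range (fun p : word n * H => opword V p.1 (J p.2)).
Proof.
rewrite predeqE => x; split=> [[a _ [h _ <-]]|[[a h] _ <-]]; first by exists (a, h).
by exists a => //; exists h.
Qed.

Lemma closed_span_stable (A : set K) (T : K -> K) : bounded_op T ->
  (forall x, A x -> closed_span A (T x)) ->
  forall x, closed_span A x -> closed_span A (T x).
Proof.
move=> Tb AT x xA; have /bounded_opP[Tl [M M0 TM]] := Tb.
have [A0 AD] := closed_span_is A.
apply: (closed_span_sub (S := [set x | closed_span A (T x)])) xA => //.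
  split=> [|a y z yA zA]; rewrite /= ?(lin0 Tl) //.
  by rewrite Tl; exact: AD.
apply: approx_closed => y yA; apply: (closed_approx (@closed_span_closed _ _ A)) => d d0.
have Mp : 0 < M + 1 by rewrite ltr_wpDl.
have [w wA yw] := yA _ (divr_gt0 d0 Mp); exists (T w) => //.
rewrite -(linB Tl); apply: le_lt_trans (TM _) _.
move: yw; rewrite ltr_pdivlMr // => yw; apply: le_lt_trans yw.
by rewrite mulrC ler_wpM2l ?nm_ge0 // lerDl ler01.
Qed.

Let S := closed_span (\bigcup_(a : word n) range (opword V a \o J)).

Lemma cyclic_span_stable i x : S x -> S (V i x).
Proof.
apply: closed_span_stable => // _ [a _ [h _ <-]].
by apply: (@closed_span_gen _ _ (\bigcup_a _)); exists (i :: a) => //; exists h.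
Qed.

Lemma span_sum (I : Type) (r : seq I) (P : pred I) (F : I -> K) :
  (forall i, P i -> S (F i)) -> S (\sum_(i <- r | P i) F i).
Proof.
have [S0 SD] := closed_span_is (\bigcup_(a : word n) range (opword V a \o J)).
move=> SF; elim/big_ind: _ => // x y Sx Sy; rewrite -[x]scale1r; exact: SD.
Qed.

Lemma spanZ (a : R[i]) x : S x -> S (a *: x).
Proof.
have [S0 SD] := closed_span_is (\bigcup_(a : word n) range (opword V a \o J)).
by move=> Sx; rewrite -[_ *: _]addr0; exact: SD.
Qed.

Lemma cyclic_psum_stable psi (r : R) m x : S x -> S (psum psi (opscale r V) m x).
Proof.
move=> Sx; rewrite psumE; apply: span_sum => k _; apply: span_sum => a _; apply: spanZ.
rewrite opword_scale //; apply: spanZ.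
by elim: (tval a) => //= i b; exact: cyclic_span_stable.
Qed.

Lemma tends_span (I : Type) (F : set_system I) {FF : ProperFilter F} (u : I -> K) l :
  (\forall t \near F, S (u t)) -> tends F u l -> S l.
Proof.
move=> Su ul; apply: (closed_approx (@closed_span_closed _ _ (\bigcup_a _))) => d d0.
have [t [St ut]] := near_ex2 Su (ul _ d0).
by exists (u t); rewrite // nmBC.
Qed.

(** The values f(V) leave invariant every closed subspace invariant under V, so what
    W generates from H lies in what V generates. *)
Lemma cyclic_evals (f : 'I_n -> ncseries R n) : evals f V W -> cyclic_for J W ->
  cyclic_for J V.
Proof.
move=> VW cW; rewrite /cyclic_for -/S -subTset -cW; apply: closed_span_sub.
- exact: closed_span_is.
- exact: closed_span_closed.
have stable i x : S x -> S (W i x).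
  move=> Sx; have S1 m : S (psum (f i) V m x).
    rewrite (_ : V = opscale 1 V); first exact: cyclic_psum_stable.
    by apply: funext => j; rewrite /opscale scale1r.
  case: VW => VW.
    have /sum_sotP[_ h] := VW i.
    by apply: (tends_span (F := \oo) _ (h x)); apply: nearW.
  have [_ [d [B [/andP[_ d1] VB BW]]]] := VW i; move/sot_cvgP/(_ x): BW => h.
  apply: (tends_span _ h); apply: filterS (near_left1 d1) => r.
  move=> /VB/(sum_normP (bounded_opscale Vb r))[_ hr].
  apply: (tends_span (F := \oo) _ (ncvg_tends x hr)).
  by apply: nearW => m; exact: cyclic_psum_stable.
move=> _ [a _ [h _ <-]] /=; elim: a => [|i a IHa] /=; last exact: stable.
by apply: (@closed_span_gen _ _ (\bigcup_a _)); exists [::] => //; exists h.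
Qed.

End Cyclic.

Section IsometricDilationUnique.
Context {R : realType} {n : nat} {H K K' : hilbertType R}.
Variables (F : 'I_n -> H -> H).

(** Common first letters of a and b cancel since W_i^* W_j is 0 or 1, and the
    remaining ones pass to H as adjoints of F. *)
Lemma isometric_dilation_gram (L L' : hilbertType R) (J : H -> L) (W : 'I_n -> L -> L)
    (J' : H -> L') (W' : 'I_n -> L' -> L') a b h h' :
  minimal_isometric_dilation F J W -> minimal_isometric_dilation F J' W' ->
  hdot (opword W a (J h)) (opword W b (J h')) =
  hdot (opword W' a (J' h)) (opword W' b (J' h')).
Proof.
move=> [[_ JJ] Wb Wi WF _] [[_ JJ'] W'b W'i W'F _].
have nil c x y : hdot (J x) (opword W c (J y)) = hdot (J' x) (opword W' c (J' y)).
  elim: c x => [|i c IHc] x /=; first by rewrite JJ JJ'.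
  by rewrite -(adjPl (Wb i)) -(adjPl (W'b i)) WF W'F IHc.
elim: a b => [|i a IHa] b; first exact: nil.
case: b => [|j b]; last by rewrite /= !row_iso_dot // IHa.
rewrite dotC [RHS]dotC; congr (Num.conj _); exact: (nil (i :: a)).
Qed.

Lemma isometric_dilation_unique (J : H -> K) (W : 'I_n -> K -> K)
    (J' : H -> K') (W' : 'I_n -> K' -> K') :
  minimal_isometric_dilation F J W -> minimal_isometric_dilation F J' W' ->
  dilations_isomorphic J W J' W'.
Proof.
move=> dW dW'; have [_ Wb _ _ cW] := dW; have [_ W'b _ _ cW'] := dW'.
move: cW cW'; rewrite /cyclic_for !cyclic_vector_range => cW cW'.
have [|U Uu UW] := gram_unitary _ cW cW'.
  by move=> p q; exact: (isometric_dilation_gram _ _ _ _ dW dW').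
have UW' a h : U (opword W a (J h)) = opword W' a (J' h) := UW (a, h).
exists U; split=> //; first by move=> h; exact: (UW' [::]).
move=> i x; have Ub : bounded_op U by apply: bounded_isometric; case: Uu.
have E : U \o W i = W' i \o U.
  apply: (bounded_eq_span _ _ cW) => [||[a h]]; try exact: bounded_comp.
  by rewrite /= -[W i _]/(opword W (i :: a) (J h)) !UW'.
exact: (congr1 (fun T => T x) E).
Qed.

End IsometricDilationUnique.

(** * Dilations over a model *)

Section ModelDilations.
Context {R : realType} {n : nat} {E : hilbertType R}.
Variables (f : 'I_n -> ncseries R n) (e : word n -> E) (z : 'I_n -> E).
Variables (MZ L : 'I_n -> E -> E).
Let g := inverse_series e z.
Hypothesis fm : fock_model f e z MZ L.
Hypothesis fL : norm_evals MZ f L.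
Variables (M : R) (gM : forall i N, \sum_(k < N) coef2 (g i) k <= M).

Let L_iso := adj_creation (fock_basis fm) (fock_Lb fm) (fock_Le fm).
Let MZb := fock_MZb fm.

Lemma model_series i : ncvg \oo (psum (g i) L) (MZ i).
Proof.
exact: (mult_ncvg (fock_basis fm) (fock_Lb fm) (fock_Le fm) (fock_MZ fm i) (gM i)).
Qed.

Context {H : hilbertType R}.
Variables (T F : 'I_n -> H -> H).
Hypothesis Tb : forall i, bounded_op (T i).
Hypothesis TF : evals f T F.
Hypothesis FT : evals g F T.

(** V is the image of M_Z under the representation that carries L to W. *)
Lemma dilation_of_isometric (K : hilbertType R) (J : H -> K) (W : 'I_n -> K -> K) :
  minimal_isometric_dilation F J W ->
  exists V : 'I_n -> K -> K,
    (forall i, sum_norm (g i) W (V i)) /\ minimal_dilation f g MZ T J V.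
Proof.
move=> [J_iso Wb W_iso FW cW]; have Fb := evals_bounded TF.
have [S [pi [SC SL pi_rep piL]]] :=
  universal_representation (fock_basis fm) (fock_Lb fm) (fock_Le fm) Wb W_iso.
have Wpi : (fun i => pi (L i)) = W by apply: funext.
have SM i : S (MZ i).
  by have [] := rep_series SC pi_rep SL (MZb i) (model_series i).
pose V i := pi (MZ i).
have Vb i : bounded_op (V i) by exact: (rep_bounded pi_rep).
have WV i : ncvg \oo (psum (g i) W) (V i).
  have [_] := rep_series SC pi_rep SL (MZb i) (model_series i); by rewrite Wpi.
have [_ VW] := rep_norm_evals SC pi_rep SM fL; rewrite Wpi in VW.
have evVW := norm_evals_evals Vb VW.
have sWV i : sum_norm (g i) W (V i) by exact/(sum_normP Wb).
have evWV : evals g W V by left=> i; exact: norm_sot.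
have [J' J'b JJ'] := ex_adjoint (bounded_isometric J_iso).
exists V; split=> //; split=> //.
- by split=> //; exists W; split=> //; exact: row_iso_contraction.
- exists pi; split=> //.
  have sub : Cstar_generated MZ `<=` S by move=> A; apply; split.
  case: pi_rep => p1 p2 p3 p4 p5; split=> //.
  + by move=> A /sub; exact: p1.
  + by move=> c A B /sub SA /sub SB; exact: p3.
  + by move=> A B /sub SA /sub SB; exact: p4.
  + by move=> A /sub; exact: p5.
- apply/(coextendsP JJ' Tb Vb).
  apply: (compress_evals J_iso J'b JJ' Fb Wb _ evWV FT).
  exact/(coextendsP JJ' Fb Wb).
exact: (cyclic_evals Vb evVW cW).
Qed.

(** W is the image of L under the representation that carries M_Z to V. *)
Lemma isometric_of_dilation (K : hilbertType R) (J : H -> K) (V : 'I_n -> K -> K) :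
  minimal_dilation f g MZ T J V ->
  exists2 W : 'I_n -> K -> K, minimal_isometric_dilation F J W &
    forall i, ncvg \oo (psum (g i) W) (V i).
Proof.
move=> [J_iso [Vb [FV [VFV _ FVV]]] [pi [pi_rep piV]] TV cV].
have SC := Cstar_generated_subalgebra MZb; set S := Cstar_generated MZ in SC pi_rep.
have SM i : S (MZ i) by move=> A [_]; exact.
have Vpi : (fun i => pi (MZ i)) = V by apply: funext.
have [SL VW] := rep_norm_evals SC pi_rep SM fL; rewrite Vpi in VW.
pose W i := pi (L i); have Wb i : bounded_op (W i) by exact: (rep_bounded pi_rep).
have evVW := norm_evals_evals Vb VW.
have [J' J'b JJ'] := ex_adjoint (bounded_isometric J_iso).
have Fb := evals_bounded TF.
exists W => [|i]; last first.
  have [_] := rep_series SC pi_rep SL (MZb i) (model_series i); by rewrite piV.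
split=> //.
- move=> i j x.
  have : pi (adj (L i) \o L j) = pi ((i == j)%:R *: id).
    by congr pi; apply: funext => y; exact: L_iso.
  rewrite (rep_comp pi_rep) //; last exact: (Cstar_adj SC).
  rewrite (rep_adj pi_rep) // (repZ SC pi_rep); last exact: (Cstar_id SC).
  by rewrite (rep_id pi_rep) => /(congr1 (fun A => A x)).
- apply/(coextendsP JJ' Fb Wb).
  apply: (compress_evals J_iso J'b JJ' Tb Vb _ evVW TF).
  exact/(coextendsP JJ' Tb Vb).
have WE : FV = W by exact: (evals_unique Vb VFV evVW).
by rewrite WE in FVV; exact: (cyclic_evals Wb FVV cV).
Qed.

(** V = g(W) is a norm limit of polynomials in W, so a unitary that intertwines the
    row isometries intertwines the dilations. *)
Lemma dilation_unique (K K' : hilbertType R) (J : H -> K) (V : 'I_n -> K -> K)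
    (J' : H -> K') (V' : 'I_n -> K' -> K') :
  minimal_dilation f g MZ T J V -> minimal_dilation f g MZ T J' V' ->
  dilations_isomorphic J V J' V'.
Proof.
move=> /isometric_of_dilation[W dW WV] /isometric_of_dilation[W' dW' WV'].
have [U [Uu UJ UW]] := isometric_dilation_unique dW dW'.
exists U; split=> // i x; have Ub : bounded_op U by apply: bounded_isometric; case: Uu.
apply: (tends_unique (tends_op Ub (ncvg_tends x (WV i)))).
apply: tends_eq (ncvg_tends (U x) (WV' i)) => m.
have word a y : U (opword W a y) = opword W' a (U y).
  by elim: a y => //= j a IHa y; rewrite UW IHa.
rewrite !psumE (lin_sum (bounded_linear Ub)); apply: eq_bigr => k _.
rewrite /hpart /wsum (lin_sum (bounded_linear Ub)); apply: eq_bigr => a _.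
by rewrite (linZ (bounded_linear Ub)) word.
Qed.

End ModelDilations.

Theorem theorem3p6 (R : realType) (n : nat) (f : 'I_n -> ncseries R n)
    (E : hilbertType R) (e : word n -> E) (z : 'I_n -> E) (MZ : 'I_n -> E -> E)
    (f_model : model f e z MZ)
    (f_class : in_Mradb f \/ (in_Mrad f /\ in_Mnorm f))
    (H : hilbertType R) (T : 'I_n -> H -> H)
    (T_domain : in_domain f (inverse_series e z) T) :
  let g := inverse_series e z in
  (exists (K : hilbertType R) (J : H -> K) (V : 'I_n -> K -> K),
     minimal_dilation f g MZ T J V) /\
  (forall (K K' : hilbertType R) (J : H -> K) (V : 'I_n -> K -> K)
          (J' : H -> K') (V' : 'I_n -> K' -> K'),
     minimal_dilation f g MZ T J V -> minimal_dilation f g MZ T J' V' ->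
     dilations_isomorphic J V J' V') /\
  (forall (F : 'I_n -> H -> H), evals f T F ->
   forall (K : hilbertType R) (J : H -> K) (W : 'I_n -> K -> K),
     minimal_isometric_dilation F J W ->
     exists V : 'I_n -> K -> K,
       (forall i, sum_norm (g i) W (V i)) /\ minimal_dilation f g MZ T J V).
Proof.
move=> g; have [L [fm fg]] := model_fock f_model.
have [f_rad fL] : in_Mrad f /\ norm_evals MZ f L.
  case: f_class => [fb|[fr fn]].
    by split; [exact: in_Mradb_rad | exact: bounded_class_norm fm fg fb].
  by split=> //; exact: norm_class_norm fm fg fn.
have [r [C [r01 C0 gC]]] := inverse_radius f_rad fg.
have gM i N : \sum_(k < N) coef2 (g i) k <= C * (1 - r)^-1.
  apply: le_trans (ler_sum (G := fun k : 'I_N => C * r ^+ k) _ _) _ => [k _|].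
    exact: gC.
  by rewrite -mulr_sumr ler_wpM2l // geometric_sum_le.
have [Tb [F [TF F_row FT]]] := T_domain.
have [D D_dot] := defect_vectors (evals_bounded TF) F_row.
have dil := dilation_of_isometric fm fL gM Tb TF FT.
split; last split.
- have [K [J [W dW]]] := isometric_dilation_ex D_dot (evals_bounded TF).
  by have [V [_ dV]] := dil _ _ _ dW; exists K, J, V.
- by move=> K K' J V J' V'; exact: (dilation_unique fm fL gM Tb TF).
by move=> F' TF'; rewrite -(evals_unique Tb TF TF'); exact: dil.
Qed.
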